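(* Let $E$ be a Banach space, let $\alpha\in(0,\frac12]$ and let $p\in[1,2)$ be such that $\alpha=\frac1p-\frac12$. If every function in $C^\alpha([0,1];E)$ is stochastically integrable with respect to a real-valued Brownian motion $W$, then $E$ has stable type $p$.
   Context: $C^\alpha([0,1];E)$ is the space of $\alpha$-Hölder continuous functions $\phi:[0,1]\to E$ with norm $\sup_t\|\phi(t)\|+\sup_{s<t}\|\phi(t)-\phi(s)\|/(t-s)^\alpha$. A (deterministic) strongly measurable function $\phi:[0,1]\to E$ is stochastically integrable with respect to $W$ if $\langle\phi,x^*\rangle\in L^2(0,1)$ for all $x^*\in E^*$ and there exists a strongly measurable random variable $Y:\Omega\to E$ with $\langle Y,x^*\rangle=\int_0^1\langle\phi(t),x^*\rangle\,dW(t)$ almost surely for all $x^*\in E^*$ (Wiener integral). $E$ has stable type $p$ if, for a sequence $(\theta_n)$ of i.i.d. standard symmetric $p$-stable random variables (i.e. $\mathbb{E}e^{i\xi\theta_n}=e^{-|\xi|^p}$) and some (equivalently all) $r\in(0,p)$, there is $C$ with $(\mathbb{E}\|\sum_n\theta_nx_n\|^r)^{1/r}\le C(\sum_n\|x_n\|^p)^{1/p}$ for all finite sequences $(x_n)$ in $E$. *)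

(* Defs.v *)
From HB Require Import structures.
From mathcomp Require Import all_boot all_order all_algebra.
From mathcomp Require Import all_classical all_reals all_analysis.
Set Implicit Arguments. Unset Strict Implicit. Unset Printing Implicit Defensive.
Import Order.TTheory GRing.Theory Num.Def Num.Theory.
Import numFieldNormedType.Exports.
Local Open Scope classical_set_scope.
Local Open Scope ring_scope.

Section Defs.
Context {R : realType}.

Definition dual_elt (E : normedModType R) (f : E -> R) : Prop :=
  (forall (a : R) (x y : E), f (a *: x + y) = a * f x + f y) /\ continuous f.

Definition strongly_measurable d (T : measurableType d) (E : normedModType R)
  (D : set T) (f : T -> E) : Prop :=
  exists g : nat -> T -> E,
    (forall n, finite_set (range (g n))) /\
    (forall n (y : E), measurable (g n @^-1` [set y])) /\
    (forall t, D t -> g n t @[n --> \oo] --> f t).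

Definition holder (E : normedModType R) (alpha : R) (phi : R -> E) : Prop :=
  (exists M : R, forall t, 0 <= t <= 1 -> `|phi t| <= M) /\
  (exists K : R, forall s t, 0 <= s -> s < t -> t <= 1 ->
     `|phi t - phi s| <= K * (t - s) `^ alpha).

Definition indep_fin d (T : measurableType d) (P : probability T R) (n : nat)
  (X : 'I_n -> T -> R) : Prop :=
  (forall i, measurable_fun setT (X i)) /\
  forall A : 'I_n -> set R, (forall i, measurable (A i)) ->
    P [set w | forall i, A i (X i w)] = (\prod_(i < n) P (X i @^-1` A i))%E.

Definition brownian d (T : measurableType d) (P : probability T R)
  (W : R -> T -> R) : Prop :=
  (forall t, measurable_fun setT (W t)) /\
  {ae P, forall w, W 0 w = 0} /\
  (forall (n : nat) (t : nat -> R), 0 <= t 0%N ->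
     (forall k, (k < n)%N -> t k <= t k.+1) -> t n <= 1 ->
     indep_fin P (fun (i : 'I_n) w => W (t i.+1) w - W (t i) w)) /\
  (forall s t, 0 <= s -> s < t -> t <= 1 -> forall A : set R, measurable A ->
     P ((fun w => W t w - W s w) @^-1` A) = normal_prob 0 (Num.sqrt (t - s)) A) /\
  {ae P, forall w, {within `[0, 1], continuous (fun t => W t w)}}.

(** step functions sum_k c_k 1_(a_k, b_k] on [0,1], encoded as (a_k, b_k, c_k) *)
Definition step_adm (s : seq (R * R * R)) : bool :=
  all (fun x => (0 <= x.1.1) && (x.1.1 <= x.1.2) && (x.1.2 <= 1)) s.

Definition step_fun (s : seq (R * R * R)) (t : R) : R :=
  \sum_(x <- s) x.2 * \1_(`]x.1.1, x.1.2]) t.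

Definition step_int d (T : measurableType d) (W : R -> T -> R)
  (s : seq (R * R * R)) (w : T) : R :=
  \sum_(x <- s) x.2 * (W x.1.2 w - W x.1.1 w).

Definition wiener_integral d (T : measurableType d) (P : probability T R)
  (W : R -> T -> R) (f : R -> R) (Z : T -> R) : Prop :=
  measurable_fun setT Z /\
  exists s : nat -> seq (R * R * R),
    (forall n, step_adm (s n)) /\
    (\int[lebesgue_measure]_(t in `[0%R, 1%R]) ((f t - step_fun (s n) t) ^+ 2)%:E)%E
       @[n --> \oo] --> 0%E /\
    (\int[P]_w ((Z w - step_int W (s n) w) ^+ 2)%:E)%E @[n --> \oo] --> 0%E.

Definition stoch_integrable d (T : measurableType d) (P : probability T R)
  (W : R -> T -> R) (E : normedModType R) (phi : R -> E) : Prop :=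
  strongly_measurable (`[0, 1] : set R) phi /\
  (forall xs : E -> R, dual_elt xs ->
     lebesgue_measure.-integrable `[0, 1] (fun t => ((xs (phi t)) ^+ 2)%:E)) /\
  exists Y : T -> E, strongly_measurable setT Y /\
    forall xs : E -> R, dual_elt xs ->
      exists Z : T -> R, wiener_integral P W (xs \o phi) Z /\
        {ae P, forall w, xs (Y w) = Z w}.

(** i.i.d. standard symmetric p-stable sequence: E e^{i xi theta_n} = e^{-|xi|^p},
    written via real and imaginary parts *)
Definition std_sym_stable_seq d (T : measurableType d) (P : probability T R)
  (p : R) (theta : nat -> T -> R) : Prop :=
  (forall n, indep_fin P (fun (i : 'I_n) => theta i)) /\
  (forall (n : nat) (xi : R),
     (\int[P]_w (cos (xi * theta n w))%:E)%E = (expR (- (`|xi| `^ p)))%:E /\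
     (\int[P]_w (sin (xi * theta n w))%:E)%E = 0%E).

Definition stable_type (E : normedModType R) (p : R) : Prop :=
  forall d (T : measurableType d) (P : probability T R) (theta : nat -> T -> R),
    std_sym_stable_seq P p theta ->
    exists r : R, 0 < r < p /\ exists C : R,
      forall (n : nat) (x : 'I_n -> E),
        (poweR (\int[P]_w ((`|\sum_(i < n) theta i w *: x i|) `^ r)%:E) r^-1
          <= (C * (\sum_(i < n) `|x i| `^ p) `^ p^-1)%:E)%E.

End Defs.

(* Main.v *)
(** Split [0,1] into [4^k] slots on every level [k].  If distinct vectors [x_i] of norm at
    most 1 occupy distinct slots, the sum of the bumps [4^(-alpha k) x_i] on these slots is
    bounded in C^alpha, whatever the number of vectors.  A gliding hump construction shows
    that the Wiener integrals of a bounded subset of C^alpha are bounded in probability, as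
    otherwise a rapidly convergent series of bad functions would not be integrable.
    Randomising the signs of the [x_i], the Kahane-Khintchine inequality of Latala and
    Oleszkiewicz turns this into a bound on means, and since the Wiener integral of a bump
    on level [k] is of order [2^(-k)], the averages of [|sum_i +-rho^(k_i) x_i|] stay
    bounded for [rho = 4^(-alpha) / 2 = 4^(-1/p)].

    Let now [sum_i b_i^p <= 1] and let [theta_i] be independent stable variables.  Bounds on
    [1 - cos] show that the probability of [|b_i theta_i| > t] is at most a multiple of
    [b_i^p t^(-p)], so that about [4^k] of the [b_i theta_i] have size [rho^k], just as many
    as there are slots on level [k].  Conditionally on the sizes, symmetrisation and the
    Rademacher bound control the mean of the sum of the [b_i theta_i] truncated at 1; the
    remaining large terms have bounded moments of order 1/2. *)

Require Import Defs.
From HB Require Import structures.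
From mathcomp Require Import all_boot all_order all_algebra.
From mathcomp Require Import all_classical all_reals all_analysis.
From mathcomp Require Import measurable_realfun.
From mathcomp Require Import ring lra zify.
Set Implicit Arguments. Unset Strict Implicit. Unset Printing Implicit Defensive.
Import Order.TTheory GRing.Theory Num.Def Num.Theory.
Import numFieldNormedType.Exports.
Local Open Scope classical_set_scope.
Local Open Scope ring_scope.

(** * Rademacher averages on the discrete cube *)

(** The Wiener integrals of bumps on different levels are dependent, since their slots overlap, so a
    contraction principle for independent variables is out of reach. Instead, the sign average of
    the norm is bounded below by a linear form in the moduli of these integrals. It is built from
    functionals norming the target vectors, has nonnegative coefficients and is exact at the target,
    so taking means involves each bump separately. The same finite family of functionals stands in
    for the norm in the gliding hump.

    The stable variables are known only through their characteristic function, and for p = 1 they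
    have no mean. Hence the dyadic sums of 1 - cos, the square roots of large values and the moment
    of order 1/2. The truncated variables have small means because the sine has mean 0. Rounding to
    multiples of 1/(n+1) makes them finitely valued, so that conditioning, symmetrisation and
    variances become finite sums, at a total cost of at most 1 in norm. The number of terms on level
    k deviates from its mean by about the square root of 4^k, so second moments control the worst
    overload over all levels. *)

Definition ecube n := {ffun 'I_n -> bool}.

Definition flip n (i : 'I_n) (e : ecube n) : ecube n := [ffun j => e j (+) (j == i)].

Definition consb n (b : bool) (e : ecube n) : ecube n.+1 :=
  [ffun i => if unlift ord0 i is Some j then e j else b].

Definition xorb_cube n (s e : ecube n) : ecube n := [ffun i => s i (+) e i].

Section Cube.
Variable R : realType.

Definition avg n (F : ecube n -> R) : R := (2 ^+ n)^-1 * \sum_(e : ecube n) F e.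

(** Normalised so that the Walsh function of a set of k coordinates has energy k; the spectral gap
    is then 1. *)
Definition energy n (F : ecube n -> R) : R :=
  4^-1 * \sum_(i < n) avg (fun e => (F e - F (flip i e)) ^+ 2).

Lemma flipK n (i : 'I_n) : involutive (flip i).
Proof. by move=> e; apply/ffunP => j; rewrite !ffunE addbK. Qed.

Lemma xorb_cubeK n (s : ecube n) : involutive (xorb_cube s).
Proof. by move=> e; apply/ffunP => j; rewrite !ffunE addKb. Qed.

Lemma sum_consb n (F : ecube n.+1 -> R) :
  \sum_e F e = \sum_(e : ecube n) (F (consb false e) + F (consb true e)).
Proof.
pose h (x : bool * ecube n) := consb x.1 x.2.
pose g (e : ecube n.+1) : bool * ecube n := (e ord0, [ffun i => e (lift ord0 i)]).
have hK : cancel h g.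
  move=> [b e]; rewrite /g /h /=; congr (_, _); first by rewrite ffunE unlift_none.
  by apply/ffunP => i; rewrite !ffunE liftK.
have gK : cancel g h.
  move=> e; apply/ffunP => i; rewrite /h /g /= ffunE.
  by case: unliftP => [j ->|->]; rewrite ?ffunE.
rewrite (reindex h) /=; last by exists g => x _; [exact: hK|exact: gK].
rewrite -(pair_bigA _ (fun b e => F (consb b e))) /=.
by rewrite big_bool /= -big_split /=; apply: eq_bigr => e _; rewrite addrC.
Qed.

Lemma avg_consb n (F : ecube n.+1 -> R) :
  avg F = avg (fun e => (F (consb false e) + F (consb true e)) / 2).
Proof.
rewrite /avg sum_consb exprS invfM -mulr_suml; set S := \sum_e _; set c := _^-1.
by rewrite mulrCA; ring.
Qed.

Lemma eq_avg n (F G : ecube n -> R) : F =1 G -> avg F = avg G.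
Proof. by move=> FG; congr (_ * _); apply: eq_bigr. Qed.

Lemma avgD n (F G : ecube n -> R) : avg (fun e => F e + G e) = avg F + avg G.
Proof. by rewrite /avg big_split mulrDr. Qed.

Lemma avgZ n (c : R) (F : ecube n -> R) : avg (fun e => c * F e) = c * avg F.
Proof. by rewrite /avg -mulr_sumr mulrCA. Qed.

Lemma avgB n (F G : ecube n -> R) : avg (fun e => F e - G e) = avg F - avg G.
Proof. by rewrite -[- avg G]mulN1r -avgZ -avgD; apply: eq_avg => e; rewrite mulN1r. Qed.

Lemma avg_sum n (I : finType) (F : I -> ecube n -> R) :
  avg (fun e => \sum_i F i e) = \sum_i avg (F i).
Proof. by rewrite /avg exchange_big /= mulr_sumr. Qed.

Lemma avg_cst n (c : R) : avg (fun _ : ecube n => c) = c.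
Proof.
by rewrite /avg sumr_const card_ffun card_bool card_ord -[c *+ _]mulr_natl natrX mulKf.
Qed.

Lemma le_avg n (F G : ecube n -> R) : (forall e, F e <= G e) -> avg F <= avg G.
Proof. by move=> FG; rewrite ler_wpM2l ?invr_ge0 ?exprn_ge0// ler_sum. Qed.

Lemma avg_ge0 n (F : ecube n -> R) : (forall e, 0 <= F e) -> 0 <= avg F.
Proof. by move=> F0; rewrite mulr_ge0 ?invr_ge0 ?exprn_ge0// sumr_ge0. Qed.

Lemma avg_inv n (h : ecube n -> ecube n) (F : ecube n -> R) :
  involutive h -> avg (fun e => F (h e)) = avg F.
Proof.
by move=> hK; rewrite /avg [in RHS](reindex h)//; exists h => x _; exact: hK.
Qed.

Lemma avg0 (F : ecube 0 -> R) (e : ecube 0) : avg F = F e.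
Proof.
by rewrite -[RHS](avg_cst 0); apply: eq_avg => e'; congr F; apply/ffunP => -[].
Qed.

Lemma flip_ord0 n b (e : ecube n) : flip ord0 (consb b e) = consb (~~ b) e.
Proof.
apply/ffunP => i; rewrite !ffunE; case: unliftP => [j ->|->].
  by rewrite eq_sym eq_liftF addbF.
by rewrite eqxx addbT.
Qed.

Lemma flip_lift n b (j : 'I_n) (e : ecube n) :
  flip (lift ord0 j) (consb b e) = consb b (flip j e).
Proof.
apply/ffunP => i; rewrite !ffunE; case: unliftP => [k ->|->].
  by rewrite ffunE (inj_eq lift_inj).
by rewrite eq_liftF addbF.
Qed.

(** [half_sum] and [half_diff] collect the Walsh coefficients of the sets that avoid, respectively
    contain, the first coordinate. *)
Definition half_sum n (F : ecube n.+1 -> R) e := (F (consb false e) + F (consb true e)) / 2.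
Definition half_diff n (F : ecube n.+1 -> R) e := (F (consb false e) - F (consb true e)) / 2.

Lemma avg_sqr_consb n (F : ecube n.+1 -> R) :
  avg (fun e => F e ^+ 2) =
  avg (fun e => half_sum F e ^+ 2) + avg (fun e => half_diff F e ^+ 2).
Proof.
rewrite avg_consb -avgD; apply: eq_avg => e; rewrite /half_sum /half_diff.
by field.
Qed.

Lemma energy_consb n (F : ecube n.+1 -> R) :
  energy F = energy (half_sum F) + energy (half_diff F) + avg (fun e => half_diff F e ^+ 2).
Proof.
rewrite /energy big_ord_recl mulrDr addrC; congr (_ + _).
  rewrite -mulrDr; congr (_ * _); rewrite -big_split/=; apply: eq_bigr => j _.
  rewrite avg_consb -avgD; apply: eq_avg => e; rewrite !flip_lift /half_sum /half_diff.
  by field.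
rewrite avg_consb -avgZ; apply: eq_avg => e; rewrite !flip_ord0 /half_diff/=.
by field.
Qed.

Lemma energy_ge0 n (F : ecube n -> R) : 0 <= energy F.
Proof.
by rewrite mulr_ge0 ?sumr_ge0// => i _; apply: avg_ge0 => e; exact: sqr_ge0.
Qed.

(** Every Walsh function other than the constant has energy at least 1. In the induction the extra
    square of [half_diff] in [energy_consb] pays for all sets containing the first coordinate, and
    the induction hypothesis for the others. *)
Lemma poincare n (F : ecube n -> R) :
  avg (fun e => F e ^+ 2) - avg F ^+ 2 <= energy F.
Proof.
elim: n F => [|n IH] F.
  by rewrite !(avg0 _ [ffun=> false]) subrr energy_ge0.
rewrite avg_sqr_consb energy_consb [avg F]avg_consb.
have := IH (half_sum F); have := energy_ge0 (half_diff F).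
by rewrite /half_sum; lra.
Qed.

Definition negc n (e : ecube n) : ecube n := [ffun i => ~~ e i].

Lemma negc_consb n b (e : ecube n) : negc (consb b e) = consb (~~ b) (negc e).
Proof. by apply/ffunP => i; rewrite !ffunE; case: unliftP => [j _|_]; rewrite ?ffunE. Qed.

Lemma negcK n : involutive (@negc n).
Proof. by move=> e; apply/ffunP => j; rewrite !ffunE negbK. Qed.

(* Even functions have no Walsh coefficients of degree 1, whence the factor 2. *)
Lemma poincare_even n (F : ecube n -> R) : (forall e, F (negc e) = F e) ->
  2 * (avg (fun e => F e ^+ 2) - avg F ^+ 2) <= energy F.
Proof.
elim: n F => [|n IH] F evF.
  by rewrite !(avg0 _ [ffun=> false]) subrr mulr0 energy_ge0.
have evF' b e : F (consb b (negc e)) = F (consb (~~ b) e).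
  by rewrite -(evF (consb b _)) negc_consb negcK.
rewrite avg_sqr_consb energy_consb [avg F]avg_consb.
have /IH : forall e, half_sum F (negc e) = half_sum F e.
  by move=> e; rewrite /half_sum !evF'/= addrC.
(* [half_diff F] is odd, hence has mean 0: its own energy bounds its square once, and the extra term
   of [energy_consb] supplies the second copy. *)
have := poincare (half_diff F).
suff -> : avg (half_diff F) = 0 by rewrite /half_sum; lra.
have : avg (half_diff F) = - avg (half_diff F).
  rewrite -[LHS](avg_inv _ (@negcK n)) -[RHS]mulN1r -avgZ; apply: eq_avg => e.
  by rewrite /half_diff !evF'/=; ring.
by lra.
Qed.

Variable V : lmodType R.

Definition seminorm (N : V -> R) :=
  (forall x y, N (x + y) <= N x + N y) /\ (forall a x, N (a *: x) = `|a| * N x).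

Definition rsum n (e : ecube n) (y : 'I_n -> V) : V := \sum_i (-1) ^+ (e i) *: y i.

Variable N : V -> R.
Hypothesis semN : seminorm N.

Lemma seminorm0 : N 0 = 0.
Proof. by rewrite -(scale0r 0) semN.2 normr0 mul0r. Qed.

Lemma seminormN x : N (- x) = N x.
Proof. by rewrite -scaleN1r semN.2 normrN1 mul1r. Qed.

Lemma seminorm_ge0 x : 0 <= N x.
Proof. by have := semN.1 x (- x); rewrite subrr seminorm0 seminormN; lra. Qed.

Lemma seminorm_sum (I : Type) (r : seq I) (P : pred I) (F : I -> V) :
  N (\sum_(i <- r | P i) F i) <= \sum_(i <- r | P i) N (F i).
Proof.
elim/big_rec2: _ => [|i x y _ le_xy]; first by rewrite seminorm0.
by apply: le_trans (semN.1 _ _) _; rewrite lerD2l.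
Qed.

Lemma rsum_negc n (e : ecube n) y : rsum (negc e) y = - rsum e y.
Proof.
rewrite /rsum -sumrN; apply: eq_bigr => i _; rewrite ffunE -scaleNr; congr (_ *: _).
by case: (e i) => /=; rewrite ?opprK.
Qed.

Lemma rsum_flip n (i : 'I_n) (e : ecube n) y :
  rsum (flip i e) y = rsum e y - (2 * (-1) ^+ (e i)) *: y i.
Proof.
rewrite /rsum (bigD1 i)//= [in RHS](bigD1 i)//= ffunE eqxx addbT.
under eq_bigr => j ji do rewrite ffunE (negbTE ji) addbF.
rewrite addrAC -scalerBl; congr (_ *: _ + _).
by case: (e i) => /=; ring.
Qed.

(** Each [y i] keeps its sign under n - 1 of the flips and changes it under one. With the triangle
    inequality this yields the Laplacian bound. *)
Lemma sum_rsum_flip n (e : ecube n) y :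
  \sum_i rsum (flip i e) y = (n%:R - 2) *: rsum e y.
Proof.
under eq_bigr do rewrite rsum_flip.
rewrite big_split/= sumr_const card_ord sumrN scalerBl scaler_nat; congr (_ - _).
by rewrite /rsum scaler_sumr; apply: eq_bigr => i _; rewrite scalerA.
Qed.

(* The discrete Laplacian of [f e = N (rsum e y)] is bounded by [f]. *)
Lemma laplacian_le n (e : ecube n) y :
  \sum_i (N (rsum e y) - N (rsum (flip i e) y)) <= 2 * N (rsum e y).
Proof.
rewrite big_split/= sumr_const card_ord sumrN -mulr_natl.
have := seminorm_sum (index_enum 'I_n) xpredT (fun i => rsum (flip i e) y).
rewrite sum_rsum_flip semN.2.
have := seminorm_ge0 (rsum e y); have := ler_norm (n%:R - 2 : R).
set a := N _; set S := \sum_(i < n) _; set b := `|_|.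
move=> ba a0; have := ler_wpM2r a0 ba; lra.
Qed.

(** The norm of a Rademacher sum is even in the signs, so twice its variance is at most its energy.
    The energy is half the mean of f times its Laplacian, hence at most the mean of f^2. Rearranging
    gives the constant 2. *)
Lemma latala_oleszkiewicz n (y : 'I_n -> V) :
  avg (fun e => N (rsum e y) ^+ 2) <= 2 * avg (fun e => N (rsum e y)) ^+ 2.
Proof.
have H : 2 * (avg (fun e => N (rsum e y) ^+ 2) - avg (fun e => N (rsum e y)) ^+ 2) <=
    energy (fun e => N (rsum e y)).
  by apply: poincare_even => e; rewrite rsum_negc seminormN.
suff : energy (fun e => N (rsum e y)) <= avg (fun e => N (rsum e y) ^+ 2).
  by move: H; lra.
have -> : energy (fun e => N (rsum e y)) =
   2^-1 * avg (fun e => N (rsum e y) * \sum_i (N (rsum e y) - N (rsum (flip i e) y))).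
  under [in RHS]eq_avg do rewrite mulr_sumr.
  rewrite avg_sum /energy !mulr_sumr; apply: eq_bigr => i _.
  set f := fun e => N (rsum e y).
  have e1 : avg (fun e => f (flip i e) ^+ 2) = avg (fun e => f e ^+ 2).
    by rewrite -[RHS](avg_inv _ (flipK i)).
  (* Discrete integration by parts: with f' for the flipped f, (f - f')^2 = 2 f (f - f') + f'^2 -
     f^2, and the last two squares have equal means because the flip permutes the cube. *)
  transitivity (4^-1 * (2 * avg (fun e => f e * (f e - f (flip i e))) +
     (avg (fun e => f (flip i e) ^+ 2) - avg (fun e => f e ^+ 2)))); last first.
    by rewrite e1; field.
  by rewrite -avgB -avgZ -avgD; congr (_ * _); apply: eq_avg => e; rewrite /f; ring.
rewrite -avgZ; apply: le_avg => e.
rewrite -[leRHS]mul1r -[in leRHS](mulVf (_ : 2 != 0 :> R))// -mulrA ler_wpM2l ?invr_ge0//.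
rewrite expr2 mulrCA ler_wpM2l ?seminorm_ge0//; exact: laplacian_le.
Qed.

(* Paley--Zygmund: a small quantile controls the mean. *)
Lemma avg_le_quantile n (y : 'I_n -> V) (M : R) :
  avg (fun e => (M < N (rsum e y))%R%:R) <= 8^-1 -> avg (fun e => N (rsum e y)) <= 2 * M.
Proof.
set f := fun e => N (rsum e y); set q := avg _ => q8.
have lo : avg (fun e => f e ^+ 2) <= 2 * avg f ^+ 2 := latala_oleszkiewicz y.
have f0 e : 0 <= f e := seminorm_ge0 _.
have M0 : 0 <= M.
  rewrite leNgt; apply/negP => M0; move: q8; rewrite /q.
  under eq_avg => e do rewrite (lt_le_trans M0 (f0 e)).
  by rewrite avg_cst/=; lra.
have [->|m0] := eqVneq (avg f) 0; first by lra.
have {}m0 : 0 < avg f by rewrite lt0r m0 avg_ge0.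
(* AM-GM: [f 1_(f > M) <= f^2 / (8 m) + 2 m 1_(f > M)] *)
have H : avg f <= avg (fun e => M + ((8 * avg f)^-1 * f e ^+ 2 + 2 * avg f * (M < f e)%R%:R)).
  apply: le_avg => e.
  have [Mf|fM] := ltP M (f e); last first.
    by rewrite mulr0 addr0 (le_trans fM)// lerDl mulr_ge0 ?sqr_ge0// invr_ge0; lra.
  rewrite mulr1; apply: (@le_trans _ _ (0 + f e)); first by rewrite add0r.
  rewrite lerD// -subr_ge0.
  have -> : (8 * avg f)^-1 * f e ^+ 2 + 2 * avg f - f e =
      (8 * avg f)^-1 * (f e - 4 * avg f) ^+ 2 by field; rewrite gt_eqF.
  by rewrite mulr_ge0 ?sqr_ge0// invr_ge0; lra.
move: H; rewrite avgD avg_cst avgD !avgZ -/q => H.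
have h1 : (8 * avg f)^-1 * avg (fun e => f e ^+ 2) <= 4^-1 * avg f.
  rewrite mulrC ler_pdivrMr; last by lra.
  by apply: le_trans lo _; rewrite expr2; lra.
have h2 : 2 * avg f * q <= 4^-1 * avg f.
  by rewrite mulrAC; have := ler_wpM2l (ltW m0) q8; lra.
by lra.
Qed.
End Cube.

(** * Norming functionals *)

Section HahnBanach.
Variables (R : realType) (E : normedModType R).

(* Linear functionals on subspaces are encoded by their graphs. *)
Definition lin_graph (G : set (E * R)) :=
  forall (t : R) x a y b, G (x, a) -> G (y, b) -> G (t *: x + y, t * a + b).

(** Domination also makes a linear graph single-valued: the difference of two values at one point is
    a value at 0, hence at most 0. *)
Definition dominated_graph (G : set (E * R)) := forall x a, G (x, a) -> a <= `|x|.

(** The one-dimensional step of Hahn-Banach. Domination on x + t x0 reduces, by scaling with the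
    modulus of t, to lower bounds on [c] for t < 0 and upper bounds for t > 0; [key] says that they
    are compatible, and [c] is the supremum of the lower ones. *)
Lemma graph_extension (G : set (E * R)) (x0 : E) :
  lin_graph G -> dominated_graph G -> G (0, 0) ->
  exists c, dominated_graph [set u | exists x a t, G (x, a) /\ u = (x + t *: x0, a + t * c)].
Proof.
move=> linG domG G0.
have key x a y b : G (x, a) -> G (y, b) -> a - `|x - x0| <= `|y + x0| - b.
  move=> Gx Gy; have := domG _ _ (linG 1 _ _ _ _ Gx Gy).
  rewrite scale1r mul1r => h.
  have e : x + y = (x - x0) + (y + x0) by rewrite addrACA addNr addr0.
  by rewrite e in h; have := le_trans h (ler_normD _ _); lra.
pose S := [set r | exists x a, G (x, a) /\ r = a - `|x - x0|].
have supS : has_sup S.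
  split; first by exists (0 - `|0 - x0|), 0, 0.
  by exists (`|0 + x0| - 0) => _ [x [a [Gx ->]]]; exact: key.
pose c := sup S; exists c.
have lo x a : G (x, a) -> a - `|x - x0| <= c.
  by move=> Gx; apply: ub_le_sup; [case: supS|exists x, a].
have hi x a : G (x, a) -> c <= `|x + x0| - a.
  move=> Gx; apply: ge_sup; first by case: supS.
  by move=> _ [y [b [Gy ->]]]; exact: key.
have sc (t : R) x a : G (x, a) -> G (t *: x, t * a).
  by move=> Gx; have := linG t _ _ _ _ Gx G0; rewrite !addr0.
move=> _ _ [x [a [t [Gx [-> ->]]]]].
have [t0|t0|->] := ltgtP t 0; last by rewrite mul0r scale0r !addr0; exact: domG.
- have s0 : 0 < - t by rewrite oppr_gt0.
  have := lo _ _ (sc (- t)^-1 _ _ Gx).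
  have -> : `|(- t)^-1 *: x - x0| = (- t)^-1 * `|x + t *: x0|.
    have -> : (- t)^-1 *: x - x0 = (- t)^-1 *: (x + t *: x0).
      by rewrite scalerDr scalerA invrN mulNr mulVf ?scaleN1r ?lt_eqF.
    by rewrite normrZ gtr0_norm// invr_gt0.
  by rewrite -mulrBr mulrC ler_pdivrMr//; lra.
- have := hi _ _ (sc t^-1 _ _ Gx).
  have -> : `|t^-1 *: x + x0| = t^-1 * `|x + t *: x0|.
    have -> : t^-1 *: x + x0 = t^-1 *: (x + t *: x0).
      by rewrite scalerDr scalerA mulVf ?scale1r// gt_eqF.
    by rewrite normrZ gtr0_norm// invr_gt0.
  by rewrite -mulrBr mulrC ler_pdivlMr//; lra.
Qed.

Lemma norming_functional (z : E) :
  exists f : E -> R, [/\ dual_elt f, forall y, `|f y| <= `|y| & f z = `|z|].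
Proof.
pose G0 : set (E * R) := [set u | exists t : R, u = (t *: z, t * `|z|)].
(* The union of an empty chain is the empty graph, so [P] must admit it; that is why containing [G0]
   is demanded of nonempty graphs only. A maximal graph is nonempty, since [G0] extends the empty
   one. *)
pose P : set (set (E * R)) :=
  [set G | [/\ lin_graph G, dominated_graph G & G !=set0 -> G0 `<=` G]].
have [F FP totF|G [[linG domG G0G] maxG]] := @Zorn_bigcup _ P.
  split.
  - move=> t x a y b [A FA Ax] [B FB By].
    have [AB|BA] := totF _ _ FA FB.
      by exists B => //; have [lB _ _] := FP _ FB; apply: lB => //; exact: AB.
    by exists A => //; have [lA _ _] := FP _ FA; apply: lA => //; exact: BA.
  - by move=> x a [A FA Ax]; have [_ dA _] := FP _ FA; exact: dA.
  - move=> [u [A FA Au]] v G0v; exists A => //; have [_ _ sA] := FP _ FA.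
    by apply: sA => //; exists u.
have G0z : G0 (z, `|z|) by exists 1; rewrite scale1r mul1r.
have Gne : G !=set0.
  apply: contrapT => Gn.
  have Ge : G = set0 by rewrite -subset0 => u Gu; apply: Gn; exists u.
  apply: (maxG G0); first by rewrite Ge; split => // /(_ _ G0z).
  split => //.
  - move=> t _ _ _ _ [s [-> ->]] [r [-> ->]]; exists (t * s + r).
    by rewrite scalerA -scalerDl mulrDl mulrA.
  - by move=> _ _ [s [-> ->]]; rewrite normrZ ler_wpM2r// ler_norm.
  - by move=> _ u.
have {}G0G := G0G Gne.
have G00 : G (0, 0) by apply: G0G; exists 0; rewrite scale0r mul0r.
have sc (t : R) x a : G (x, a) -> G (t *: x, t * a).
  by move=> Gx; have := linG t _ _ _ _ Gx G00; rewrite !addr0.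
have tot x0 : exists a, G (x0, a).
  apply: contrapT => nG.
  have [c domB] := graph_extension x0 linG domG G00.
  set B := (X in dominated_graph X) in domB.
  have GB : G `<=` B by move=> [x a] Gx; exists x, a, 0; rewrite scale0r mul0r !addr0.
  have Bx0 : B (x0, c) by exists 0, 0, 1; rewrite scale1r mul1r !add0r.
  apply: (maxG B); first by split => // /(_ _ Bx0) Gx0; apply: nG; exists c.
  split => //; last by move=> _; exact: subset_trans GB.
  move=> t _ _ _ _ [x [a [s [Gx [-> ->]]]]] [y [b [r [Gy [-> ->]]]]].
  exists (t *: x + y), (t * a + b), (t * s + r); split; first exact: linG.
  by rewrite scalerDr scalerA addrACA -scalerDl mulrDr mulrA addrACA -mulrDl.
have uniqG x a b : G (x, a) -> G (x, b) -> a = b.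
  have half u v : G (x, u) -> G (x, v) -> u <= v.
    move=> Gu Gv; have := domG _ _ (linG (-1) _ _ _ _ Gv Gu).
    by rewrite scaleN1r addNr normr0; lra.
  by move=> Gu Gv; apply/eqP; rewrite eq_le !half.
have [f fG] := choice tot.
have flin a x y : f (a *: x + y) = a * f x + f y.
  by apply: (uniqG (a *: x + y)) => //; exact: linG.
have f0 : f 0 = 0 by exact: (uniqG 0).
have fbnd y : `|f y| <= `|y|.
  rewrite ler_norml domG// andbT lerNl.
  by have := domG _ _ (sc (-1) _ _ (fG y)); rewrite scaleN1r normrN mulN1r.
exists f; split => //; last by apply: (uniqG z) => //; exact: G0G.
split=> // x; apply/cvgrPdist_lt => e e0.
near=> t; have -> : f x - f t = f (x - t).
  by have -> : x - t = (-1) *: t + x; rewrite ?flin ?mulN1r ?scaleN1r addrC.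
apply: le_lt_trans (fbnd _) _; near: t.
exact: cvgr_dist_lt.
Unshelve. all: by end_near. Qed.

End HahnBanach.

(** * Hoelder sums of bumps *)

Section Bumps.
Variable R : realType.
Implicit Types (u v t s eta a : R).

(** A trapezoid on [0,1]: the slopes are 1/eta on the two end pieces of length [eta], and the value
    is 1 in between. *)
Definition bump eta u : R := maxr 0 (minr 1 (minr u (1 - u) / eta)).

Lemma bump_ge0 eta u : 0 <= bump eta u.
Proof. by rewrite le_max lexx. Qed.

Lemma bump_le1 eta u : bump eta u <= 1.
Proof. by rewrite ge_max ler01 ge_min lexx. Qed.

Lemma bump_eq0 eta u : 0 < eta -> ~~ (0 < u < 1) -> bump eta u = 0.
Proof.
move=> eta0; rewrite negb_and -!leNgt => u01.
apply/max_idPl; rewrite ge_min; apply/orP; right.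
rewrite pmulr_lle0 ?invr_gt0// ge_min subr_le0.
by case/orP: u01 => ->; rewrite ?orbT.
Qed.

Lemma bump_eq1 eta u : 0 < eta -> eta <= u <= 1 - eta -> bump eta u = 1.
Proof.
move=> eta0 /andP[u1 u2]; rewrite /bump.
have -> : minr 1 (minr u (1 - u) / eta) = 1.
  by apply/min_idPl; rewrite ler_pdivlMr// mul1r le_min u1; lra.
by apply/max_idPr.
Qed.

Lemma bump_lip eta u v : 0 < eta -> `|bump eta u - bump eta v| <= `|u - v| / eta.
Proof.
move=> eta0.
suff H x y : bump eta x <= bump eta y + `|x - y| / eta.
  by rewrite ler_norml; have := H u v; have := H v u; rewrite [`|v - u|]distrC; lra.
have d0 : 0 <= `|x - y| / eta by rewrite divr_ge0// ltW.
have h : minr x (1 - x) / eta <= minr y (1 - y) / eta + `|x - y| / eta.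
  rewrite -mulrDl ler_pM2r ?invr_gt0//.
  have := ler_norm (x - y); have := ler_norm (- (x - y)); rewrite normrN => h1 h2.
  rewrite minEle [in leRHS]minEle.
  by case: ifPn; case: ifPn; rewrite -?ltNge; lra.
rewrite /bump; move: h d0; move: (_ / eta) (_ / eta) (_ / eta) => p q w pq w0.
by rewrite !maxEle !minEle; do 4 ?[case: ifPn]; rewrite -?ltNge; lra.
Qed.

Lemma bump_continuous eta : 0 < eta -> continuous (bump eta).
Proof.
move=> eta0 u; apply/cvgrPdist_lt => e e0; near=> t.
apply: le_lt_trans (bump_lip _ _ eta0) _.
rewrite ltr_pdivrMr//; near: t; apply: cvgr_dist_lt => //; exact: mulr_gt0.
Unshelve. all: by end_near. Qed.

Lemma sum_indic_le1 (I : finType) (A b : pred I) :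
  (forall i i', A i -> A i' -> b i -> b i' -> i = i') ->
  \sum_(i | A i) (b i)%:R <= 1 :> R.
Proof.
move=> H; have [[i /andP[Ai bi]]|/= no] := pselect (exists i, A i && b i).
  rewrite (bigD1 i)//= bi big1 ?addr0// => i' /andP[Ai' /negP ni].
  by case: (boolP (b i')) => // bi'; case: ni; apply/eqP; exact: H.
rewrite big1// => i Ai; case: (boolP (b i)) => // bi.
by case: no; exists i; rewrite Ai.
Qed.

Lemma slot_uniq u (j j' : nat) : 0 < u - j%:R < 1 -> 0 < u - j'%:R < 1 -> j = j'.
Proof.
move=> /andP[a1 a2] /andP[b1 b2]; apply/eqP; rewrite eqn_leq; apply/andP; split.
  by rewrite -ltnS -(ltr_nat R) -natr1; lra.
by rewrite -ltnS -(ltr_nat R) -natr1; lra.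
Qed.

Lemma sum_bump_le1 eta u (I : finType) (A : pred I) (j : I -> nat) : 0 < eta ->
  (forall i i', A i -> A i' -> j i = j i' -> i = i') ->
  \sum_(i | A i) bump eta (u - (j i)%:R) <= 1.
Proof.
move=> eta0 injA.
apply: le_trans (sum_indic_le1 (A := A) (b := fun i => 0 < u - (j i)%:R < 1) _); last first.
  by move=> i i' Ai Ai' bi bi'; apply: injA => //; apply: (@slot_uniq u).
apply: ler_sum => i _; case: (boolP (0 < u - (j i)%:R < 1)) => b; first exact: bump_le1.
by rewrite bump_eq0.
Qed.

(** A term vanishes unless [u] or [v] is inside its slot, and each point is inside at most one slot.
    So at most two terms survive, whence the factor 2. *)
Lemma sum_bump_lip eta u v (I : finType) (A : pred I) (j : I -> nat) : 0 < eta ->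
  (forall i i', A i -> A i' -> j i = j i' -> i = i') ->
  \sum_(i | A i) `|bump eta (u - (j i)%:R) - bump eta (v - (j i)%:R)| <=
  2 * minr 1 (`|u - v| / eta).
Proof.
move=> eta0 injA; set m := minr _ _.
have m0 : 0 <= m by rewrite le_min ler01 divr_ge0// ltW.
pose b u i := 0 < u - (j i)%:R < 1.
have sb w : \sum_(i | A i) (b w i)%:R <= 1 :> R.
  apply: sum_indic_le1 => i i' Ai Ai' bi bi'.
  by apply: injA => //; apply: (@slot_uniq w).
apply: (@le_trans _ _ (m * (\sum_(i | A i) (b u i)%:R + \sum_(i | A i) (b v i)%:R))).
  rewrite -big_split mulr_sumr; apply: ler_sum => i _ /=.
  have hm : `|bump eta (u - (j i)%:R) - bump eta (v - (j i)%:R)| <= m.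
    rewrite le_min; apply/andP; split; last first.
      by apply: le_trans (bump_lip _ _ eta0) _; rewrite opprB addrA subrK.
    rewrite ler_norml; have := bump_le1 eta (u - (j i)%:R).
    have := bump_ge0 eta (u - (j i)%:R); have := bump_le1 eta (v - (j i)%:R).
    have := bump_ge0 eta (v - (j i)%:R); lra.
  have [bu|bu] := boolP (b u i).
    by apply: le_trans hm _; rewrite ler_peMr// lerDl.
  have [bv|bv] := boolP (b v i); first by rewrite add0r mulr1.
  by rewrite !bump_eq0// subrr normr0 addr0 mulr0.
by rewrite mulrC ler_wpM2r//; have := sb u; have := sb v; lra.
Qed.

Lemma geo_sum_le a m : 0 <= a -> a < 1 -> \sum_(k < m) a ^+ k <= (1 - a)^-1.
Proof.
move=> a0 a1; have c0 : 0 < 1 - a by lra.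
rewrite -(ler_pM2l c0) divff ?gt_eqF// -[X in X * _]opprB mulNr -subrX1.
have : 0 <= a ^+ m by exact: exprn_ge0.
by lra.
Qed.

(* The subtracted linear term is what makes the induction on the number of scales close. *)
Lemma scale_sum_le a alpha m dl :
  2^-1 <= a -> a < 1 -> 0 < alpha -> alpha <= 1 -> a * 4 `^ alpha = 1 ->
  0 < dl -> dl <= 1 ->
  \sum_(k < m) a ^+ k * minr 1 (4 ^+ k * dl) <= 2 * ((1 - a)^-1 + 1) * dl `^ alpha - dl.
Proof.
move=> a2 a1 alpha0 alpha1 a4.
have a0 : 0 <= a by lra.
have b1 : 2 <= (1 - a)^-1 by rewrite -[leLHS]invrK lef_pV2 ?posrE; lra.
have ub k d : \sum_(i < k) a ^+ i * minr 1 (4 ^+ i * d) <= (1 - a)^-1.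
  apply: le_trans (geo_sum_le k a0 a1); apply: ler_sum => i _.
  by rewrite ler_piMr ?ge_min ?lexx// exprn_ge0.
move: b1 ub; move: (1 - a)^-1 => b b1 ub.
(* For d at least 1/4 the geometric series alone suffices, because d^alpha >= 4^(-alpha) = a >= 1/2;
   this fixes the factor 2 in the statement. *)
have big d : 4^-1 <= d -> d <= 1 -> b <= 2 * (b + 1) * d `^ alpha - d.
  move=> d4 d1; have : a <= d `^ alpha.
    have -> : a = 4^-1 `^ alpha.
      rewrite -powR_inv1// -powRrM mulN1r powRN.
      by apply: (mulIf (x := 4 `^ alpha)); rewrite ?a4 ?mulVf// gt_eqF ?powR_gt0.
    by rewrite ge0_ler_powR ?nnegrE//; lra.
  move=> h; have : 0 <= (b + 1) * (d `^ alpha - 2^-1) by apply: mulr_ge0; lra.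
  by lra.
elim: m dl => [|m IH] dl dl0 dl1.
  rewrite big_ord0; have : dl <= dl `^ alpha by apply: ger1_powR => //; rewrite dl0.
  have : 0 <= b * dl `^ alpha by rewrite mulr_ge0 ?powR_ge0//; lra.
  by lra.
have [d4|d4] := leP 4^-1 dl; first by apply: le_trans (big _ d4 dl1).
rewrite big_ord_recl /= expr0 expr0 !mul1r (min_idPr _)//.
(* Self-similarity: dropping level 0 multiplies [dl] by 4 and the sum by [a], which leaves a
   dl^alpha bound unchanged since a 4^alpha = 1. *)
have -> : \sum_(i < m) a ^+ fintype.bump 0 i * minr 1 (4 ^+ fintype.bump 0 i * dl) =
    a * \sum_(i < m) a ^+ i * minr 1 (4 ^+ i * (4 * dl)).
  rewrite mulr_sumr; apply: eq_bigr => i _.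
  by rewrite /fintype.bump/= add1n !exprS -mulrA; congr (_ * (_ * minr 1 _)); ring.
have h4 : a * (4 * dl) `^ alpha = dl `^ alpha.
  by rewrite powRM ?ltW// mulrA a4 mul1r.
have {}IH : \sum_(i < m) a ^+ i * minr 1 (4 ^+ i * (4 * dl)) <=
  2 * (b + 1) * (4 * dl) `^ alpha - 4 * dl by apply: IH; lra.
have := ler_wpM2l a0 IH.
have -> : a * (2 * (b + 1) * (4 * dl) `^ alpha - 4 * dl) =
  2 * (b + 1) * dl `^ alpha - 4 * a * dl by rewrite -h4; ring.
(* Level 0 adds [dl], while the linear term has become -4 a dl; as a >= 1/2, their sum is at most
   -dl. *)
have : 0 <= (a - 2^-1) * dl by apply: mulr_ge0; lra.
by lra.
Qed.

End Bumps.

(** * Vector-valued sums of bumps over all levels *)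

Section BumpSums.
Variables (R : realType) (E : normedModType R).
Implicit Types (u v t s eta a : R).

Definition slot_inj n (lev pos : 'I_n -> nat) :=
  forall i i', lev i = lev i' -> pos i = pos i' -> i = i'.

Definition bump_at eta (k j : nat) t : R := bump eta (4 ^+ k * t - j%:R).

Definition bump_sum eta a n (lev pos : 'I_n -> nat) (x : 'I_n -> E) t : E :=
  \sum_i (a ^+ lev i * bump_at eta (lev i) (pos i) t) *: x i.

Lemma sum_levels_le n (lev : 'I_n -> nat) (F : 'I_n -> R) (B : nat -> R) a : 0 <= a ->
  (forall k, \sum_(i | lev i == k) F i <= B k) ->
  exists m, \sum_i a ^+ lev i * F i <= \sum_(k < m) a ^+ k * B k.
Proof.
move=> a0 FB; pose m := (\max_i lev i).+1; exists m.
have ltm i : (lev i < m)%N by rewrite ltnS leq_bigmax.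
rewrite (partition_big (fun i => Ordinal (ltm i)) xpredT)//=.
apply: ler_sum => k _; rewrite (eq_bigr (fun i => a ^+ k * F i)).
  by rewrite -mulr_sumr ler_wpM2l ?exprn_ge0//; exact: FB.
by move=> i /eqP <-.
Qed.

Lemma bump_sum_bounded eta a n (lev pos : 'I_n -> nat) (x : 'I_n -> E) t :
  0 < eta -> 0 <= a -> a < 1 -> slot_inj lev pos -> (forall i, `|x i| <= 1) ->
  `|bump_sum eta a lev pos x t| <= (1 - a)^-1.
Proof.
move=> eta0 a0 a1 inj x1.
have [|m Hm] := @sum_levels_le _ lev (fun i => bump_at eta (lev i) (pos i) t) (fun _ => 1) _ a0.
  move=> k; rewrite (eq_bigr (fun i => bump eta (4 ^+ k * t - (pos i)%:R))).
    apply: sum_bump_le1 => // i i' /eqP ki /eqP ki' pp; apply: inj => //.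
    by rewrite ki ki'.
  by move=> i /eqP <-.
apply: le_trans (ler_norm_sum _ _ _) _.
apply: (@le_trans _ _ (\sum_i a ^+ lev i * bump_at eta (lev i) (pos i) t)).
  apply: ler_sum => i _; rewrite normrZ ger0_norm ?mulr_ge0 ?exprn_ge0 ?bump_ge0//.
  by rewrite ler_piMr// mulr_ge0 ?exprn_ge0 ?bump_ge0.
apply: le_trans (geo_sum_le m a0 a1).
by apply: le_trans Hm _; apply: ler_sum => k _; rewrite mulr1.
Qed.

(** By [sum_bump_lip], level k changes by at most 2/eta times min(1, 4^k (t - s)); [scale_sum_le]
    adds these bounds with weights a^k. *)
Lemma bump_sum_holder eta a alpha n (lev pos : 'I_n -> nat) (x : 'I_n -> E) s t :
  0 < eta -> eta <= 1 -> 2^-1 <= a -> a < 1 -> 0 < alpha -> alpha <= 1 ->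
  a * 4 `^ alpha = 1 -> slot_inj lev pos -> (forall i, `|x i| <= 1) ->
  s < t -> t - s <= 1 ->
  `|bump_sum eta a lev pos x t - bump_sum eta a lev pos x s| <=
  4 / eta * ((1 - a)^-1 + 1) * (t - s) `^ alpha.
Proof.
move=> eta0 eta1 a2 a1 alpha0 alpha1 a4 inj x1 st ts1.
have a0 : 0 <= a by lra.
pose F i := `|bump_at eta (lev i) (pos i) t - bump_at eta (lev i) (pos i) s|.
have [|m Hm] := @sum_levels_le _ lev F
    (fun k => 2 / eta * minr 1 (4 ^+ k * (t - s))) _ a0.
  move=> k; rewrite (eq_bigr (fun i =>
      `|bump eta (4 ^+ k * t - (pos i)%:R) - bump eta (4 ^+ k * s - (pos i)%:R)|)); last first.
    by move=> i /eqP <-.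
  apply: (@le_trans _ _ (2 * minr 1 (`|4 ^+ k * t - 4 ^+ k * s| / eta))).
    apply: sum_bump_lip => // i i' /eqP ki /eqP ki' pp; apply: inj => //.
    by rewrite ki ki'.
  rewrite -mulrBr normrM gtr0_norm ?exprn_gt0// gtr0_norm ?subr_gt0//.
  set q := 4 ^+ k * (t - s).
  rewrite -mulrA ler_wpM2l// [leRHS]mulrC ler_pdivlMr// le_min; apply/andP; split.
    by apply: le_trans eta1; rewrite ler_piMl ?ge_min ?lexx// ltW.
  by rewrite -ler_pdivlMr// ge_min lexx orbT.
rewrite /bump_sum -sumrB; apply: le_trans (ler_norm_sum _ _ _) _.
apply: (@le_trans _ _ (\sum_i a ^+ lev i * F i)).
  apply: ler_sum => i _; rewrite -scalerBl -mulrBr normrZ normrM ger0_norm ?exprn_ge0//.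
  by rewrite ler_piMr// mulr_ge0 ?exprn_ge0.
apply: le_trans Hm _.
under eq_bigr do rewrite mulrCA.
rewrite -mulr_sumr.
have ts0 : 0 < t - s by rewrite subr_gt0.
have := scale_sum_le m a2 a1 alpha0 alpha1 a4 ts0 ts1.
set S := \sum_(_ < m) _ => h.
have : 2 / eta * S <= 2 / eta * (2 * ((1 - a)^-1 + 1) * (t - s) `^ alpha).
  by rewrite ler_wpM2l ?divr_ge0 ?ltW//; lra.
move/le_trans; apply; move: (1 - a)^-1 (_ `^ _) => b y.
by rewrite le_eqVlt; apply/orP; left; apply/eqP; ring.
Qed.

End BumpSums.

(** * Integration and the normal law *)

Section IntegralTools.
Context d (T : measurableType d) (R : realType) (mu : {measure set T -> \bar R}).
Implicit Types (D : set T) (f g : T -> R).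

(** The integral of a nonnegative function is a supremum over simple functions below it, so the
    comparison is one of suprema and is valid for arbitrary nonnegative functions. *)
Lemma le_integral_ge0 D (f g : T -> \bar R) :
  (forall x, D x -> (0 <= f x)%E) -> (forall x, D x -> (f x <= g x)%E) ->
  (\int[mu]_(x in D) f x <= \int[mu]_(x in D) g x)%E.
Proof.
move=> f0 fg; rewrite !ge0_integralE//; last by move=> x Dx; exact: le_trans (f0 x Dx) (fg x Dx).
apply: le_ereal_sup => /= _ [h hf <-]; exists h => // x.
apply: le_trans (hf x) _; exact: lee_restrict.
Qed.

Lemma integral_le_comb D (I : finType) (c m : I -> R) (g : I -> T -> R) f :
  measurable D -> (forall i, 0 <= c i) -> (forall i x, D x -> 0 <= g i x) ->
  (forall i, measurable_fun D (g i)) ->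
  (forall i, (\int[mu]_(x in D) (g i x)%:E <= (m i)%:E)%E) ->
  (forall x, D x -> 0 <= f x <= \sum_i c i * g i x) ->
  (\int[mu]_(x in D) (f x)%:E <= (\sum_i c i * m i)%:E)%E.
Proof.
move=> mD c0 g0 mg gm fg.
apply: (@le_trans _ _ (\int[mu]_(x in D) \sum_i ((c i)%:E * (g i x)%:E))%E).
  apply: le_integral_ge0 => x Dx; first by rewrite lee_fin; case/andP: (fg x Dx).
  by under eq_bigr do rewrite -EFinM; rewrite sumEFin lee_fin; case/andP: (fg x Dx).
rewrite ge0_integral_sum//; last 2 first.
- by move=> i; apply/measurable_EFinP; exact: measurable_funM.
- by move=> i x Dx; rewrite -EFinM lee_fin mulr_ge0// g0.
rewrite -sumEFin; apply: lee_sum => i _.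
rewrite ge0_integralZl//; last 3 first.
- exact/measurable_EFinP.
- by move=> x Dx; rewrite lee_fin g0.
- by rewrite lee_fin.
by rewrite EFinM lee_wpmul2l// lee_fin.
Qed.

Lemma integral_le_comb2 D (c1 c2 m1 m2 : R) g1 g2 f :
  measurable D -> 0 <= c1 -> 0 <= c2 ->
  (forall x, D x -> 0 <= g1 x) -> (forall x, D x -> 0 <= g2 x) ->
  measurable_fun D g1 -> measurable_fun D g2 ->
  (\int[mu]_(x in D) (g1 x)%:E <= m1%:E)%E ->
  (\int[mu]_(x in D) (g2 x)%:E <= m2%:E)%E ->
  (forall x, D x -> 0 <= f x <= c1 * g1 x + c2 * g2 x) ->
  (\int[mu]_(x in D) (f x)%:E <= (c1 * m1 + c2 * m2)%:E)%E.
Proof.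
move=> mD c10 c20 g10 g20 mg1 mg2 gm1 gm2 fg.
have := @integral_le_comb D bool (fun b => if b then c1 else c2)
  (fun b => if b then m1 else m2) (fun b => if b then g1 else g2) f mD.
rewrite big_bool; apply; try by case.
by move=> x Dx; rewrite big_bool; exact: fg.
Qed.

End IntegralTools.

Section Law.
Context d (T : measurableType d) (R : realType) (P : probability T R).

Lemma integral_law (X : T -> R) (nu : {measure set (measurableTypeR R) -> \bar R})
  (f : R -> \bar R) :
  measurable_fun setT X -> (forall A, measurable A -> P (X @^-1` A) = nu A) ->
  measurable_fun setT f -> (forall x, (0 <= f x)%E) ->
  (\int[P]_w f (X w) = \int[nu]_x f x)%E.
Proof.
move=> mX law mf f0.
pose X0 : T -> measurableTypeR R := X.
have mX0 : measurable_fun setT X0 by [].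
pose X' : {RV P >-> measurableTypeR R} := HB.pack X0 (isMeasurableFun.Build _ _ _ _ X0 mX0).
rewrite -(@ge0_integral_distribution _ _ _ _ R P X' f)//.
by apply: eq_measure_integral => A mA _; exact: law.
Qed.
End Law.

Section Normal.
Variable R : realType.
Implicit Types (s t x : R).
Local Notation mu := (@lebesgue_measure R).

Lemma integral_normal_prob s (f : R -> \bar R) :
  measurable_fun setT f -> (forall x, (0 <= f x)%E) ->
  (\int[normal_prob 0%R s]_x f x = \int[mu]_x (f x * (normal_pdf 0%R s x)%:E))%E.
Proof.
move=> mf f0; have dom := @normal_prob_dominates R 0 s.
rewrite -(Radon_Nikodym_SigmaFinite.change_of_variables dom f0)//.
apply: ae_eq_integral => //.
- apply: emeasurable_funM => //; apply: (measurable_int mu).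
  exact: Radon_Nikodym_SigmaFinite.f_integrable.
- apply: emeasurable_funM => //=; apply/measurableT_comp => //=.
  exact: measurable_normal_pdf.
- apply: ae_eqe_mul2l => /=; apply: integral_ae_eq => //=.
  + exact: Radon_Nikodym_SigmaFinite.f_integrable.
  + by apply/measurableT_comp =>//; exact: measurable_normal_pdf.
  + by move=> A _ mA; rewrite -Radon_Nikodym_SigmaFinite.f_integral.
Qed.

(** The variance of N(0,1), kept as a symbolic constant that all later bounds carry as a factor;
    [bump_width] absorbs it. *)
Definition normal_var : R := fine (\int[normal_prob 0%R 1%R]_x (x ^+ 2)%:E)%E.

Lemma normal_pdf_scale s x : 0 < s -> normal_pdf 0 s (s * x) * s = normal_pdf 0 1 x.
Proof.
move=> s0; rewrite !normal_pdfE ?gt_eqF ?oner_eq0// /normal_peak /normal_fun !subr0.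
rewrite expr1n exprMn.
have -> : s ^+ 2 * pi *+ 2 = s ^+ 2 * (1 * pi *+ 2) :> R by ring.
rewrite sqrtrM ?sqr_ge0// sqrtr_sqr gtr0_norm// invfM.
have -> : - (s ^+ 2 * x ^+ 2) / (s ^+ 2 *+ 2) = - x ^+ 2 / (1 *+ 2).
  by field; rewrite gt_eqF.
by rewrite mulrC !mulrA divff ?mul1r// gt_eqF.
Qed.

Lemma normal_sqr_scale s : 0 < s ->
  (\int[normal_prob 0%R s]_x (x ^+ 2)%:E =
   (s ^+ 2)%:E * \int[normal_prob 0%R 1%R]_x (x ^+ 2)%:E)%E.
Proof.
move=> s0.
have msq : measurable_fun setT (fun x : R => (x ^+ 2)%:E).
  by apply/measurable_EFinP; exact: exprn_measurable.
have sq0 x : (0 <= (x ^+ 2)%:E)%E by rewrite lee_fin sqr_ge0.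
rewrite !integral_normal_prob// -ge0_integralZl//; last 2 first.
- apply: emeasurable_funM => //; apply/measurable_EFinP; exact: measurable_normal_pdf.
- by move=> x _; rewrite mule_ge0// lee_fin normal_pdf_ge0.
pose G x : R := x ^+ 2 * normal_pdf 0 s x.
have dF x : derivable (fun y : R => s * y) x 1 by apply: derivableM.
have F'E : (fun y : R => s * y)^`()%classic = cst s.
  apply/funext => x; rewrite derive1E deriveM// derive_cst scaler0 addr0.
  by rewrite derive_id /GRing.scale/= mulr1.
under eq_integral do rewrite -EFinM.
rewrite (@increasing_ge0_integration_by_substitutionT R (fun y : R => s * y) G)//.
- apply: eq_integral => x _; rewrite F'E; congr EFin; rewrite !fctE /G.
  by rewrite -(normal_pdf_scale x s0)// exprMn; ring.
- by move=> x y xy; rewrite ltr_pM2l.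
- by rewrite F'E => ?; exact: cvg_cst.
- by rewrite F'E; exact: is_cvg_cst.
- by rewrite F'E; exact: is_cvg_cst.
- by apply: gt0_cvgMrNy.
- by apply: gt0_cvgMry.
- move=> x; apply: cvgM; first exact: exprn_continuous.
  by apply: continuous_normal_pdf; rewrite gt_eqF.
- by move=> x; rewrite mulr_ge0 ?sqr_ge0 ?normal_pdf_ge0.
Qed.

Lemma normal_sqr_fin : (\int[@normal_prob R 0%R 1%R]_x (x ^+ 2)%:E < +oo)%E.
Proof.
have msq : measurable_fun setT (fun x : R => (x ^+ 2)%:E).
  by apply/measurable_EFinP; exact: exprn_measurable.
have sq0 (x : R) : (0 <= (x ^+ 2)%:E)%E by rewrite lee_fin sqr_ge0.
rewrite integral_normal_prob//.
(* [x^2 exp(-x^2/2) <= 4 exp(-x^2/4)], a multiple of the density of N(0,2). *)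
pose C : R := 4 * normal_peak 1 / normal_peak (Num.sqrt 2).
have s2 : Num.sqrt 2 != 0 :> R by rewrite gt_eqF// sqrtr_gt0.
have pk : 0 < normal_peak (Num.sqrt 2) :> R by rewrite normal_peak_gt0.
apply: (@le_lt_trans _ _ (C%:E * 1)%E); last by rewrite mule1 ltry.
rewrite -(integral_normal_pdf 0 (Num.sqrt 2)) -ge0_integralZl//; last 3 first.
- apply/measurable_EFinP; exact: measurable_normal_pdf.
- by move=> x _; rewrite lee_fin normal_pdf_ge0.
- by rewrite lee_fin /C divr_ge0 ?mulr_ge0 ?normal_peak_ge0.
apply: le_integral_ge0 => x _; first by rewrite -EFinM lee_fin mulr_ge0 ?sqr_ge0 ?normal_pdf_ge0.
rewrite -!EFinM lee_fin !normal_pdfE ?oner_eq0// /normal_fun !subr0 sqr_sqrtr//.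
rewrite expr1n /C.
have -> : 4 * normal_peak 1 / normal_peak (Num.sqrt 2) *
   (normal_peak (Num.sqrt 2) * expR (- x ^+ 2 / (2 *+ 2))) =
   normal_peak 1 * (4 * expR (- x ^+ 2 / (2 *+ 2))) by field; rewrite gt_eqF.
rewrite mulrCA ler_wpM2l ?normal_peak_ge0//.
have -> : - x ^+ 2 / (1 *+ 2) = - x ^+ 2 / (2 *+ 2) + - (x ^+ 2 / 4) by field.
rewrite expRD mulrCA [leRHS]mulrC ler_wpM2l ?expR_ge0// expRN.
rewrite ler_pdivrMr ?expR_gt0//.
have := expR_ge1Dx (x ^+ 2 / 4).
by lra.
Qed.

(** The density is at most 1/s and the interval has length 2ts. *)
Lemma normal_small_ball s t : 0 < s -> 0 <= t ->
  (normal_prob 0%R s [set x | `|x| <= t * s]%R <= (2 * t)%:E)%E.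
Proof.
move=> s0 t0; rewrite /normal_prob.
have -> : [set x : R | `|x| <= t * s] = `[- (t * s), t * s]%classic.
  by apply/seteqP; split => x /=; rewrite in_itv/= ler_norml.
have := @le_integral_ge0 _ _ _ mu `[- (t * s), t * s]%classic
  (fun x => (normal_pdf 0 s x)%:E) (cst (normal_peak s)%:E).
move=> H; apply: le_trans (H _ _) _ => {H}.
  by move=> x _; rewrite lee_fin normal_pdf_ge0.
  by move=> x _; rewrite lee_fin normal_pdf_ub// gt_eqF.
rewrite integral_cst//= lebesgue_measure_itv/= lte_fin.
have ts : 0 <= t * s by rewrite mulr_ge0// ltW.
case: ifPn => _; last by rewrite mule0 lee_fin mulr_ge0.
rewrite -EFinB -EFinM lee_fin opprK.
have : normal_peak s <= s^-1.
  rewrite /normal_peak lef_pV2 ?posrE// ?sqrtr_gt0; last first.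
    by rewrite mulrn_wgt0// mulr_gt0 ?pi_gt0// exprn_gt0.
  rewrite -[leLHS](ger0_norm (ltW s0)) -sqrtr_sqr ler_wsqrtr//.
  rewrite -mulrnAr ler_peMr ?sqr_ge0//.
  have := @pi_ge2 R; lra.
move=> h; apply: (@le_trans _ _ (s^-1 * (t * s + t * s))).
  by rewrite ler_wpM2r// addr_ge0.
by rewrite le_eqVlt; apply/orP; left; apply/eqP; field; rewrite gt_eqF.
Qed.

End Normal.

Section HasIntegral.
Context d (T : measurableType d) (R : realType) (mu : {measure set T -> \bar R}).
Variables (D : set T) (mD : measurable D).
Implicit Types (f g : T -> R).

Definition has_integral f (m : R) :=
  mu.-integrable D (EFin \o f) /\ (\int[mu]_(x in D) (f x)%:E = m%:E)%E.

Lemma has_integralD f g m m' : has_integral f m -> has_integral g m' ->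
  has_integral (fun x => f x + g x) (m + m').
Proof.
move=> [fi fm] [gi gm]; split; first exact: (integrableD mD fi gi).
by under eq_integral do rewrite EFinD; rewrite integralD// fm gm.
Qed.

Lemma has_integralZ (c : R) f m : has_integral f m -> has_integral (fun x => c * f x) (c * m).
Proof.
move=> [fi fm]; split; first exact: (integrableZl mD c fi).
by under eq_integral do rewrite EFinM; rewrite integralZl// fm.
Qed.

Lemma has_integral0 : has_integral (fun => 0) 0.
Proof. by split; [exact: integrable0|rewrite integral0]. Qed.

Lemma has_integral_sum (I : eqType) (r : seq I) (F : I -> T -> R) (M : I -> R) :
  (forall i, i \in r -> has_integral (F i) (M i)) ->
  has_integral (fun x => \sum_(i <- r) F i x) (\sum_(i <- r) M i).
Proof.
elim: r => [|i r IH] FM.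
  rewrite big_nil; have -> : (fun x => \sum_(i <- [::]) F i x) = (fun=> 0 : R).
    by apply/funext => x; rewrite big_nil.
  exact: has_integral0.
rewrite big_cons; have -> : (fun x => \sum_(j <- i :: r) F j x) =
    (fun x => F i x + \sum_(j <- r) F j x) by apply/funext => x; rewrite big_cons.
apply: has_integralD; first by apply: FM; rewrite mem_head.
by apply: IH => j jr; apply: FM; rewrite in_cons jr orbT.
Qed.

End HasIntegral.

(** * Wiener integrals *)

Section BrownianIncrements.
Context (R : realType) d (T : measurableType d) (P : probability T R) (W : R -> T -> R).
Hypothesis bW : brownian P W.
Local Notation v := (normal_var R).

Lemma normal_varE : (\int[@normal_prob R 0%R 1%R]_x (x ^+ 2)%:E = v%:E)%E.
Proof.
rewrite fineK// ge0_fin_numE; first exact: normal_sqr_fin.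
by apply: integral_ge0 => x _; rewrite lee_fin sqr_ge0.
Qed.

Lemma normal_var_ge0 : 0 <= v.
Proof. by rewrite fine_ge0// integral_ge0// => x _; rewrite lee_fin sqr_ge0. Qed.

Lemma measurable_brownian t : measurable_fun setT (W t).
Proof. by case: bW. Qed.

Lemma measurable_increment s t : measurable_fun setT (fun w => W t w - W s w).
Proof. by apply: measurable_funB; exact: measurable_brownian. Qed.

Lemma increment_sqr s t : 0 <= s <= 1 -> 0 <= t <= 1 ->
  has_integral P setT (fun w => (W t w - W s w) ^+ 2) (v * `|t - s|).
Proof.
wlog st : s t / s <= t => [H s01 t01|].
  have [st|/ltW ts] := leP s t; first exact: H.
  have -> : (fun w => (W t w - W s w) ^+ 2) = (fun w => (W s w - W t w) ^+ 2).
    by apply/funext => w; rewrite -sqrrN opprB.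
  by rewrite distrC; exact: H.
move=> /andP[s0 _] /andP[_ t1].
have msq : measurable_fun setT (fun w => (W t w - W s w) ^+ 2).
  by apply: measurable_funX; exact: measurable_increment.
suff E : (\int[P]_w ((W t w - W s w) ^+ 2)%:E = (v * `|t - s|)%:E)%E.
  split => //; apply/integrableP; split; first exact/measurable_EFinP.
  under eq_integral => w _ do rewrite /= ger0_norm ?sqr_ge0//.
  by rewrite E ltry.
move: st; rewrite le_eqVlt => /predU1P[->|st].
  rewrite subrr normr0 mulr0; under eq_integral do rewrite subrr expr0n.
  by rewrite integral0.
rewrite (@integral_law _ _ _ P (fun w => W t w - W s w) (normal_prob 0 (Num.sqrt (t - s)))
  (fun x => (x ^+ 2)%:E)).
- rewrite normal_sqr_scale ?sqrtr_gt0 ?subr_gt0// normal_varE -EFinM mulrC.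
  by rewrite sqr_sqrtr ?subr_ge0 ?ltW// gtr0_norm// subr_gt0.
- exact: measurable_increment.
- by case: bW => _ [_ [_ [law _]]] A mA; exact: law.
- by apply/measurable_EFinP; exact: exprn_measurable.
- by move=> x; rewrite lee_fin sqr_ge0.
Qed.

(** The polarisation of the variances of increments: up to [normal_var], the covariance of the
    increments over ]a,b] and ]c,e]. By [overlapE] it is the length of the intersection of the two
    intervals. *)
Definition overlap (a b c e : R) := 2^-1 * (`|b - c| + `|a - e| - `|b - e| - `|a - c|).

Lemma increment_mul a b c e : 0 <= a <= 1 -> 0 <= b <= 1 -> 0 <= c <= 1 -> 0 <= e <= 1 ->
  has_integral P setT (fun w => (W b w - W a w) * (W e w - W c w)) (v * overlap a b c e).
Proof.
move=> a01 b01 c01 e01.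
have -> : (fun w => (W b w - W a w) * (W e w - W c w)) = (fun w =>
   2^-1 * (((W b w - W c w) ^+ 2 + (W a w - W e w) ^+ 2) +
   (-1) * ((W b w - W e w) ^+ 2 + (W a w - W c w) ^+ 2))).
  by apply/funext => w; field.
have -> : v * overlap a b c e = 2^-1 * ((v * `|b - c| + v * `|a - e|) +
   (-1) * (v * `|b - e| + v * `|a - c|)) by rewrite /overlap; ring.
apply: has_integralZ => //; apply: has_integralD => //.
  by apply: has_integralD => //; exact: increment_sqr.
apply: has_integralZ => //.
by apply: has_integralD => //; exact: increment_sqr.
Qed.

Lemma overlapE a b c e : a <= b -> c <= e ->
  overlap a b c e = if maxr a c < minr b e then minr b e - maxr a c else 0.
Proof.
move=> ab ce; have normE (x : R) : `|x| = if 0 <= x then x else - x.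
  by case: leP => x0; [rewrite ger0_norm|rewrite ltr0_norm].
rewrite /overlap !normE maxEle minEle.
by do 7 ?[case: ifPn]; rewrite -?ltNge -?leNgt; lra.
Qed.

Lemma indic_mul a b c e : 0 <= a -> a <= b -> b <= 1 -> 0 <= c -> c <= e -> e <= 1 ->
  has_integral (@lebesgue_measure R) `[0, 1]%classic
    (fun t => \1_`]a, b] t * \1_`]c, e] t) (overlap a b c e).
Proof.
move=> a0 ab b1 c0 ce e1.
have -> : (fun t => \1_`]a, b] t * \1_`]c, e] t) = (\1_(`]maxr a c, minr b e]) : R -> R).
  apply/funext => t; transitivity ((\1_`]a, b] \* \1_`]c, e]) t : R); first by [].
  rewrite -indicI.
  congr (\1_ _ t); apply/seteqP; split => x /=; rewrite !in_itv/= gt_max le_min.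
    by move=> [/andP[-> ->] /andP[-> ->]].
  by move=> /andP[/andP[-> ->] /andP[-> ->]].
have mI : measurable (`]maxr a c, minr b e]%classic : set R) by [].
split.
  by apply: integrableS (integrable_indic_itv _ _ _ _).
rewrite integral_indic// setIidl; last first.
  move=> x /=; rewrite !in_itv/= gt_max le_min.
  by move=> /andP[/andP[ax _] /andP[xb _]]; apply/andP; split; lra.
apply: etrans (lebesgue_measure_itv `]maxr a c, minr b e]) _.
rewrite /= lte_fin overlapE//.
by case: ifPn.
Qed.

Lemma step_int_sqr s : step_adm s ->
  has_integral P setT (fun w => step_int W s w ^+ 2)
   (v * \sum_(x <- s) \sum_(y <- s) x.2 * y.2 * overlap x.1.1 x.1.2 y.1.1 y.1.2).
Proof.
move=> /allP adm; rewrite mulr_sumr.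
have -> : (fun w => step_int W s w ^+ 2) = (fun w => \sum_(x <- s) \sum_(y <- s)
    x.2 * y.2 * ((W x.1.2 w - W x.1.1 w) * (W y.1.2 w - W y.1.1 w))).
  apply/funext => w; rewrite /step_int expr2 big_distrlr/=.
  by apply: eq_bigr => x _; apply: eq_bigr => y _; ring.
apply: has_integral_sum => // x /adm /andP[/andP[x0 x01] x1].
rewrite mulr_sumr; apply: has_integral_sum => // y /adm /andP[/andP[y0 y01] y1].
rewrite mulrCA; apply: has_integralZ => //.
by apply: increment_mul; apply/andP; split; lra.
Qed.

Lemma step_fun_sqr s : step_adm s ->
  has_integral (@lebesgue_measure R) `[0, 1]%classic (fun t => step_fun s t ^+ 2)
   (\sum_(x <- s) \sum_(y <- s) x.2 * y.2 * overlap x.1.1 x.1.2 y.1.1 y.1.2).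
Proof.
move=> /allP adm.
have -> : (fun t => step_fun s t ^+ 2) = (fun t => \sum_(x <- s) \sum_(y <- s)
    x.2 * y.2 * (\1_(`]x.1.1, x.1.2]) t * \1_(`]y.1.1, y.1.2]) t)).
  apply/funext => w; rewrite /step_fun expr2 big_distrlr/=.
  by apply: eq_bigr => x _; apply: eq_bigr => y _; ring.
apply: has_integral_sum => // x /adm /andP[/andP[x0 x01] x1].
apply: has_integral_sum => // y /adm /andP[/andP[y0 y01] y1].
by apply: has_integralZ => //; exact: indic_mul.
Qed.

(** Both squares expand into the same double sum of overlaps, so overlapping intervals in [s]
    require no common refinement. *)
Lemma step_isometry s : step_adm s ->
  (\int[P]_w (step_int W s w ^+ 2)%:E =
   v%:E * \int[lebesgue_measure]_(t in `[0%R, 1%R]) (step_fun s t ^+ 2)%:E)%E.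
Proof. by move=> adm; rewrite (step_int_sqr adm).2 (step_fun_sqr adm).2 EFinM. Qed.

Lemma measurable_step_fun (s : seq (R * R * R)) (D : set R) : measurable_fun D (step_fun s).
Proof. by apply: measurable_sum => x; apply: measurable_funM => //. Qed.

Lemma measurable_step_int s : measurable_fun setT (step_int W s).
Proof.
by apply: measurable_sum => x; apply: measurable_funM => //; exact: measurable_increment.
Qed.

Local Notation I01 := (`[0%R, 1%R]%classic : set R).

Lemma cvg0_lt (u : nat -> \bar R) (e : R) : 0 < e -> u n @[n --> \oo] --> 0%E ->
  \forall n \near \oo, (u n < e%:E)%E.
Proof.
move=> e0 /fine_cvgP[ufin u0]; near=> n.
have un : u n \is a fin_num by near: n.
rewrite -(fineK un) lte_fin; near: n.
exact: (cvgr_lt _ u0).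
Unshelve. all: by end_near. Qed.

Lemma cvg0_le (u : nat -> \bar R) : (forall n, 0 <= u n)%E ->
  (forall e : R, 0 < e -> \forall n \near \oo, (u n <= e%:E)%E) ->
  u n @[n --> \oo] --> 0%E.
Proof.
move=> u0 H; have fin e n : (u n <= e%:E)%E -> u n \is a fin_num.
  by move=> ue; rewrite ge0_fin_numE// (le_lt_trans ue)// ltry.
apply/fine_cvgP; split.
  by have := H _ ltr01; apply: filterS => n; exact: fin.
apply/cvgr0Pnorm_le => e e0; have := H _ e0; apply: filterS => n ue.
by rewrite ger0_norm ?fine_ge0// -lee_fin fineK// (fin _ _ ue).
Qed.

Lemma sqr_add_le (a b : R) : 0 <= (a + b) ^+ 2 <= 2 * a ^+ 2 + 2 * b ^+ 2.
Proof.
by rewrite sqr_ge0/=; have := sqr_ge0 (a - b); rewrite !sqrrD !mulrN sqrrN; lra.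
Qed.

(** The isometry up to a factor 4: passing from [f] to a step function and from its integral to [Z]
    each costs a factor 2 through [sqr_add_le]. *)
Lemma wiener_bound f Z (B : R) : measurable_fun I01 f -> wiener_integral P W f Z ->
  (\int[lebesgue_measure]_(t in I01) (f t ^+ 2)%:E <= B%:E)%E ->
  (\int[P]_w (Z w ^+ 2)%:E <= (4 * v * B)%:E)%E.
Proof.
move=> mf [mZ [s [adm [fs Zs]]]] fB.
have mI : measurable I01 by [].
suff H (e : R) : 0 < e -> (\int[P]_w (Z w ^+ 2)%:E <= (4 * v * B)%:E + e%:E)%E.
  by apply/lee_addgt0Pr.
(* Chosen so that the two approximation errors, weighted 2 and 4v by the argument, add up to exactly
   [e]. *)
move=> e0; pose e' := e / (2 + 4 * v).
have v0 := normal_var_ge0.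
have e'0 : 0 < e' by rewrite divr_gt0//; lra.
have eB : 4 * v * B + e = 2 * e' + 2 * (v * (2 * e' + 2 * B)).
  have : e = e' * (2 + 4 * v) by rewrite divfK// gt_eqF//; lra.
  by lra.
have [n [n1 n2]] : exists n,
   (\int[lebesgue_measure]_(t in I01) ((f t - step_fun (s n) t) ^+ 2)%:E < e'%:E)%E /\
   (\int[P]_w ((Z w - step_int W (s n) w) ^+ 2)%:E < e'%:E)%E.
  have H := cvg0_lt e'0 fs; have H' := cvg0_lt e'0 Zs.
  near \oo => n; exists n; split; near: n; [exact: H|exact: H'].
have sB : (\int[lebesgue_measure]_(t in I01) (step_fun (s n) t ^+ 2)%:E <=
    (2 * e' + 2 * B)%:E)%E.
  apply: integral_le_comb2 (ltW n1) fB _ => //.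
  - by move=> x _; exact: sqr_ge0.
  - by move=> x _; exact: sqr_ge0.
  - by apply: measurable_funX; apply: measurable_funB => //; exact: measurable_step_fun.
  - exact: measurable_funX.
  - move=> x _; have := sqr_add_le (- (f x - step_fun (s n) x)) (f x).
    by rewrite sqrrN opprB subrK.
have IB : (\int[P]_w (step_int W (s n) w ^+ 2)%:E <= (v * (2 * e' + 2 * B))%:E)%E.
  by rewrite step_isometry// EFinM lee_wpmul2l// lee_fin.
rewrite -EFinD eB.
apply: integral_le_comb2 (ltW n2) IB _ => //.
- by move=> x _; exact: sqr_ge0.
- by move=> x _; exact: sqr_ge0.
- by apply: measurable_funX; apply: measurable_funB => //; exact: measurable_step_int.
- by apply: measurable_funX; exact: measurable_step_int.
- by move=> x _; have := sqr_add_le (Z x - step_int W (s n) x) (step_int W (s n) x); rewrite subrK.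
Unshelve. all: by end_near. Qed.

Lemma wiener_linear (a : R) f g Z Z' : measurable_fun I01 f -> measurable_fun I01 g ->
  wiener_integral P W f Z -> wiener_integral P W g Z' ->
  wiener_integral P W (fun t => a * f t + g t) (fun w => a * Z w + Z' w).
Proof.
move=> mf mg [mZ [s [adm [fs Zs]]]] [mZ' [s' [adm' [gs Zs']]]].
split; first by apply: measurable_funD => //; exact: measurable_funM.
pose q n := [seq (x.1, a * x.2) | x <- s n] ++ s' n.
have sf n t : step_fun (q n) t = a * step_fun (s n) t + step_fun (s' n) t.
  rewrite /step_fun big_cat big_map/= mulr_sumr; congr (_ + _).
  by apply: eq_bigr => x _; rewrite mulrA.
have si n w : step_int W (q n) w = a * step_int W (s n) w + step_int W (s' n) w.
  rewrite /step_int big_cat big_map/= mulr_sumr; congr (_ + _).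
  by apply: eq_bigr => x _; rewrite mulrA.
have cv (u1 u2 u : nat -> \bar R) : u1 n @[n --> \oo] --> 0%E -> u2 n @[n --> \oo] --> 0%E ->
  (forall n, 0 <= u n)%E ->
  (forall n m1 m2, (u1 n <= m1%:E -> u2 n <= m2%:E ->
     u n <= (2 * a ^+ 2 * m1 + 2 * m2)%:E)%E) -> u n @[n --> \oo] --> 0%E.
  move=> u10 u20 u0 H.
  apply: cvg0_le => // e e0; pose e' := e / (2 * a ^+ 2 + 2).
  have a0 := sqr_ge0 a.
  have e'0 : 0 < e' by rewrite divr_gt0//; lra.
  have H1 := cvg0_lt e'0 u10; have H2 := cvg0_lt e'0 u20.
  have -> : e = 2 * a ^+ 2 * e' + 2 * e'.
    have : e = e' * (2 * a ^+ 2 + 2) by rewrite divfK// gt_eqF//; lra.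
    by lra.
  by near=> n; apply: H; apply/ltW; near: n; [exact: H1|exact: H2].
exists q; split; [|split].
- move=> n; rewrite /step_adm all_cat -[X in _ && X]/(step_adm (s' n)) adm' andbT.
  by rewrite all_map; exact: adm.
- apply: (cv _ _ _ fs gs) => n; first by apply: integral_ge0 => x _; rewrite lee_fin sqr_ge0.
  move=> m1 m2 h1 h2; apply: integral_le_comb2 h1 h2 _ => //.
  + by rewrite mulr_ge0// sqr_ge0.
  + by move=> x _; exact: sqr_ge0.
  + by move=> x _; exact: sqr_ge0.
  + by apply: measurable_funX; apply: measurable_funB => //; exact: measurable_step_fun.
  + by apply: measurable_funX; apply: measurable_funB => //; exact: measurable_step_fun.
  + move=> x _; have := sqr_add_le (a * (f x - step_fun (s n) x)) (g x - step_fun (s' n) x).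
    rewrite exprMn mulrA sf.
    by rewrite opprD addrACA -mulrBr.
- apply: (cv _ _ _ Zs Zs') => n; first by apply: integral_ge0 => x _; rewrite lee_fin sqr_ge0.
  move=> m1 m2 h1 h2; apply: integral_le_comb2 h1 h2 _ => //.
  + by rewrite mulr_ge0// sqr_ge0.
  + by move=> x _; exact: sqr_ge0.
  + by move=> x _; exact: sqr_ge0.
  + by apply: measurable_funX; apply: measurable_funB => //; exact: measurable_step_int.
  + by apply: measurable_funX; apply: measurable_funB => //; exact: measurable_step_int.
  + move=> x _; have := sqr_add_le (a * (Z x - step_int W (s n) x)) (Z' x - step_int W (s' n) x).
    rewrite exprMn mulrA si.
    by rewrite opprD addrACA -mulrBr.
Unshelve. all: by end_near. Qed.

Lemma wiener_increment (a b : R) : 0 <= a -> a <= b -> b <= 1 ->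
  wiener_integral P W \1_`]a, b] (fun w => W b w - W a w).
Proof.
move=> a0 ab b1; split; first exact: measurable_increment.
exists (fun _ => [:: (a, b, 1)]); split; first by move=> n; rewrite /step_adm/= a0 ab b1.
split.
  under eq_fun => n. under eq_integral => t _.
    rewrite /step_fun big_seq1/= mul1r subrr expr0n/=. over. rewrite integral0. over.
  exact: cvg_cst.
under eq_fun => n. under eq_integral => t _.
  rewrite /step_int big_seq1/= mul1r subrr expr0n/=. over. rewrite integral0. over.
exact: cvg_cst.
Qed.

End BrownianIncrements.

(** * The gliding hump *)

Section Limits.
Variables (R : realType) (E : completeNormedModType R).

(** As [r] at least halves, r m <= 2 (r m - r m.+1), so the increments of [u] are dominated by a
    telescoping sum. *)
Lemma geometric_limit (u : nat -> E) (r : nat -> R) :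
  (forall m, 0 <= r m) -> (forall m, r m.+1 <= r m / 2) ->
  (forall m, `|u m.+1 - u m| <= r m) ->
  exists l, u n @[n --> \oo] --> l /\ forall m, `|l - u m| <= 2 * r m.
Proof.
move=> r0 r2 ur.
have tail m k : `|u (m + k)%N - u m| <= 2 * (r m - r (m + k)%N).
  elim: k => [|k IH]; first by rewrite addn0 !subrr normr0 mulr0.
  rewrite addnS.
  have -> : u (m + k).+1 - u m = (u (m + k).+1 - u (m + k)%N) + (u (m + k)%N - u m).
    by rewrite addrA subrK.
  apply: le_trans (ler_normD _ _) _.
  by have := ur (m + k)%N; have := r2 (m + k)%N; lra.
have rgeo m : r m <= r 0%N * (2^-1) ^+ m.
  elim: m => [|m IH]; first by rewrite expr0 mulr1.
  by apply: le_trans (r2 m) _; rewrite exprSr mulrA ler_wpM2r.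
have cu : cvgn u.
  have cs : cvgn (series (fun k => u k.+1 - u k)).
    apply: normed_cvg; apply: series_le_cvg (@is_cvg_geometric_series R (r 0%N) 2^-1 _) => //=.
    - by move=> n; rewrite /geometric/= mulr_ge0 ?exprn_ge0.
    - by move=> n; rewrite /geometric/=; apply: le_trans (ur n) (rgeo n).
    - by rewrite ger0_norm// invf_lt1// ltr1n.
  have -> : u = (fun n => u 0%N + series (fun k => u k.+1 - u k) n).
    by apply/funext => n; rewrite /series/= telescope_sumr// addrC subrK.
  by apply: is_cvgD => //; exact: is_cvg_cst.
exists (limn u); split => // m.
apply: (@closed_cvg _ _ \oo _ (fun n => `|u n - u m|) (fun x => x <= 2 * r m)).
- exact: closed_le.
- near=> n; have mn : (m <= n)%N by near: n; exact: nbhs_infty_ge.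
  by rewrite -(subnKC mn); apply: le_trans (tail _ _) _; have := r0 (m + (n - m))%N; lra.
- by apply: cvg_norm; apply: cvgB => //; exact: cvg_cst.
Unshelve. all: by end_near. Qed.

Lemma measurable_strongly_comp d (T : measurableType d) (V : normedModType R) (D : set T)
  (f : T -> V) (N : V -> R) : measurable D -> strongly_measurable D f -> continuous N ->
  measurable_fun D (N \o f).
Proof.
move=> mD [g [fing [mg gf]]] cN.
apply: (@measurable_fun_cvg _ _ _ _ (fun n => N \o g n)); last first.
  by move=> x Dx; apply: continuous_cvg; [exact: cN|exact: gf].
move=> n _ B mB; apply: measurableI => //.
have -> : (N \o g n) @^-1` B = \bigcup_(y in range (g n) `&` N @^-1` B) (g n @^-1` [set y]).
  apply/seteqP; split => x /=; first by move=> Bx; exists (g n x) => //; split => //; exists x.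
  by move=> [y [_ By] gy]; rewrite /= in gy; rewrite gy.
apply: fin_bigcup_measurable => //; exact: finite_setIl.
Qed.

End Limits.

Section Tails.
Context d (T : measurableType d) (R : realType) (P : probability T R).

Lemma measurable_gt (X : T -> R) (c : R) : measurable_fun setT X ->
  measurable [set w | c < X w].
Proof.
move=> mX; have -> : [set w | c < X w] = setT `&` X @^-1` `]c, +oo[%classic.
  by rewrite setTI; apply/seteqP; split => w /=; rewrite in_itv/= andbT.
exact: mX.
Qed.

Lemma tail_small (X : T -> R) (e : R) : measurable_fun setT X -> 0 < e ->
  exists K : nat, (P [set w | (K%:R < X w)%R] <= e%:E)%E.
Proof.
move=> mX e0; pose F (n : nat) := [set w | n%:R < X w].
have mF n : measurable (F n) by exact: measurable_gt.
have cap0 : \bigcap_n F n = set0.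
  rewrite -subset0 => w Fw; have := Fw (Num.truncn (X w)).+1 I.
  by rewrite /F/= ltNge ltW// truncnS_gt.
have := @nonincreasing_cvg_mu _ _ _ P F; rewrite cap0 measure0.
move=> /(_ _ mF measurable0) H.
have H' : (P \o F) x @[x --> \oo] --> 0%E.
  apply: H; first by apply: le_lt_trans (probability_le1 _ _) (ltry _).
  move=> n m nm; apply/subsetPset => w; rewrite /F/= => h; apply: le_lt_trans h.
  by rewrite ler_nat.
have := cvg0_lt e0 H' => h; near \oo => n; exists n; apply/ltW.
near: n; exact: h.
Unshelve. all: by end_near. Qed.

(** Outside this single event every [D j] has modulus at most 1. The price is the factor #|J|, which
    in [hump_step] is known before the next coefficient is chosen. *)
Lemma chebyshev_sum (J : finType) (D : J -> T -> R) (b : R) :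
  (forall j, measurable_fun setT (D j)) ->
  (forall j, (\int[P]_w (D j w ^+ 2)%:E <= b%:E)%E) ->
  (P [set w | (1 < \sum_j D j w ^+ 2)%R] <= (#|J|%:R * b)%:E)%E.
Proof.
move=> mD Db; pose A := [set w | 1 < \sum_j D j w ^+ 2].
have mA : measurable A.
  by apply: measurable_gt; apply: measurable_sum => j; exact: measurable_funX.
rewrite -[X in P X](setIT A) -integral_indic//.
have := @integral_le_comb _ T R P setT J (fun=> 1) (fun=> b) (fun j w => D j w ^+ 2) \1_A.
rewrite sumr_const mul1r -[b *+ _]mulr_natl; apply => //.
- by move=> j w _; exact: sqr_ge0.
- by move=> j; exact: measurable_funX.
move=> w _; under eq_bigr do rewrite mul1r.
rewrite indicE; case: (boolP (w \in A)) => wA; rewrite ?ler01 ?lexx/=.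
  by move: wA; rewrite inE => /ltW.
by apply: sumr_ge0 => j _; exact: sqr_ge0.
Qed.

Lemma prob_union3 (A B1 B2 B3 N : set T) :
  measurable A -> measurable B1 -> measurable B2 -> measurable B3 -> P.-negligible N ->
  A `<=` N `|` (B1 `|` (B2 `|` B3)) -> (P A <= P B1 + (P B2 + P B3))%E.
Proof.
move=> mA m1 m2 m3 [N' [mN' PN' NN']] AB.
have sub : A `<=` N' `|` (B1 `|` (B2 `|` B3)).
  by move=> w /AB[/NN'|]; [left|right].
apply: le_trans (le_measure _ _ _ sub) _; rewrite ?inE//.
  by apply: measurableU => //; apply: measurableU => //; exact: measurableU.
have m23 : measurable (B2 `|` B3) by exact: measurableU.
have m123 : measurable (B1 `|` (B2 `|` B3)) by exact: measurableU.
have hN : (P N' <= 0)%E by rewrite PN'.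
apply: le_trans (measureU2 P mN' m123) _; apply: le_trans (leeD hN (lexx _)) _; rewrite add0e.
by apply: le_trans (measureU2 P m1 m23) _; rewrite leeD2l// measureU2.
Qed.

End Tails.

(** * Uniform tail bounds by a gliding hump *)

Section UniformBound.
Context (R : realType) (E : completeNormedModType R) (alpha : R).
Context d (Omega : measurableType d) (P : probability Omega R) (W : R -> Omega -> R).
Hypothesis bW : brownian P W.
Hypothesis intW : forall phi : R -> E, holder alpha phi -> stoch_integrable P W phi.

Definition holder_ball (C : R) (phi : R -> E) :=
  (forall t, 0 <= t <= 1 -> `|phi t| <= C) /\
  (forall s t, 0 <= s -> s < t -> t <= 1 -> `|phi t - phi s| <= C * (t - s) `^ alpha).

Definition dual_ball (f : E -> R) := dual_elt f /\ forall y, `|f y| <= `|y|.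

Definition represents (Y : Omega -> E) (phi : R -> E) :=
  strongly_measurable setT Y /\
  forall xs : E -> R, dual_elt xs ->
    exists Z : Omega -> R, wiener_integral P W (xs \o phi) Z /\
      {ae P, forall w, xs (Y w) = Z w}.

Local Notation I01 := (`[0%R, 1%R]%classic : set R).

Lemma holder_ballW C phi : holder_ball C phi -> holder alpha phi.
Proof. by move=> [b l]; split; exists C. Qed.

Lemma holder_represents phi : holder alpha phi -> exists Y, represents Y phi.
Proof. by move=> /intW [_ [_ [Y [mY H]]]]; exists Y. Qed.

Lemma measurable_dual_holder (phi : R -> E) (xs : E -> R) : holder alpha phi -> dual_elt xs ->
  measurable_fun I01 (xs \o phi).
Proof.
by move=> /intW [mphi _] [_ cxs]; apply: measurable_strongly_comp.
Qed.

Lemma holderD_scale (phi psi : R -> E) (r : R) : holder alpha psi -> holder alpha phi ->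
  holder alpha (fun t => psi t + r *: phi t).
Proof.
move=> [[B hB] [K hK]] [[B' hB'] [K' hK']]; split.
  exists (B + `|r| * B') => t t01; apply: le_trans (ler_normD _ _) _.
  by rewrite normrZ lerD ?hB// ler_wpM2l// hB'.
exists (K + `|r| * K') => s t s0 st t1.
have -> : psi t + r *: phi t - (psi s + r *: phi s) =
  (psi t - psi s) + r *: (phi t - phi s) by rewrite scalerBr opprD addrACA.
apply: le_trans (ler_normD _ _) _.
by rewrite mulrDl lerD ?hK// normrZ -mulrA ler_wpM2l// hK'.
Qed.

Lemma dual_linear (xs : E -> R) (a : R) (x y : E) :
  dual_elt xs -> xs (y + a *: x) = xs y + a * xs x.
Proof. by case=> lin _; rewrite addrC lin addrC. Qed.

Lemma dualB (xs : E -> R) (x y : E) : dual_elt xs -> xs (x - y) = xs x - xs y.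
Proof. by move=> dx; rewrite -scaleN1r dual_linear// mulN1r. Qed.

(* One step of the gliding hump: [phi] is so bad that adding [rho phi] to [psi], and then
   any sufficiently small later correction, keeps the stochastic integral large. *)
Lemma hump_step (C delta : R) : 0 < C -> 0 < delta ->
  (forall M : R, exists phi (J : finType) (f : J -> E -> R) (Z : J -> Omega -> R),
    [/\ holder_ball C phi, forall j, dual_ball (f j),
        forall j, wiener_integral P W (f j \o phi) (Z j) &
        (delta%:E < P [set w | exists j, (M < `|Z j w|)%R])%E]) ->
  forall (psi : R -> E) (rho m : R), holder alpha psi -> 0 < rho ->
  exists (phi : R -> E) (rho' : R), [/\ holder_ball C phi, 0 < rho', rho' <= rho / 2 &
    forall chi Y, holder alpha chi -> represents Y chi ->
      (forall t, 0 <= t <= 1 -> `|chi t - (psi t + rho *: phi t)| <= 2 * C * rho') ->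
      ((delta / 2)%:E <= P [set w | (m < `|Y w|)%R])%E].
Proof.
move=> C0 delta0 bad psi rho m hpsi rho0.
have [Yp [mYp Yp_rep]] := holder_represents hpsi.
have mnorm (Y : Omega -> E) : strongly_measurable setT Y ->
    measurable_fun setT (fun w => `|Y w|).
  move=> mY; apply: (measurable_strongly_comp (N := fun x : E => `|x|)) => //.
  exact: norm_continuous.
have d4 : 0 < delta / 4 by lra.
have [K hK] := tail_small P (mnorm _ mYp) d4.
(* If the integral of [phi] exceeds [M] under some [f j], then [rho] times it beats three terms
   together: [K] for the integral of [psi], m for [Y], and 1 for the discrepancy [D j]. *)
pose M := (K%:R + `|m| + 1) / rho.
have [phi [J [f [Z [Cphi fJ ZJ PZ]]]]] := bad M.
have hphi := holder_ballW Cphi.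
have v0 := normal_var_ge0 R.
(* Apart from the 1, which keeps it positive, [q] is the Chebyshev bound for the discrepancies at
   rho' = 1. The actual bound carries rho'^2, which is at most rho' since rho' <= 1, so rho' <=
   delta / (4 q) makes it at most delta / 4. *)
pose q := 1 + #|J|%:R * (4 * normal_var R * (2 * C) ^+ 2).
have q1 : 1 <= q by rewrite lerDl !mulr_ge0// ?sqr_ge0//; lra.
pose rho' := minr (rho / 2) (minr 1 (delta / 4 / q)).
have q0 : 0 < q by lra.
have dq0 : 0 < delta / 4 / q by rewrite divr_gt0.
have rho'0 : 0 < rho' by rewrite !lt_min ltr01 dq0; apply/andP; split; lra.
exists phi, rho'; split => //; first by rewrite ge_min lexx.
move=> chi Y hchi [mY Y_rep] close.
have [Zp Zp_rep] := choice (fun j => Yp_rep (f j) (fJ j).1).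
have [Zc Zc_rep] := choice (fun j => Y_rep (f j) (fJ j).1).
pose D j w := (-1) * (rho * Z j w + Zp j w) + Zc j w.
have mf g j : holder alpha g -> measurable_fun I01 (f j \o g).
  by move=> hg; apply: measurable_dual_holder => //; case: (fJ j).
have DW j : wiener_integral P W
    (fun t => (-1) * (rho * (f j \o phi) t + (f j \o psi) t) + (f j \o chi) t) (D j).
  apply: wiener_linear => //; [|exact: mf| |exact: (Zc_rep j).1].
    by apply: measurable_funD; [apply: measurable_funM => //; exact: mf|exact: mf].
  apply: wiener_linear => //; [exact: mf|exact: mf|exact: (Zp_rep j).1].
have mD j : measurable_fun setT (D j) by case: (DW j).
have Db j : (\int[P]_w (D j w ^+ 2)%:E <= (4 * normal_var R * (2 * C * rho') ^+ 2)%:E)%E.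
  apply: (wiener_bound bW _ (DW j)).
    apply: measurable_funD; last exact: mf.
    apply: measurable_funM => //; apply: measurable_funD; last exact: mf.
    by apply: measurable_funM => //; exact: mf.
  apply: (@le_trans _ _ (\int[lebesgue_measure]_(t in I01) ((2 * C * rho') ^+ 2)%:E)%E).
    apply: le_integral_ge0 => t t01; first by rewrite lee_fin sqr_ge0.
    have t01' : 0 <= t <= 1 by move: t01; rewrite /= in_itv.
    rewrite lee_fin -[leLHS]real_normK ?num_real// ler_sqr ?nnegrE//; last first.
      by rewrite !mulr_ge0// ltW.
    apply: le_trans (close t t01').
    have -> : -1 * (rho * (f j \o phi) t + (f j \o psi) t) + (f j \o chi) t =
        f j (chi t - (psi t + rho *: phi t)).
      by case: (fJ j) => dj _; rewrite dualB// dual_linear//=; ring.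
    by case: (fJ j) => _; exact.
  rewrite integral_cst//= lebesgue_measure_itv/= lte_fin ltr01 -EFinB -EFinM subr0 mulr1.
  exact: lexx.
have SD := chebyshev_sum mD Db.
have ae_all : {ae P, forall w, forall j, f j (Yp w) = Zp j w /\ f j (Y w) = Zc j w}.
  apply: filter_forall => j; apply: filterS2 (Zp_rep j).2 (Zc_rep j).2.
  by move=> w.
have mZ j : measurable_fun setT (Z j) by case: (ZJ j).
have mbad : measurable [set w | exists j, M < `|Z j w|].
  have -> : [set w | exists j, M < `|Z j w|] = \bigcup_(j in [set: J]) [set w | M < `|Z j w|].
    by apply/seteqP; split => w /=; [move=> [j h]; exists j|move=> [j _ h]; exists j].
  apply: fin_bigcup_measurable => // j _; apply: measurable_gt.
  exact: measurableT_comp.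
have mS : measurable [set w | 1 < \sum_j D j w ^+ 2].
  by apply: measurable_gt; apply: measurable_sum => j; exact: measurable_funX.
(* Probability budget: the bad event weighs more than delta, the tail of [Yp] and the discrepancies
   take delta / 4 each, so delta / 2 is left for large [Y]. *)
have := @prob_union3 _ _ R P _ [set w | K%:R < `|Yp w|] [set w | 1 < \sum_j D j w ^+ 2]
  [set w | m < `|Y w|] _ mbad (measurable_gt _ (mnorm _ mYp)) mS
  (measurable_gt _ (mnorm _ mY)) ae_all.
move=> H.
have {H} : (P [set w | exists j, (M < `|Z j w|)%R] <= P [set w | (K%:R < `|Yp w|)%R] +
  (P [set w | (1 < \sum_j D j w ^+ 2)%R] + P [set w | (m < `|Y w|)%R]))%E.
  apply: H => w [j MZ].
  have [ok|] := pselect (forall j, f j (Yp w) = Zp j w /\ f j (Y w) = Zc j w); last by left.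
  right; have [|YpK] := ltP K%:R `|Yp w|; first by left.
  right; have [|DS] := ltP 1 (\sum_j D j w ^+ 2); first by left.
  right; rewrite /= ltNge; apply/negP => Ym.
  have [oYp oY] := ok j; have [_ fb] := fJ j.
  have Dj : `|D j w| <= 1.
    rewrite -(@ler_sqr _ _ _) ?nnegrE// real_normK ?num_real// expr1n; apply: le_trans DS.
    by rewrite (bigD1 j)//= lerDl sumr_ge0// => i _; exact: sqr_ge0.
  have h1 := fb (Yp w); have h2 := fb (Y w).
  rewrite oYp in h1; rewrite oY in h2.
  have : rho * `|Z j w| <= `|Zc j w| + `|Zp j w| + `|D j w|.
    rewrite -{1}(gtr0_norm rho0) -normrM.
    have -> : rho * Z j w = Zc j w - Zp j w - D j w by rewrite /D; ring.
    apply: le_trans (ler_normB _ _) _; rewrite lerD2r; exact: ler_normB.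
  have : K%:R + `|m| + 1 < rho * `|Z j w| by rewrite mulrC -ltr_pdivrMr.
  have := ler_norm m; lra.
have PS : (P [set w | (1 < \sum_j D j w ^+ 2)%R] <= (delta / 4)%:E)%E.
  apply: le_trans SD _; rewrite lee_fin.
  have r1 : rho' <= delta / 4 / q by rewrite !ge_min lexx !orbT.
  have r2 : rho' <= 1 by rewrite !ge_min lexx !orbT.
  have r3 : rho' ^+ 2 <= delta / 4 / q.
    by apply: le_trans r1; rewrite expr2 ler_piMr// ltW.
  have -> : #|J|%:R * (4 * normal_var R * (2 * C * rho') ^+ 2) = (q - 1) * rho' ^+ 2.
    by rewrite /q; ring.
  apply: (@le_trans _ _ (q * (delta / 4 / q))).
    by apply: ler_pM => //; [lra|exact: sqr_ge0|lra].
  by rewrite mulrCA divff ?mulr1// gt_eqF.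
move=> H; have {}H := lt_le_trans PZ H.
have fin (A : set Omega) : measurable A -> P A \is a fin_num by move=> mA; exact: fin_num_measure.
have mB : measurable [set w | m < `|Y w|] by apply: measurable_gt; exact: mnorm.
have mA : measurable [set w | K%:R < `|Yp w|] by apply: measurable_gt; exact: mnorm.
move: H hK PS; rewrite -(fineK (fin _ mB)) -(fineK (fin _ mA)) -(fineK (fin _ mS)).
rewrite -!EFinD !lte_fin !lee_fin; set x := fine _; set y := fine _; set z := fine _.
by lra.
Qed.

(** If it failed, [hump_step] could be iterated into a Hölder function whose integral exceeds every
    level with probability at least delta / 2. Finite families of functionals keep the exceptional
    sets to finite unions of null sets. *)
Theorem uniform_tail_bound (C delta : R) : 0 < C -> 0 < delta ->
  exists M : R, forall phi (J : finType) (f : J -> E -> R) (Z : J -> Omega -> R),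
    holder_ball C phi -> (forall j, dual_ball (f j)) ->
    (forall j, wiener_integral P W (f j \o phi) (Z j)) ->
    (P [set w | exists j, (M < `|Z j w|)%R] <= delta%:E)%E.
Proof.
move=> C0 delta0; apply: contrapT => noM.
have bad (M : R) : exists phi (J : finType) (f : J -> E -> R) (Z : J -> Omega -> R),
    [/\ holder_ball C phi, forall j, dual_ball (f j),
        forall j, wiener_integral P W (f j \o phi) (Z j) &
        (delta%:E < P [set w | exists j, (M < `|Z j w|)%R])%E].
  apply: contrapT => no; apply: noM; exists M => phi J f Z h1 h2 h3.
  by rewrite leNgt; apply/negP => h4; apply: no; exists phi, J, f, Z.
have step := hump_step C0 delta0 bad.
(* The hypotheses on the current state are premises inside [good], so that every triple has a
   successor and [choice] applies. *)
pose good (x : (R -> E) * R * nat) (y : (R -> E) * R) :=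
  holder alpha x.1.1 -> 0 < x.1.2 -> [/\ holder_ball C y.1, 0 < y.2, y.2 <= x.1.2 / 2 &
    forall chi Y, holder alpha chi -> represents Y chi ->
      (forall t, 0 <= t <= 1 -> `|chi t - (x.1.1 t + x.1.2 *: y.1 t)| <= 2 * C * y.2) ->
      ((delta / 2)%:E <= P [set w | (x.2%:R < `|Y w|)%R])%E].
have ex x : exists y, good x y.
  case: x => -[psi rho] m.
  have [hpsi|nh] := pselect (holder alpha psi); last by exists (psi, rho) => /= h; case: nh.
  have [rho0|nr] := pselect (0 < rho); last by exists (psi, rho) => /= _ h; case: nr.
  by have [phi [rho' H]] := step psi rho m%:R hpsi rho0; exists (phi, rho').
have [nxt nxtP] := choice ex.
(* A state is the partial sum together with the coefficient of the next hump. *)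
pose st := fix st (m : nat) : (R -> E) * R := if m is k.+1 then
  ((fun t => (st k).1 t + (st k).2 *: (nxt (st k, k)).1 t), (nxt (st k, k)).2)
  else (fun=> 0, 1).
have holder0 : holder alpha (fun=> 0 : E).
  split; first by exists 0 => t _; rewrite normr0.
  by exists 0 => s t _ _ _; rewrite subrr normr0 mul0r.
have stP m : holder alpha (st m).1 /\ 0 < (st m).2.
  elim: m => [|m [h r]] /=; first by [].
  have [b r' _ _] := nxtP (st m, m) h r.
  split=> //; apply: holderD_scale => //; exact: holder_ballW b.
pose phi m := (nxt (st m, m)).1.
have goodP m : [/\ holder_ball C (phi m), (st m.+1).2 <= (st m).2 / 2 &
    forall chi Y, holder alpha chi -> represents Y chi ->
      (forall t, 0 <= t <= 1 -> `|chi t - (st m.+1).1 t| <= 2 * C * (st m.+1).2) ->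
      ((delta / 2)%:E <= P [set w | (m%:R < `|Y w|)%R])%E].
  by have [b r' r'' H] := nxtP (st m, m) (stP m).1 (stP m).2.
(* With rho_m the m-th coefficient, those already spent add up to at most 2 (1 - rho_m). The bound
   2C is thus uniform in m and survives the pointwise limit. *)
have st_lip m : (forall s t, 0 <= s -> s < t -> t <= 1 ->
    `|(st m).1 t - (st m).1 s| <= 2 * C * (1 - (st m).2) * (t - s) `^ alpha).
  elim: m => [|m IH] s t s0 st1 t1.
    by rewrite /= !subrr normr0 mulr0 mul0r.
  have [[_ L] r2 _] := goodP m.
  have -> : (st m.+1).1 t - (st m.+1).1 s =
     ((st m).1 t - (st m).1 s) + (st m).2 *: (phi m t - phi m s).
    by rewrite /= -/(phi m) scalerBr opprD addrACA.
  apply: le_trans (ler_normD _ _) _; rewrite normrZ gtr0_norm ?(stP m).2//.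
  have a1 := IH _ _ s0 st1 t1.
  have a2 := ler_wpM2l (ltW (stP m).2) (L _ _ s0 st1 t1).
  apply: le_trans (lerD a1 a2) _.
  rewrite mulrA -mulrDl ler_wpM2r ?powR_ge0//.
  by have := ler_wpM2l (ltW C0) r2; lra.
have lim t : exists l, 0 <= t <= 1 -> (st n).1 t @[n --> \oo] --> l /\
    forall m, `|l - (st m).1 t| <= 2 * (C * (st m).2).
  have [t01|t01] := boolP (0 <= t <= 1); last by exists 0.
  have g1 m : C * (st m.+1).2 <= C * (st m).2 / 2.
    by have [_ r2 _] := goodP m; rewrite -mulrA ler_wpM2l// ltW.
  have g2 m : `|(st m.+1).1 t - (st m).1 t| <= C * (st m).2.
    have [[b _] _ _] := goodP m; rewrite /= addrAC subrr add0r.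
    by rewrite normrZ gtr0_norm ?(stP m).2// mulrC ler_wpM2r ?(ltW (stP m).2)// b.
  have g0 m : 0 <= C * (st m).2 := mulr_ge0 (ltW C0) (ltW (stP m).2).
  have [l Hl] := @geometric_limit R E (fun n => (st n).1 t) _ g0 g1 g2.
  by exists l.
have [chi chiP] := choice lim.
have hchi : holder alpha chi.
  split.
    exists (2 * C) => t t01; have [_ /(_ 0%N)] := chiP t t01.
    by rewrite /= subr0 mulr1.
  exists (2 * C) => s t s0 st1 t1.
  have t01 : 0 <= t <= 1 by apply/andP; split; lra.
  have s01 : 0 <= s <= 1 by apply/andP; split; lra.
  apply: (@closed_cvg _ _ \oo _ (fun n => `|(st n).1 t - (st n).1 s|)
    (fun x => x <= 2 * C * (t - s) `^ alpha)).
  - exact: closed_le.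
  - near=> n; apply: le_trans (st_lip n _ _ s0 st1 t1) _.
    rewrite ler_wpM2r ?powR_ge0//.
    by have := mulr_ge0 (ltW C0) (ltW (stP n).2); lra.
  - apply: cvg_norm; apply: cvgB; [exact: (chiP t t01).1|exact: (chiP s s01).1].
have [Y Yrep] := holder_represents hchi.
have mY : measurable_fun setT (fun w => `|Y w|).
  apply: (measurable_strongly_comp (N := fun x : E => `|x|)) => //; first exact: Yrep.1.
  exact: norm_continuous.
have d4 : 0 < delta / 4 by lra.
have [K hK] := tail_small P mY d4.
have [_ _ /(_ chi Y hchi Yrep)] := goodP K.
have close : forall t, 0 <= t <= 1 -> `|chi t - (st K.+1).1 t| <= 2 * C * (st K.+1).2.
  by move=> t t01; have [_ H] := chiP t t01; rewrite -mulrA; exact: H.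
move=> /(_ close) H; have := le_trans H hK; rewrite lee_fin.
by lra.
Unshelve. all: by end_near. Qed.

End UniformBound.

(** * From the Wiener integral to Rademacher averages *)

Section Contraction.
Variables (R : realType) (V : lmodType R).

(** Adding the sign pattern of [c] modulo 2 permutes the cube. *)
Lemma avg_rsum_abs n (N : V -> R) (c : 'I_n -> R) (x : 'I_n -> V) :
  avg (fun e => N (rsum e (fun i => c i *: x i))) =
  avg (fun e => N (rsum e (fun i => `|c i| *: x i))).
Proof.
pose s : ecube n := [ffun i => c i < 0].
rewrite -(avg_inv _ (xorb_cubeK s)); apply: eq_avg => e; congr N.
apply: eq_bigr => i _; rewrite !ffunE signr_addb !scalerA; congr (_ *: _).
by rewrite [X in X * _]mulrC -mulrA; congr (_ * _); rewrite [RHS]real_normrEsign ?num_real.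
Qed.

(** A substitute for the norm that sees finitely many functionals only; by [lt_max_seminorm] its
    upper tails are the events of [uniform_tail_bound]. *)
Definition max_seminorm (J : finType) (f : J -> V -> R) (z : V) : R := \big[maxr/0]_j `|f j z|.

Lemma max_seminormP (J : finType) (f : J -> V -> R) :
  (forall j a x y, f j (a *: x + y) = a * f j x + f j y) -> seminorm (max_seminorm f).
Proof.
move=> lin.
have f0 j : f j 0 = 0 by have := lin j 1 0 0; rewrite scale1r addr0 mul1r; lra.
have fZ j a x : f j (a *: x) = a * f j x by rewrite -[a *: x]addr0 lin f0 addr0.
have N0 z : 0 <= max_seminorm f z by exact: bigmax_ge_id.
split=> [x y|a x].
  apply: bigmax_le => [|j _]; first by rewrite addr_ge0.
  rewrite -[x]scale1r lin mul1r scale1r; apply: le_trans (ler_normD _ _) _.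
  by apply: lerD; apply: (@le_bigmax_cond _ _ _ _ j xpredT (fun i => `|f i _|)).
have [->|a0] := eqVneq a 0.
  rewrite normr0 mul0r scale0r; apply/eqP; rewrite eq_le N0 andbT.
  by apply: bigmax_le => // j _; rewrite f0 normr0.
have a1 : 0 < `|a| by rewrite normr_gt0.
apply/eqP; rewrite eq_le; apply/andP; split.
  apply: bigmax_le => [|j _]; first by rewrite mulr_ge0.
  rewrite fZ normrM ler_wpM2l//.
  exact: (@le_bigmax_cond _ _ _ _ j xpredT (fun i => `|f i _|)).
rewrite mulrC -ler_pdivlMr//; apply: bigmax_le => [|j _]; first by rewrite divr_ge0// ltW.
rewrite ler_pdivlMr// mulrC -normrM -fZ.
exact: (@le_bigmax_cond _ _ _ _ j xpredT (fun i => `|f i _|)).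
Qed.

Lemma lt_max_seminorm (J : finType) (f : J -> V -> R) (M : R) (z : V) :
  0 <= M -> (M < max_seminorm f z) = [exists j, M < `|f j z|].
Proof.
move=> M0; apply/idP/existsP => [|[j h]]; last first.
  by apply: lt_le_trans h _; apply: (@le_bigmax_cond _ _ _ _ j xpredT (fun i => `|f i _|)).
move=> h; apply: contrapT => no; move: h; apply/negP; rewrite -leNgt.
by apply: bigmax_le => // j _; rewrite leNgt; apply/negP => h; apply: no; exists j.
Qed.

End Contraction.

(** * The Wiener integral of a single bump *)

Section BumpIntegral.
Context (R : realType) d (Omega : measurableType d) (P : probability Omega R).
Variable W : R -> Omega -> R.
Hypothesis bW : brownian P W.
Local Notation I01 := (`[0%R, 1%R]%classic : set R).
Local Notation v := (normal_var R).

Lemma wiener0 : wiener_integral P W (fun=> 0) (fun=> 0).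
Proof.
split; first exact: measurable_cst.
exists (fun=> [::]); split => //; split.
  under eq_fun => n. under eq_integral => t _.
    rewrite /step_fun big_nil subrr expr0n/=. over. rewrite integral0. over.
  exact: cvg_cst.
under eq_fun => n. under eq_integral => t _.
  rewrite /step_int big_nil subrr expr0n/=. over. rewrite integral0. over.
exact: cvg_cst.
Qed.

Lemma wiener_sum n (c : 'I_n -> R) (f : 'I_n -> R -> R) (Z : 'I_n -> Omega -> R) :
  (forall i, measurable_fun I01 (f i)) -> (forall i, wiener_integral P W (f i) (Z i)) ->
  wiener_integral P W (fun t => \sum_i c i * f i t) (fun w => \sum_i c i * Z i w).
Proof.
elim: n c f Z => [|n IH] c f Z mf fZ.
  have -> : (fun t => \sum_(i < 0) c i * f i t) = fun=> 0.
    by apply/funext => t; rewrite big_ord0.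
  have -> : (fun w => \sum_(i < 0) c i * Z i w) = fun=> 0.
    by apply/funext => w; rewrite big_ord0.
  exact: wiener0.
have -> : (fun t => \sum_i c i * f i t) = (fun t => c ord0 * f ord0 t +
    \sum_i c (lift ord0 i) * f (lift ord0 i) t).
  by apply/funext => t; rewrite big_ord_recl.
have -> : (fun t => \sum_i c i * Z i t) = (fun t => c ord0 * Z ord0 t +
    \sum_i c (lift ord0 i) * Z (lift ord0 i) t).
  by apply/funext => t; rewrite big_ord_recl.
apply: wiener_linear => //; last by apply: IH.
by apply: measurable_sum => i; exact: measurable_funM.
Qed.

Lemma measurable_bump_at eta k j (D : set R) : 0 < eta -> measurable_fun D (bump_at eta k j).
Proof.
move=> eta0; apply: measurable_funTS; apply: continuous_measurable_fun => t.
apply: (@continuous_comp _ _ _ (fun t : R => 4 ^+ k * t - j%:R) (bump eta)).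
  by apply: cvgB; [apply: cvgMr; exact: cvg_id|exact: cvg_cst].
exact: bump_continuous.
Qed.

(* So narrow that the L2 distance from a bump to the indicator of its slot is negligible
   against the length of the slot, see [wiener_bump_lower]. *)
Definition bump_width : R := (2 ^+ 13 * (v + 1))^-1.

Lemma bump_width_gt0 : 0 < bump_width.
Proof. by rewrite invr_gt0; have := normal_var_ge0 R; lra. Qed.

Lemma bump_width_le : bump_width <= 4^-1.
Proof. by rewrite /bump_width lef_pV2 ?posrE//; have := normal_var_ge0 R; lra. Qed.

(** Bump and indicator differ only on two end pieces of length eta / 4^k, and by at most 1 there. *)
Lemma bump_defect k j : (j < 4 ^ k)%N ->
  (\int[lebesgue_measure]_(t in I01)
     ((bump_at bump_width k j t - \1_`]j%:R / 4 ^+ k, j.+1%:R / 4 ^+ k] t) ^+ 2)%:E <=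
   (2 * bump_width / 4 ^+ k)%:E)%E.
Proof.
move=> jk; set eta := bump_width; have eta0 := bump_width_gt0; have eta4 := bump_width_le.
set h := 4 ^+ k; have h0 : 0 < h :> R by rewrite exprn_gt0.
pose I1 := (`[j%:R / h, (j%:R + eta) / h]%classic : set R).
pose I2 := (`[(j.+1%:R - eta) / h, j.+1%:R / h]%classic : set R).
have len (a b : R) : a <= b ->
    (\int[lebesgue_measure]_(t in I01) (\1_(`[a / h, b / h]) t)%:E <= ((b - a) / h)%:E)%E.
  move=> ab; rewrite integral_indic//.
  apply: (@le_trans _ _ (lebesgue_measure (`[a / h, b / h]%classic : set R))).
    by apply: le_measure; rewrite ?inE//; exact: measurableI.
  apply: (@le_trans _ _ (if a / h < b / h then (b / h - a / h)%:E else 0%E)).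
    rewrite le_eqVlt; apply/orP; left; apply/eqP.
    by apply: etrans (lebesgue_measure_itv `[a / h, b / h]) _; rewrite /= lte_fin.
  rewrite mulrBl; case: ifPn => // _; rewrite lee_fin subr_ge0.
  by rewrite ler_pM2r ?invr_gt0.
have -> : 2 * eta / h = 1 * (eta / h) + 1 * (eta / h) by ring.
pose D01 (t : R) := (bump_at eta k j t - \1_`]j%:R / h, j.+1%:R / h] t) ^+ 2.
have := @integral_le_comb2 _ _ R lebesgue_measure I01 1 1 (eta / h) (eta / h)
  (\1_I1) (\1_I2) D01.
have mI1 : measurable I1 by exact: measurable_itv.
have mI2 : measurable I2 by exact: measurable_itv.
apply => //; try exact: measurable_indic.
- have := len j%:R (j%:R + eta); rewrite lerDl (ltW eta0) addrAC subrr add0r.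
  by apply.
- have := len (j.+1%:R - eta) j.+1%:R; rewrite gerBl (ltW eta0) subKr.
  by apply.
move=> t _; rewrite /D01 sqr_ge0 !mul1r /=.
have bnd : (bump_at eta k j t - \1_`]j%:R / h, j.+1%:R / h] t) ^+ 2 <= 1.
  have := bump_ge0 eta (h * t - j%:R); have := bump_le1 eta (h * t - j%:R).
  rewrite -/(bump_at eta k j t); move: (bump_at _ _ _ _) => b b1 b0.
  by rewrite indicE; case: (_ \in _) => /=; nra.
have [t1|t1] := boolP (t \in I1).
  by apply: le_trans bnd _; rewrite [\1_I1 t]indicE t1 lerDl.
have [t2|t2] := boolP (t \in I2).
  by apply: le_trans bnd _; rewrite [\1_I2 t]indicE t2 lerDr.
rewrite [\1_I1 t]indicE (negbTE t1) [\1_I2 t]indicE (negbTE t2) addr0 /=.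
suff -> : bump_at eta k j t = \1_`]j%:R / h, j.+1%:R / h] t by rewrite subrr expr0n.
have hx x : (x / h <= t) = (x <= h * t) by rewrite ler_pdivrMr// mulrC.
have hy x : (t <= x / h) = (h * t <= x) by rewrite ler_pdivlMr// mulrC.
have hz x : (x / h < t) = (x < h * t) by rewrite ltr_pdivrMr// mulrC.
move: t1 t2; rewrite !notin_setE /I1 /I2 /= !in_itv/= !hx !hy => /negP t1 /negP t2.
rewrite indicE /bump_at -/h.
have jS : j.+1%:R = j%:R + 1 :> R by rewrite -natr1.
rewrite jS in t2 *.
have [u0|u0] := ltP (h * t) j%:R.
  rewrite bump_eq0//; last by apply/negP => /andP[]; lra.
  by rewrite memNset// /= in_itv/= hz => /andP[]; lra.
have [u1|u1] := ltP (j%:R + 1) (h * t).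
  rewrite bump_eq0//; last by apply/negP => /andP[]; lra.
  by rewrite memNset// /= in_itv/= hy => /andP[_]; lra.
rewrite u0/= in t1; rewrite u1 andbT in t2.
rewrite bump_eq1//; last by apply/andP; split; lra.
have e0 : 0 < eta := eta0.
by rewrite mem_set//= in_itv/= hz hy; apply/andP; split; lra.
Qed.

(** [G] is close in L2 to the increment [X] over the slot, whose deviation is tau = 2^(-k). The
    defect h pays tau/8 where [X] is small, which has probability at most 1/4, and bounds the
    modulus of [D] by AM-GM elsewhere. Each part has mean at most tau/32, so half of tau/8 survives
    in the mean. *)
Lemma wiener_bump_lower k j (G : Omega -> R) : (j < 4 ^ k)%N ->
  wiener_integral P W (bump_at bump_width k j) G ->
  exists h : Omega -> R, [/\ measurable_fun setT h, forall w, 0 <= h w,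
    (\int[P]_w (h w)%:E <= ((2^-1) ^+ k / 16)%:E)%E &
    forall w, (2^-1) ^+ k / 8 <= `|G w| + h w].
Proof.
move=> jk WG; set eta := bump_width; have eta0 : 0 < eta := bump_width_gt0.
pose tau : R := (2^-1) ^+ k; have tau0 : 0 < tau by rewrite exprn_gt0.
have tau2 : tau ^+ 2 = (4 ^+ k)^-1.
  by rewrite /tau -exprM mulnC exprM -exprVn; congr (_ ^+ _); field.
pose a : R := j%:R / 4 ^+ k; pose b : R := j.+1%:R / 4 ^+ k.
have h4 : 0 < 4 ^+ k :> R by rewrite exprn_gt0.
have a0 : 0 <= a by rewrite divr_ge0// ltW.
have ab : b - a = tau ^+ 2.
  by rewrite tau2 /a /b -mulrBl -natr1 addrAC subrr add0r mul1r.
have b1 : b <= 1.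
  by rewrite /b ler_pdivrMr// mul1r -natrX ler_nat.
have t20 : 0 < tau ^+ 2 by rewrite exprn_gt0.
have ltab : a < b by lra.
pose X w := W b w - W a w.
have mX : measurable_fun setT X by exact: (measurable_increment bW).
pose D w := (-1) * X w + G w.
have DW : wiener_integral P W (fun t => (-1) * \1_`]a, b] t + bump_at eta k j t) D.
  apply: wiener_linear => //; first exact: measurable_bump_at.
  by apply: wiener_increment => //; exact: ltW.
have mD : measurable_fun setT D by case: DW.
have ED : (\int[P]_w (D w ^+ 2)%:E <= (4 * v * (2 * eta * tau ^+ 2))%:E)%E.
  apply: (wiener_bound bW _ DW).
    by apply: measurable_funD; [exact: measurable_funM|exact: measurable_bump_at].
  have := bump_defect jk; rewrite -/eta -/a -/b -tau2; apply: le_trans.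
  apply: le_integral_ge0 => t _; first by rewrite lee_fin sqr_ge0.
  by rewrite mulN1r addrC lexx.
pose S := [set w | `|X w| <= tau / 8].
have mS : measurable S.
  have -> : S = ~` [set w | tau / 8 < `|X w|].
    by apply/seteqP; split => w; rewrite /S/= leNgt => /negP.
  by apply: measurableC; apply: measurable_gt; exact: measurableT_comp.
have PS : (P S <= (4^-1)%:E)%E.
  have := bW.2.2.2.1 a b a0 ltab b1 [set x | `|x| <= tau / 8] => law.
  rewrite (_ : S = X @^-1` [set x | `|x| <= tau / 8])// law; last first.
    have -> : [set x : R | `|x| <= tau / 8] = `[- (tau / 8), tau / 8]%classic.
      by apply/seteqP; split => x /=; rewrite in_itv/= ler_norml.
    exact: measurable_itv.
  have -> : Num.sqrt (b - a) = tau by rewrite ab sqrtr_sqr gtr0_norm.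
  have e8 : (0 : R) <= 8^-1 by [].
  have := normal_small_ball tau0 e8; rewrite mulrC.
  by move=> H; apply: le_trans H _; rewrite lee_fin; lra.
pose h w := tau / 8 * \1_S w + (tau / 64 + 16 / tau * D w ^+ 2).
have mD2 : measurable_fun setT (fun w => tau / 64 + 16 / tau * D w ^+ 2).
  by apply: measurable_funD => //; apply: measurable_funM => //; exact: measurable_funX.
have c8 : 0 <= tau / 8 by lra.
have c64 : 0 <= tau / 64 by lra.
have c16 : 0 <= 16 / tau by rewrite divr_ge0// ltW.
have D20 w : 0 <= tau / 64 + 16 / tau * D w ^+ 2 := addr_ge0 c64 (mulr_ge0 c16 (sqr_ge0 _)).
have h0 w : 0 <= h w by rewrite addr_ge0// mulr_ge0// indicE ler0n.
exists h; split => //.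
- by apply: measurable_funD => //; apply: measurable_funM => //; exact: measurable_indic.
- have ED2 : (\int[P]_w (tau / 64 + 16 / tau * D w ^+ 2)%:E <=
     (tau / 64 * 1 + 16 / tau * (4 * v * (2 * eta * tau ^+ 2)))%:E)%E.
    apply: (integral_le_comb2 (g1 := fun=> 1) _ _ _ _ _ _ _ _ ED) => //.
    + by move=> w _; exact: sqr_ge0.
    + exact: measurable_funX.
    + by rewrite integral_cst//= probability_setT mule1.
    + by move=> w _; rewrite mulr1 lexx andbT.
  have PS' : (\int[P]_w (\1_S w)%:E <= (4^-1)%:E)%E by rewrite integral_indic// setIT.
  have -> : tau / 16 = tau / 8 * 4^-1 + 1 * (tau / 32) by field.
  apply: (integral_le_comb2 (g1 := \1_S) _ _ _ _ _ _ mD2 PS' (m2 := tau / 32)) => //.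
  + apply: le_trans ED2 _; rewrite lee_fin.
    have -> : tau / 64 * 1 + 16 / tau * (4 * v * (2 * eta * tau ^+ 2)) =
      tau / 64 + 2 ^+ 13 * (v * eta) * (tau / 64) by field; rewrite gt_eqF.
    (* The constant 2^13 of [bump_width] serves here: the mean of 16/tau times D^2 becomes at most
       tau/64. *)
    have : 2 ^+ 13 * (v * eta) <= 1.
      rewrite /eta /bump_width mulrA ler_pdivrMr; last by have := normal_var_ge0 R; lra.
      by lra.
    by move=> ve; have := ler_wpM2r (ltW tau0) ve; lra.
  + by move=> w _; rewrite mul1r lexx andbT; exact: h0.
- move=> w; rewrite -/tau /h indicE.
  have D0 : `|D w| <= tau / 64 + 16 / tau * D w ^+ 2.
    rewrite -subr_ge0 -[D w ^+ 2]real_normK ?num_real//; set y := `|_|.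
    have -> : tau / 64 + 16 / tau * y ^+ 2 - y = 16 / tau * (y - tau / 32) ^+ 2.
      by field; rewrite gt_eqF.
    by rewrite mulr_ge0 ?sqr_ge0// divr_ge0// ltW.
  have [wS|wS] := boolP (w \in S).
    by have := normr_ge0 (G w); have := D20 w; rewrite /= mulr1; lra.
  rewrite /= mulr0 add0r.
  have : tau / 8 < `|X w| by move: wS; rewrite notin_setE /S/= => /negP; rewrite ltNge.
  have : `|X w| <= `|G w| + `|D w|.
    have -> : X w = G w - D w by rewrite /D; ring.
    exact: ler_normB.
  by lra.
Qed.

End BumpIntegral.

(** * Rademacher averages of vectors in distinct slots *)

Section RademacherBound.
Context (R : realType) (E : completeNormedModType R) (alpha a : R).
Context d (Omega : measurableType d) (P : probability Omega R) (W : R -> Omega -> R).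
Hypothesis bW : brownian P W.
Hypothesis intW : forall phi : R -> E, holder alpha phi -> stoch_integrable P W phi.
Hypotheses (alpha0 : 0 < alpha) (alpha1 : alpha <= 1).
Hypotheses (a2 : 2^-1 <= a) (a1 : a < 1) (a4 : a * 4 `^ alpha = 1).
Local Notation eta := (bump_width R).
Local Notation I01 := (`[0%R, 1%R]%classic : set R).

Definition slot_norm : R := maxr (1 - a)^-1 (4 / eta * ((1 - a)^-1 + 1)).

Lemma slot_norm_gt0 : 0 < slot_norm.
Proof. by rewrite lt_max invr_gt0 subr_gt0 a1. Qed.

Lemma bump_sum_ball n (lev pos : 'I_n -> nat) (x : 'I_n -> E) :
  slot_inj lev pos -> (forall i, `|x i| <= 1) ->
  holder_ball alpha slot_norm (bump_sum eta a lev pos x).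
Proof.
move=> inj x1; have e0 := bump_width_gt0 R; have e1 := bump_width_le R.
have a0 : 0 <= a by apply: le_trans a2; rewrite invr_ge0.
split=> [t _|s t s0 st t1].
  apply: le_trans (bump_sum_bounded t e0 a0 a1 inj x1) _.
  by rewrite le_max lexx.
have eta1 : eta <= 1 by lra.
have ts : t - s <= 1 by lra.
apply: le_trans (bump_sum_holder e0 eta1 a2 a1 alpha0 alpha1 a4 inj x1 st ts) _.
by rewrite ler_wpM2r ?powR_ge0// le_max lexx orbT.
Qed.

(* The scalar integral exists because [bump_at eta k j] is, up to scaling, a functional
   applied to the Hoelder function [bump_at eta k j *: x0]; no L2 theory is needed. *)
Lemma wiener_bump (x0 : E) k j : x0 != 0 ->
  exists G, wiener_integral P W (bump_at eta k j) G.
Proof.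
move=> x00; have [f [df fb fx]] := norming_functional x0.
have nx0 : 0 < `|x0| by rewrite normr_gt0.
have a0 : 0 < a by apply: lt_le_trans a2; rewrite invr_gt0.
have f0 : f 0 = 0.
  by apply/normr0_eq0/eqP; rewrite eq_le normr_ge0 andbT; have := fb 0; rewrite normr0.
pose y := `|x0|^-1 *: x0.
have fy : f y = 1.
  have := dual_linear `|x0|^-1 x0 0 df; rewrite add0r => ->.
  by rewrite f0 add0r fx mulVf// gt_eqF.
pose phi := bump_sum eta a (fun _ : 'I_1 => k) (fun=> j) (fun=> y).
have hphi : holder alpha phi.
  apply: holder_ballW (bump_sum_ball _ _); first by move=> i i' _ _; rewrite !ord1.
  by move=> _; rewrite /y normrZ normfV normr_id mulVf// gt_eqF.
have [Y [_ /(_ f df)[Z [ZW _]]]] := holder_represents intW hphi.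
have mf := measurable_dual_holder intW hphi df.
exists (fun w => (a ^+ k)^-1 * Z w + 0).
have -> : bump_at eta k j = (fun t => (a ^+ k)^-1 * (f \o phi) t + 0).
  apply/funext => t; rewrite addr0 /= /phi /bump_sum big_ord1.
  have := dual_linear (a ^+ k * bump_at eta k j t) y 0 df; rewrite add0r => ->.
  by rewrite f0 add0r fy mulr1 mulKf// expf_neq0// gt_eqF.
by apply: wiener_linear => //; exact: wiener0.
Qed.

Lemma dual_rsum (f : E -> R) n (e : ecube n) (c : 'I_n -> R) (x : 'I_n -> E) : dual_elt f ->
  f (rsum e (fun i => c i *: x i)) = \sum_i (-1) ^+ e i * c i * f (x i).
Proof.
move=> df.
have f0 : f 0 = 0 by have := dual_linear 1 0 0 df; rewrite scale1r addr0 mul1r; lra.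
rewrite /rsum; elim/big_rec2: _ => // i y1 y2 _ <-.
by rewrite scalerA addrC dual_linear// addrC.
Qed.

(** With f e norming the target sum [z e], the form that maps g to the sum of c_i g_i equals the
    mean norm of the target at g_i = 2^(-lev i), and at the moduli of the [G i] it is dominated by
    the sign average of [max_seminorm]. Being linear with c_i >= 0, it lets the marginal bounds of
    [wiener_bump_lower] be summed without any joint law. *)
Theorem rademacher_bound : exists C : R, 0 <= C /\
  forall n (lev pos : 'I_n -> nat) (x : 'I_n -> E),
    slot_inj lev pos -> (forall i, pos i < 4 ^ lev i)%N -> (forall i, `|x i| <= 1) ->
    avg (fun e => `|rsum e (fun i => (a / 2) ^+ lev i *: x i)|) <= C.
Proof.
have [triv|nt] := pselect (forall x : E, x = 0).
  exists 0; split => // n lev pos x _ _ _.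
  by under eq_avg => e do rewrite [rsum _ _]triv normr0; rewrite avg_cst.
have /existsNP[x0 /eqP x00] := nt.
have ex_G (kj : nat * nat) : exists G, wiener_integral P W (bump_at eta kj.1 kj.2) G.
  exact: wiener_bump x00.
have [G0 G0W] := choice ex_G.
(* With s the average to be bounded, the final balance reads s/8 <= 2M + s/32 + s/16; it leaves s/32
   <= 2M, whence 64 M. *)
have d32 : (0 : R) < 32^-1 by [].
have [M0 HM] := uniform_tail_bound bW intW slot_norm_gt0 d32.
pose M := maxr M0 0; have M_ge0 : 0 <= M by rewrite le_max lexx orbT.
exists (64 * M); split; first by rewrite mulr_ge0.
move=> n lev pos x inj posl x1.
have a0 : 0 < a by apply: lt_le_trans a2; rewrite invr_gt0.
pose G i := G0 (lev i, pos i).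
have GW i : wiener_integral P W (bump_at eta (lev i) (pos i)) (G i) := G0W (lev i, pos i).
have mG i : measurable_fun setT (G i) by case: (GW i).
have hex i := wiener_bump_lower bW (posl i) (GW i).
have [h hP] := choice hex.
pose z e := rsum e (fun i => (a / 2) ^+ lev i *: x i).
have nex e := norming_functional (z e).
have [f fP] := choice nex.
have df e : dual_elt (f e) by case: (fP e).
have fz e : f e (z e) = `|z e| by case: (fP e).
have fball e : dual_ball (f e) by case: (fP e).
have flin e b u u' : f e (b *: u + u') = b * f e u + f e u' by case: (df e) => + _; exact.
pose beta i := avg (fun e => (-1) ^+ (e i) * f e (x i)).
(* Monotonicity of the subdifferential of the norm, applied to [z e] and [z (flip i e)]. *)
have beta0 i : 0 <= beta i.
  suff : 0 <= beta i + beta i by lra.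
  rewrite -{2}[beta i](avg_inv _ (flipK i)) -avgD; apply: avg_ge0 => e.
  set e' := flip i e; have se : (-1) ^+ e' i = - (-1) ^+ e i :> R.
    by rewrite ffunE eqxx addbT; case: (e i); rewrite /= ?opprK.
  rewrite se mulNr -mulrBr.
  have ze : z e' = z e + (- (2 * (-1) ^+ e i * (a / 2) ^+ lev i)) *: x i.
    by rewrite /z rsum_flip scalerA scaleNr.
  have [_ b1 n1] := fP e; have [_ b2 n2] := fP e'.
  have h1 := le_trans (ler_norm _) (b2 (z e)); rewrite -n1 in h1.
  have h2 := le_trans (ler_norm _) (b1 (z e')); rewrite -n2 ze !dual_linear// in h2.
  have b0 : 0 < (a / 2) ^+ lev i by rewrite exprn_gt0// divr_gt0.
  have : 0 <= 2 * (a / 2) ^+ lev i * ((-1) ^+ e i * (f e (x i) - f e' (x i))) by lra.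
  by rewrite pmulr_rge0// mulr_gt0.
pose c i := a ^+ lev i * beta i.
have c0 i : 0 <= c i by rewrite mulr_ge0 ?exprn_ge0// ltW.
pose S w e := rsum e (fun i => (a ^+ lev i * G i w) *: x i).
pose N := max_seminorm f.
have semN : seminorm N by exact: max_seminormP.
have Zint (e e' : ecube n) :
    wiener_integral P W (f e' \o bump_sum eta a lev pos (fun i => (-1) ^+ e i *: x i))
    (fun w => f e' (S w e)).
  pose b i : R := (-1) ^+ e i * a ^+ lev i * f e' (x i).
  have -> : f e' \o bump_sum eta a lev pos (fun i => (-1) ^+ e i *: x i) =
      fun t => \sum_i b i * bump_at eta (lev i) (pos i) t.
    apply/funext => t /=.
    transitivity (f e' (rsum e (fun i => (a ^+ lev i * bump_at eta (lev i) (pos i) t) *: x i))).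
      by congr (f e'); apply: eq_bigr => i _; rewrite !scalerA mulrC.
    by rewrite dual_rsum//; apply: eq_bigr => i _; rewrite /b; ring.
  have -> : (fun w => f e' (S w e)) = fun w => \sum_i b i * G i w.
    by apply/funext => w; rewrite dual_rsum//; apply: eq_bigr => i _; rewrite /b; ring.
  apply: wiener_sum => // i; apply: measurable_bump_at; exact: bump_width_gt0.
have mBc (r : R) e : measurable [set w | exists e', r < `|f e' (S w e)|].
  have -> : [set w | exists e', r < `|f e' (S w e)|] =
      \bigcup_(e' in [set: ecube n]) [set w | r < `|f e' (S w e)|].
    by apply/seteqP; split => w /=; [move=> [e' h']; exists e'|move=> [e' _ h']; exists e'].
  apply: fin_bigcup_measurable => [|e' _]; first exact: finite_finset.
   apply: measurable_gt.
  by apply: measurableT_comp => //; case: (Zint e e').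
pose B e := [set w | exists e', M < `|f e' (S w e)|].
have mB e : measurable (B e) by exact: mBc.
have PB e : (P (B e) <= (32^-1)%:E)%E.
  have := HM (bump_sum eta a lev pos (fun i => (-1) ^+ e i *: x i)) (ecube n) f
    (fun e' w => f e' (S w e)) _ fball (Zint e).
  move=> H; apply: le_trans (H _); last first.
    by apply: bump_sum_ball => // i; rewrite normrZ normr_sign mul1r.
  apply: le_measure; rewrite ?inE; [exact: mB|exact: mBc|].
  by move=> w [e' h']; exists e'; apply: le_lt_trans h'; rewrite le_max lexx.
(* The proportion of sign patterns that are bad at [w]. Its mean is at most 1/32, which turns a
   probability bound for each fixed pattern into a quantile over patterns for most [w]. *)
pose q w := avg (fun e => \1_(B e) w : R).
have mq : measurable_fun setT q.
  apply: measurable_funM => //; apply: measurable_sum => e; exact: measurable_indic.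
have q0 w : 0 <= q w by apply: avg_ge0 => e; rewrite indicE.
have Eq : (\int[P]_w (q w)%:E <= (32^-1)%:E)%E.
  rewrite -(avg_cst n 32^-1) /avg mulr_sumr.
  apply: (integral_le_comb (c := fun=> (2 ^+ n)^-1) (m := fun=> 32^-1)
    (g := fun e => \1_(B e))) => //.
  - by move=> e; rewrite integral_indic// setIT; exact: PB.
  - by move=> w _; rewrite q0 /q /avg mulr_sumr lexx.
have good w : q w <= 8^-1 -> \sum_i c i * `|G i w| <= 2 * M.
  move=> qw; have : avg (fun e => N (S w e)) <= 2 * M.
    apply: avg_le_quantile => //; apply: le_trans qw.
    apply: le_avg => e; rewrite lt_max_seminorm// indicE ler_nat.
    case: existsP => //= -[e' h'].
    by rewrite mem_set//; exists e'.
  (* The random signs absorb those of the [G i]; testing the pattern [e] with the single functional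
     f e then leaves the linear form. *)
  apply: le_trans; rewrite /S avg_rsum_abs.
  apply: (@le_trans _ _ (avg (fun e =>
      f e (rsum e (fun i => `|a ^+ lev i * G i w| *: x i))))); last first.
    apply: le_avg => e; apply: le_trans (ler_norm _) _.
    exact: (@le_bigmax_cond _ _ _ _ e xpredT (fun j => `|f j _|)).
  under eq_avg => e do rewrite dual_rsum//.
  rewrite avg_sum; apply: ler_sum => i _.
  under eq_avg => e do rewrite mulrAC mulrC.
  by rewrite avgZ normrM (ger0_norm (exprn_ge0 _ (ltW a0))) /c -/(beta i) mulrAC.
have total : \sum_i c i * (2^-1) ^+ lev i = avg (fun e => `|z e|).
  under [RHS]eq_avg => e do rewrite -fz dual_rsum//.
  rewrite avg_sum; apply: eq_bigr => i _.
  under [RHS]eq_avg => e do rewrite mulrAC mulrC.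
  by rewrite avgZ -/(beta i) /c exprMn mulrAC.
pose tau i : R := (2^-1) ^+ lev i.
have tau0 i : 0 <= tau i by rewrite exprn_ge0.
(* Where q w <= 1/8 the quantile lemma applies. Elsewhere the left side, being s/8 with s the sum of
   the c_i tau_i, is already below s times q w. *)
have key w : \sum_i c i * (tau i / 8) <= 2 * M + (\sum_i c i * tau i) * q w + \sum_i c i * h i w.
  have H : \sum_i c i * (tau i / 8) <= \sum_i c i * `|G i w| + \sum_i c i * h i w.
    rewrite -big_split/=; apply: ler_sum => i _; rewrite -mulrDr ler_wpM2l//.
    by case: (hP i).
  have s0 : 0 <= \sum_i c i * tau i by rewrite sumr_ge0// => i _; rewrite mulr_ge0.
  have sh0 : 0 <= \sum_i c i * h i w.
    by rewrite sumr_ge0// => i _; rewrite mulr_ge0//; case: (hP i).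
  have [qs|qb] := leP (q w) 8^-1.
    apply: le_trans H _; rewrite lerD2r; apply: le_trans (good w qs) _.
    by rewrite lerDl mulr_ge0.
  have -> : \sum_i c i * (tau i / 8) = (\sum_i c i * tau i) * 8^-1.
    by rewrite mulr_suml; apply: eq_bigr => i _; rewrite mulrA.
  by have := ler_wpM2l s0 (ltW qb); lra.
have sumh : (\int[P]_w (\sum_i c i * h i w)%:E <= (\sum_i c i * (tau i / 16))%:E)%E.
  apply: (integral_le_comb (g := h)) => //; try by move=> i; case: (hP i).
  by move=> w _; rewrite lexx andbT sumr_ge0// => i _; rewrite mulr_ge0//; case: (hP i).
rewrite -total -/tau.
set s := \sum_i c i * tau i in key *.
have H1 : (\int[P]_w (2 * M + s * q w)%:E <= (2 * M * 1 + s * 32^-1)%:E)%E.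
  have s0 : 0 <= s by rewrite sumr_ge0// => i _; rewrite mulr_ge0.
  apply: (integral_le_comb2 (g1 := fun=> 1) _ _ _ _ _ _ mq _ Eq) => //.
  - by rewrite mulr_ge0.
  - by rewrite integral_cst//= probability_setT mule1.
  - by move=> w _; rewrite mulr1 lexx andbT addr_ge0// mulr_ge0.
have s0 : 0 <= s by rewrite sumr_ge0// => i _; rewrite mulr_ge0.
have msum : measurable_fun setT (fun w => \sum_i c i * h i w).
  by apply: measurable_sum => i; apply: measurable_funM => //; case: (hP i).
have mqs : measurable_fun setT (fun w => 2 * M + s * q w).
  by apply: measurable_funD => //; exact: measurable_funM.
have sh0 w : 0 <= \sum_i c i * h i w.
  by rewrite sumr_ge0// => i _; rewrite mulr_ge0//; case: (hP i).
have := integral_le_comb2 (mu := P) (f := fun=> \sum_i c i * (tau i / 8)) measurableT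
  ler01 ler01 _ _ mqs msum H1 sumh.
rewrite integral_cst//= probability_setT mule1 lee_fin => H.
have e1 k : \sum_i c i * (tau i / k) = s / k.
  by rewrite /s mulr_suml; apply: eq_bigr => i _; rewrite mulrA.
have : s / 8 <= 1 * (2 * M * 1 + s * 32^-1) + 1 * (s / 16).
  rewrite -(e1 8) -(e1 16); apply: H => //.
  - by move=> w _; rewrite addr_ge0// mulr_ge0.
  - move=> w _; rewrite !mul1r key andbT.
    by rewrite sumr_ge0// => i _; apply: mulr_ge0 => //; apply: divr_ge0.
by lra.
Qed.

End RademacherBound.

(** * Sums of independent finitely valued variables *)

Section ProductWeights.
Variables (R : realType) (n : nat) (V : finType) (q : 'I_n -> V -> R).
Hypothesis q0 : forall i v, 0 <= q i v.
Hypothesis q1 : forall i, \sum_v q i v = 1.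
Implicit Types f g : {ffun 'I_n -> V}.

Definition weight f : R := \prod_i q i (f i).

Definition expect (F : {ffun 'I_n -> V} -> R) : R := \sum_f weight f * F f.

Lemma weight_ge0 f : 0 <= weight f.
Proof. by apply: prodr_ge0. Qed.

Lemma expect_prod (G : 'I_n -> V -> R) :
  expect (fun f => \prod_i G i (f i)) = \prod_i \sum_v q i v * G i v.
Proof.
rewrite (bigA_distr_bigA (fun i v => q i v * G i v)).
by apply: eq_bigr => f _; rewrite /weight -big_split.
Qed.

Lemma sum_weight : \sum_f weight f = 1.
Proof.
rewrite /weight -(bigA_distr_bigA (fun i v => q i v)).
by rewrite big1// => i _; exact: q1.
Qed.

Lemma expect_cst (c : R) : expect (fun=> c) = c.
Proof. by rewrite /expect -mulr_suml sum_weight mul1r. Qed.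

Lemma eq_expect F G : F =1 G -> expect F = expect G.
Proof. by move=> FG; apply: eq_bigr => f _; rewrite FG. Qed.

Lemma expectD F G : expect (fun f => F f + G f) = expect F + expect G.
Proof. by rewrite /expect -big_split; apply: eq_bigr => f _; rewrite mulrDr. Qed.

Lemma expectZ c F : expect (fun f => c * F f) = c * expect F.
Proof. by rewrite /expect mulr_sumr; apply: eq_bigr => f _; rewrite mulrCA. Qed.

Lemma expect_sum (I : finType) (F : I -> {ffun 'I_n -> V} -> R) :
  expect (fun f => \sum_i F i f) = \sum_i expect (F i).
Proof.
by rewrite /expect exchange_big; apply: eq_bigr => f _ /=; rewrite mulr_sumr.
Qed.

Lemma le_expect F G : (forall f, F f <= G f) -> expect F <= expect G.
Proof. by move=> FG; apply: ler_sum => f _; rewrite ler_wpM2l ?weight_ge0. Qed.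

Lemma expect_marginal i (G : V -> R) : expect (fun f => G (f i)) = \sum_v q i v * G v.
Proof.
pose G' j v : R := if j == i then G v else 1.
transitivity (expect (fun f => \prod_j G' j (f j))).
  apply: eq_expect => f; rewrite (bigD1 i)//= /G' eqxx big1 ?mulr1// => j ji.
  by rewrite (negbTE ji).
rewrite expect_prod (bigD1 i)//= /G' eqxx [X in _ * X]big1 ?mulr1// => j ji.
by rewrite (negbTE ji); under eq_bigr do rewrite mulr1.
Qed.

Lemma expect_marginal2 i j (G H : V -> R) : i != j ->
  expect (fun f => G (f i) * H (f j)) = (\sum_v q i v * G v) * (\sum_v q j v * H v).
Proof.
move=> ij; pose G' k v : R := if k == i then G v else if k == j then H v else 1.
transitivity (expect (fun f => \prod_k G' k (f k))).
  apply: eq_expect => f; rewrite (bigD1 i)//= (bigD1 j)/=; last by rewrite eq_sym.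
  rewrite /G' eqxx [j == i]eq_sym (negbTE ij) eqxx big1 ?mulr1// => k /andP[ki kj].
  by rewrite (negbTE ki) (negbTE kj).
rewrite expect_prod (bigD1 i)//= (bigD1 j)/=; last by rewrite eq_sym.
rewrite /G' eqxx [j == i]eq_sym (negbTE ij) eqxx [X in _ * (_ * X)]big1 ?mulr1//.
move=> k /andP[ki kj].
by rewrite (negbTE ki) (negbTE kj); under eq_bigr do rewrite mulr1.
Qed.

(** Independence kills the off-diagonal covariances, and an indicator of mean m_i has variance m_i -
    m_i^2 <= m_i. *)
Lemma variance_count_le (b : pred V) (mu := \sum_i \sum_(v | b v) q i v) :
  expect (fun f => (\sum_i (b (f i))%:R - mu) ^+ 2) <= mu.
Proof.
pose m i := \sum_(v | b v) q i v.
have mE i : \sum_v q i v * (b v)%:R = m i.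
  rewrite /m [RHS]big_mkcond; apply: eq_bigr => v _.
  by case: (b v); rewrite ?mulr1 ?mulr0.
have m0 i : 0 <= m i by apply: sumr_ge0.
pose D i f := (b (f i))%:R - m i.
have ED i : \sum_v q i v * ((b v)%:R - m i) = 0.
  by under eq_bigr do rewrite mulrBr; rewrite sumrB -mulr_suml q1 mE mul1r subrr.
rewrite (@eq_expect _ (fun f => \sum_i \sum_j D i f * D j f)); last first.
  by move=> f; rewrite /mu -sumrB expr2 big_distrlr.
rewrite expect_sum /mu; apply: ler_sum => i _.
rewrite expect_sum (bigD1 i)//= [X in _ + X]big1 ?addr0; last first.
  move=> j ji; rewrite (@expect_marginal2 i j (fun v => (b v)%:R - m i) (fun v => (b v)%:R - m j)).
    by rewrite ED mul0r.
  by rewrite eq_sym.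
rewrite (expect_marginal i (fun v => ((b v)%:R - m i) * ((b v)%:R - m i))).
rewrite -/(m i) -[leRHS](mE i); apply: (@le_trans _ _ (m i - m i ^+ 2)); last first.
  by rewrite mE gerBl sqr_ge0.
rewrite le_eqVlt; apply/orP; left; apply/eqP.
transitivity (\sum_v (q i v * (b v)%:R - m i * (q i v * (b v)%:R) -
  m i * (q i v * ((b v)%:R - m i)))).
  by apply: eq_bigr => v _; case: (b v) => /=; ring.
by rewrite !sumrB -!mulr_sumr ED mE mulr0 subr0 expr2.
Qed.

End ProductWeights.

Section Symmetrization.
Variables (R : realType) (n : nat) (V : finType) (q : 'I_n -> V -> R) (E : lmodType R).
Hypothesis q0 : forall i v, 0 <= q i v.
Hypothesis q1 : forall i, \sum_v q i v = 1.
Variable N : E -> R.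
Hypothesis semN : seminorm N.

Definition swap (e : ecube n) (f g : {ffun 'I_n -> V}) : {ffun 'I_n -> V} :=
  [ffun i => if e i then g i else f i].

(* Subtract an independent copy, which Jensen allows, then exchange the two copies in the
   coordinates selected by [e]. *)
Lemma symmetrization (c : V -> R) (x : 'I_n -> E) :
  expect q (fun f => N (\sum_i (c (f i) - \sum_v q i v * c v) *: x i)) <=
  2 * expect q (fun f => avg (fun e => N (rsum e (fun i => c (f i) *: x i)))).
Proof.
pose D (f g : {ffun 'I_n -> V}) (e : ecube n) := rsum e (fun i => (c (f i) - c (g i)) *: x i).
pose e0 : ecube n := [ffun=> false].
pose w := weight q.
have w0 f : 0 <= w f by exact: weight_ge0.
have step1 (f : {ffun 'I_n -> V}) :
    N (\sum_i (c (f i) - \sum_v q i v * c v) *: x i) <= expect q (fun g => N (D f g e0)).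
  have -> : \sum_i (c (f i) - \sum_v q i v * c v) *: x i = \sum_g w g *: D f g e0.
    rewrite /D /rsum; under [RHS]eq_bigr do rewrite scaler_sumr.
    rewrite exchange_big; apply: eq_bigr => i _ /=.
    under [RHS]eq_bigr => g _ do rewrite ffunE expr0 scale1r scalerA.
    rewrite -scaler_suml; congr (_ *: _).
    under [RHS]eq_bigr do rewrite mulrBr.
    by rewrite sumrB -mulr_suml sum_weight// mul1r -(expect_marginal q1).
  apply: le_trans (seminorm_sum semN _ _ _) _; apply: ler_sum => g _.
  by rewrite semN.2 ger0_norm.
have step2 e : \sum_f \sum_g w f * w g * N (D f g e0) = \sum_f \sum_g w f * w g * N (D f g e).
  pose h (fg : {ffun 'I_n -> V} * {ffun 'I_n -> V}) := (swap e fg.1 fg.2, swap e fg.2 fg.1).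
  have hK : involutive h.
    move=> [f g]; rewrite /h /=; congr (_, _); apply/ffunP => i; rewrite !ffunE.
      by case: (e i).
    by case: (e i).
  rewrite !pair_big/= (reindex h)/=; last by exists h => fg _; exact: hK.
  apply: eq_bigr => -[f g] _ /=; congr (_ * _).
    rewrite /w /weight -!big_split; apply: eq_bigr => i _; rewrite !ffunE.
    by case: (e i); rewrite //= mulrC.
  congr N; apply: eq_bigr => i _; rewrite !ffunE expr0 scale1r scalerA.
  by case: (e i); rewrite /= ?mulN1r ?mul1r ?opprB.
have step3 e : \sum_f \sum_g w f * w g * N (D f g e) <=
    2 * expect q (fun f => N (rsum e (fun i => c (f i) *: x i))).
  pose r f := N (rsum e (fun i => c (f i) *: x i)).
  apply: (@le_trans _ _ (\sum_f \sum_g (w f * r f * w g + w f * (w g * r g)))).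
    apply: ler_sum => f _; apply: ler_sum => g _.
    rewrite [leRHS](_ : _ = w f * w g * (r f + r g)); last by ring.
    rewrite ler_wpM2l ?mulr_ge0//.
    have -> : D f g e = rsum e (fun i => c (f i) *: x i) + - rsum e (fun i => c (g i) *: x i).
      by rewrite /D /rsum -sumrB; apply: eq_bigr => i _; rewrite scalerBl scalerBr.
    by rewrite /r -[N (rsum e (fun i => c (g i) *: _))](seminormN semN); exact: semN.1.
  under eq_bigr => f _ do rewrite big_split/= -!mulr_sumr sum_weight// mulr1.
  rewrite big_split/= -mulr_suml sum_weight// mul1r.
  by rewrite /expect -/w; rewrite mulr_natl mulr2n.
apply: (@le_trans _ _ (\sum_f \sum_g w f * w g * N (D f g e0))).
  apply: ler_sum => f _; rewrite -/w.
  by under [leRHS]eq_bigr do rewrite -mulrA; rewrite -mulr_sumr ler_wpM2l//; exact: step1.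
rewrite -[leLHS](avg_cst n).
have -> : expect q (fun f => avg (fun e => N (rsum e (fun i => c (f i) *: x i)))) =
    avg (fun e => expect q (fun f => N (rsum e (fun i => c (f i) *: x i)))).
  by rewrite /expect avg_sum; apply: eq_bigr => f _; rewrite avgZ.
by rewrite -avgZ; apply: le_avg => e; rewrite (step2 e); exact: step3.
Qed.

End Symmetrization.

(** * Rademacher sums with overfull levels *)

Section Shells.
Variables (R : realType) (E : normedModType R) (rho C : R).

Definition rademacher_bounded := forall n (lev pos : 'I_n -> nat) (x : 'I_n -> E),
    slot_inj lev pos -> (forall i, pos i < 4 ^ lev i)%N -> (forall i, `|x i| <= 1) ->
    avg (fun e => `|rsum e (fun i => rho ^+ lev i *: x i)|) <= C.

Lemma seminorm_norm : seminorm (fun x : E => `|x|).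
Proof. by split; [exact: ler_normD|exact: normrZ]. Qed.

(* Members outside the subfamily [A] are set to [0] and sent to fresh slots. *)
Lemma rademacher_sub n (A : pred 'I_n) (lev pos : 'I_n -> nat) (y : 'I_n -> E) :
  0 < rho -> rademacher_bounded ->
  (forall i i', A i -> A i' -> lev i = lev i' -> pos i = pos i' -> i = i') ->
  (forall i, pos i < 4 ^ lev i)%N -> (forall i, `|y i| <= rho ^+ lev i) ->
  avg (fun e => `|rsum e (fun i => if A i then y i else 0)|) <= C.
Proof.
move=> rho0 bnd inj posl yl.
pose L := (\max_i lev i).+1.
have levL i : (lev i < L)%N by rewrite ltnS leq_bigmax.
pose lev' i := if A i then lev i else (L + i)%N.
pose pos' i := if A i then pos i else 0%N.
pose x i := if A i then (rho ^+ lev i)^-1 *: y i else 0.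
have := bnd n lev' pos' x; move=> H.
have {}H : avg (fun e => `|rsum e (fun i => rho ^+ lev' i *: x i)|) <= C.
  apply: H.
  - move=> i i'; rewrite /lev' /pos'; case: ifPn => Ai; case: ifPn => Ai' h1 h2.
    + exact: inj.
    + by have := levL i; rewrite h1; lia.
    + by have := levL i'; rewrite -h1; lia.
    + by apply: val_inj; move: h1 => /=; lia.
  - by move=> i; rewrite /pos' /lev'; case: ifPn => Ai; rewrite ?posl// expn_gt0.
  - move=> i; rewrite /x; case: ifPn => Ai; last by rewrite normr0.
    have r0 : 0 < rho ^+ lev i by rewrite exprn_gt0.
    by rewrite normrZ normfV (gtr0_norm r0) mulrC ler_pdivrMr// mul1r.
apply: le_trans H; apply: le_avg => e.
rewrite le_eqVlt; apply/orP; left; apply/eqP; congr `|_|.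
apply: eq_bigr => i _; congr (_ *: _); rewrite /x /lev'; case: ifPn => Ai.
  by rewrite scalerA divff ?scale1r// gt_eqF// exprn_gt0.
by rewrite scaler0.
Qed.

(* Members on the same level are dealt out to [B] subfamilies according to their rank. *)
Lemma rademacher_shells n (lev : 'I_n -> nat) (y : 'I_n -> E) (B : nat) :
  0 < rho -> rademacher_bounded -> (forall i, `|y i| <= rho ^+ lev i) ->
  (forall k, #|[pred i | lev i == k]| <= B * 4 ^ k)%N ->
  avg (fun e => `|rsum e y|) <= B%:R * C.
Proof.
move=> rho0 bnd yl cnt.
pose before i := [pred j : 'I_n | (lev j == lev i) && (j < i)%N].
pose rank i := #|before i|.
have p4 k : (0 < 4 ^ k)%N by rewrite expn_gt0.
have rankB i : (rank i < B * 4 ^ lev i)%N.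
  apply: leq_trans (cnt (lev i)); apply: proper_card; apply/fintype.properP; split.
    by apply/fintype.subsetP => j; rewrite !inE => /andP[].
  by exists i; rewrite !inE ?eqxx// ltnn.
have rank_inj i i' : lev i = lev i' -> rank i = rank i' -> i = i'.
  wlog : i i' / (i < i')%N => [H ll rr|ii' ll rr].
    have [ii'|ii'|/val_inj//] := ltngtP i i'; first exact: H.
    by apply/esym; apply: H.
  suff : (rank i < rank i')%N by rewrite rr ltnn.
  apply: proper_card; apply/fintype.properP; split.
    apply/fintype.subsetP => j; rewrite !inE ll => /andP[-> /= ji]; exact: ltn_trans ii'.
  by exists i; rewrite !inE ll eqxx ?ltnn.
pose grp i := (rank i %/ 4 ^ lev i)%N.
pose pos i := (rank i %% 4 ^ lev i)%N.
have grpB i : (grp i < B)%N by rewrite ltn_divLR.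
have split_sum e : rsum e y = \sum_(g < B) rsum e (fun i => if grp i == g then y i else 0).
  rewrite /rsum exchange_big /=; apply: eq_bigr => i _.
  rewrite -scaler_sumr (bigD1 (Ordinal (grpB i)))//= eqxx big1 ?addr0// => g ng.
  by case: eqP => // gi; case/eqP: ng; apply: val_inj.
apply: (@le_trans _ _ (\sum_(g < B) avg (fun e =>
    `|rsum e (fun i => if grp i == g then y i else 0)|))).
  rewrite -avg_sum; apply: le_avg => e; rewrite split_sum; exact: ler_norm_sum.
apply: (@le_trans _ _ (\sum_(g < B) C)); last by rewrite sumr_const card_ord mulr_natl.
apply: ler_sum => g _; apply: (@rademacher_sub _ _ lev pos) => //; last first.
  by move=> i; rewrite ltn_mod.
move=> i i' /eqP gi /eqP gi' ll pp; apply: rank_inj => //.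
by rewrite (divn_eq (rank i) (4 ^ lev i)) -/(grp i) -/(pos i) gi pp -gi' /grp /pos ll -divn_eq.
Qed.

End Shells.

(** * Mean norm of sums of finitely valued variables *)

Section FiniteTheorem.
Variables (R : realType) (E : normedModType R) (rho C : R).

Lemma half_geo_sum L : \sum_(k < L) (2^-1 : R) ^+ k <= 2.
Proof.
have := @geo_sum_le R 2^-1 L; rewrite (_ : (1 - 2^-1)^-1 = 2); last by field.
by apply; lra.
Qed.

(** The means contribute [K]. The centred part is symmetrised at the cost of a factor 2; for fixed
    values [rademacher_shells] bounds its sign average by C times the overload [B f], whose mean is
    at most 2 (K + 1). *)
Lemma expect_bound n (V : finType) (q : 'I_n -> V -> R) (c : V -> R) (s : 'I_n -> R)
    (u : 'I_n -> E) (K : R) :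
  0 < rho -> rho <= 1 -> 0 <= C -> rademacher_bounded E rho C ->
  (forall i v, 0 <= q i v) -> (forall i, \sum_v q i v = 1) ->
  (forall v, `|c v| <= 1) -> (forall i, `|u i| <= 1) ->
  0 <= K -> (forall i, 0 <= s i) -> \sum_i s i <= 1 ->
  \sum_i `|\sum_v q i v * c v| <= K ->
  (forall i k, \sum_(v | rho ^+ k.+1 < `|c v|) q i v <= K * s i * 4 ^+ k) ->
  expect q (fun f => `|\sum_i c (f i) *: u i|) <= K + 4 * C * (K + 1).
Proof.
move=> rho0 rho1 C0 bnd q0 q1 c1 u1 K0 s0 s1 meanK tailK.
(* Level [L] takes all smaller values; it never overflows, because 4^n >= n. *)
pose L := n.
have nL : (n <= 4 ^ L)%N by apply: ltnW; apply: ltn_expl.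
(* A failed search returns [L]. In every case the modulus of [c v] is at most rho^(lev v), and for
   levels below [L] it exceeds rho^(lev v + 1). *)
pose lev v := find (fun k => rho ^+ k.+1 < `|c v|) (iota 0 L).
have lev_le v : `|c v| <= rho ^+ lev v.
  case E0 : (lev v) => [|k]; first by rewrite expr0.
  have kL : (k < L)%N.
    have := find_size (fun k => rho ^+ k.+1 < `|c v|) (iota 0 L).
    by rewrite size_iota -/(lev v) E0.
  have := @before_find _ 0%N (fun k => rho ^+ k.+1 < `|c v|) (iota 0 L) k.
  by rewrite -/(lev v) E0 ltnSn nth_iota// add0n => /(_ isT)/negbT; rewrite -leNgt.
have lev_gt v k : (k < L)%N -> lev v == k -> rho ^+ k.+1 < `|c v|.
  move=> kL /eqP vk.
  have hs : has (fun k => rho ^+ k.+1 < `|c v|) (iota 0 L).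
    by rewrite has_find size_iota -/(lev v) vk.
  by have := nth_find 0%N hs; rewrite -/(lev v) vk nth_iota.
have levL v : (lev v <= L)%N.
  by have := find_size (fun k => rho ^+ k.+1 < `|c v|) (iota 0 L); rewrite size_iota.
pose cnt k (f : {ffun 'I_n -> V}) := #|[pred i | lev (f i) == k]|.
pose B f := (\max_(k < L) (cnt k f %/ 4 ^ k)).+1.
have p4 k : (0 < 4 ^ k)%N by rewrite expn_gt0.
have step (f : {ffun 'I_n -> V}) :
    avg (fun e => `|rsum e (fun i => c (f i) *: u i)|) <= (B f)%:R * C.
  apply: (rademacher_shells (lev := fun i => lev (f i)) rho0 bnd).
    move=> i; rewrite normrZ; apply: le_trans (lev_le _).
    by rewrite ler_piMr.
  move=> k; rewrite -/(cnt k f).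
  have [kL|kL] := ltnP k L.
    apply: ltnW; apply: leq_trans (ltn_ceil _ (p4 k)) _.
    rewrite leq_mul2r ltnS; apply/orP; right.
    exact: (leq_bigmax (Ordinal kL)).
  apply: (@leq_trans (4 ^ k)); last by rewrite leq_pmull.
  apply: leq_trans (max_card _) _; rewrite card_ord.
  by apply: leq_trans nL _; rewrite leq_exp2l.
pose mu k := \sum_i \sum_(v | lev v == k) q i v.
have mu0 k : 0 <= mu k by apply: sumr_ge0 => i _; apply: sumr_ge0.
have muK k : (k < L)%N -> mu k <= K * 4 ^+ k.
  move=> kL; apply: (@le_trans _ _ (\sum_i K * s i * 4 ^+ k)).
    apply: ler_sum => i _; apply: le_trans (tailK i k).
    rewrite [leRHS]big_mkcond [leLHS]big_mkcond; apply: ler_sum => v _.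
    case: ifPn => lk; last by case: ifP.
    by rewrite (lev_gt v k kL lk).
  rewrite -mulr_suml -mulr_sumr ler_wpM2r ?exprn_ge0//.
  by rewrite ler_piMr.
have cntE k (f : {ffun 'I_n -> V}) : (cnt k f)%:R = \sum_i (lev (f i) == k)%:R :> R.
  by rewrite /cnt -sum1_card natr_sum big_mkcond/=; apply: eq_bigr => i _; rewrite inE; case: eqP.
pose dev k (f : {ffun 'I_n -> V}) := ((cnt k f)%:R - mu k) ^+ 2.
have dev0 k f : 0 <= dev k f by exact: sqr_ge0.
have Edev k : (k < L)%N -> expect q (dev k) <= K * 4 ^+ k.
  move=> kL; apply: le_trans (muK k kL); rewrite /mu.
  have := variance_count_le q0 q1 (fun v => lev v == k).
  by apply: le_trans; apply: (le_expect q0) => f; rewrite /dev cntE.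
(* AM-GM [|x| / 4 ^ k <= (x ^ 2 / 8 ^ k + 2 ^- k) / 2] for the deviations of the counts from
   their means, so that only second moments are needed and the levels can be summed. *)
pose bd (f : {ffun 'I_n -> V}) : R :=
  1 + K + \sum_(k < L) (2^-1 * ((8^-1) ^+ k * dev k f + (2^-1) ^+ k)).
have term0 k f : 0 <= 2^-1 * ((8^-1) ^+ k * dev k f + (2^-1) ^+ k).
  by rewrite mulr_ge0// addr_ge0 ?exprn_ge0// mulr_ge0// exprn_ge0.
have Bbd (f : {ffun 'I_n -> V}) : (B f)%:R <= bd f.
  rewrite /B -natr1 addrC /bd -addrA lerD2l.
  apply: (big_ind (fun m : nat => m%:R <=
    K + \sum_(k < L) (2^-1 * ((8^-1) ^+ k * dev k f + (2^-1) ^+ k)))).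
  - by rewrite addr_ge0// sumr_ge0.
  - by move=> m1 m2 h1 h2; rewrite /maxn; case: ifP.
  - move=> k _; apply: (@le_trans _ _ ((cnt k f)%:R / 4 ^+ k)).
      by rewrite ler_pdivlMr ?exprn_gt0// -natrX -natrM ler_nat leq_divM.
    have a1 : mu k / 4 ^+ k <= K by rewrite ler_pdivrMr ?exprn_gt0//; exact: muK.
    rewrite (bigD1 k)//= -[X in X / _](subrK (mu k)) mulrDl [X in X <= _]addrC; apply: lerD => //.
    apply: (@le_trans _ _ (2^-1 * (8^-1 ^+ k * dev k f + 2^-1 ^+ k))); last first.
      by rewrite lerDl sumr_ge0.
    rewrite /dev; set x := (_ - _ : R).
    have -> : (4 ^+ k)^-1 = (2^-1 ^+ k) ^+ 2 :> R.
      by rewrite -exprM mulnC exprM -exprVn; congr (_ ^+ _); field.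
    have -> : 8^-1 ^+ k = (2^-1 ^+ k) ^+ 3 :> R.
      by rewrite -exprM mulnC exprM; congr (_ ^+ _); field.
    have : 0 <= (2^-1 : R) ^+ k by rewrite exprn_ge0.
    move: (2^-1 ^+ k) => h h0; have := mulr_ge0 h0 (sqr_ge0 (h * x - 1)); lra.
(* The variance on level k is at most K 4^k, so with the weight 8^(-k) it becomes K 2^(-k) and can
   be summed over the levels. *)
have Ebd : expect q bd <= 2 * (K + 1).
  rewrite /bd expectD (expect_cst q1) expect_sum.
  apply: (@le_trans _ _ (1 + K + \sum_(k < L) 2^-1 * (K + 1) * 2^-1 ^+ k)); last first.
    rewrite -mulr_sumr; have := half_geo_sum L => g.
    have := ler_wpM2l (addr_ge0 K0 ler01) g; lra.
  rewrite lerD2l; apply: ler_sum => k _.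
  rewrite expectZ expectD (expect_cst q1) expectZ.
  have e8 : 0 <= 8^-1 :> R by [].
  have := ler_wpM2l (exprn_ge0 k e8) (Edev k (ltn_ord k)).
  have -> : 8^-1 ^+ k * (K * 4 ^+ k) = K * 2^-1 ^+ k :> R.
    by rewrite mulrCA -exprMn; congr (_ * _ ^+ _); field.
  by lra.
have mid : expect q (fun f => `|\sum_i (c (f i) - \sum_v q i v * c v) *: u i|) <=
    2 * (2 * (K + 1) * C).
  apply: le_trans (symmetrization q0 q1 (@seminorm_norm R E) c u) _.
  rewrite ler_wpM2l//; apply: (@le_trans _ _ (expect q (fun f => C * bd f))).
    apply: (le_expect q0) => f; apply: le_trans (step f) _.
    by rewrite mulrC ler_wpM2l.
  by rewrite expectZ mulrC ler_wpM2r.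
rewrite (_ : K + _ = K + 2 * (2 * (K + 1) * C)); last by ring.
apply: (@le_trans _ _ (expect q (fun f => K + `|\sum_i (c (f i) - \sum_v q i v * c v) *: u i|))).
  apply: (le_expect q0) => f.
  have -> : \sum_i c (f i) *: u i = \sum_i (\sum_v q i v * c v) *: u i +
      \sum_i (c (f i) - \sum_v q i v * c v) *: u i.
    by rewrite -big_split/=; apply: eq_bigr => i _; rewrite -scalerDl addrC subrK.
  apply: le_trans (ler_normD _ _) _; rewrite lerD2r; apply: le_trans meanK.
  apply: le_trans (ler_norm_sum _ _ _) _; apply: ler_sum => i _.
  by rewrite normrZ ler_piMr.
by rewrite expectD (expect_cst q1) lerD2l.
Qed.

End FiniteTheorem.

(** * Truncated stable variables *)

Section Trig.
Variable R : realType.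
Implicit Types x u b : R.

Lemma ge0_of_derive (f df : R -> R) b : f 0 = 0 -> (forall x, is_derive x 1 f (df x)) ->
  (forall x, 0 <= x -> x <= b -> 0 <= df x) -> forall x, 0 <= x -> x <= b -> 0 <= f x.
Proof.
move=> f0 fd df0 x; rewrite le_eqVlt => /predU1P[<- _|x0 xb]; first by rewrite f0.
have [|c] := MVT x0 (fun y _ => fd y).
  apply: continuous_subspaceT => y; apply/differentiable_continuous/derivable1_diffP.
  by case: (fd y).
rewrite in_itv/= => /andP[c0 cx]; rewrite f0 !subr0 => ->.
by rewrite mulr_ge0// ?(ltW x0)//; apply: df0; [exact: ltW|lra].
Qed.

Lemma sin_le x : 0 <= x -> sin x <= x.
Proof.
move=> x0; rewrite -subr_ge0.
apply: (@ge0_of_derive (fun y => y - sin y) (fun y => 1 - cos y) x) => //.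
- by rewrite sin0 subr0.
Qed.

Lemma cos_ge x : 0 <= x -> 1 - x ^+ 2 / 2 <= cos x.
Proof.
move=> x0; rewrite -subr_ge0.
apply: (@ge0_of_derive (fun y => cos y - (1 - y ^+ 2 / 2)) (fun y => - sin y + y) x) => //.
- by rewrite cos0 expr0n mul0r subr0 subrr.
- by move=> y; apply: is_derive_eq; rewrite /GRing.scale/=; field.
- by move=> y y0 _; rewrite addrC subr_ge0; exact: sin_le.
Qed.

Lemma sin_ge x : 0 <= x -> x - x ^+ 3 / 6 <= sin x.
Proof.
move=> x0; rewrite -subr_ge0.
apply: (@ge0_of_derive (fun y => sin y - (y - y ^+ 3 / 6))
  (fun y => cos y - (1 - y ^+ 2 / 2)) x) => //.
- by rewrite sin0 expr0n mul0r !subr0.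
- by move=> y; apply: is_derive_eq; rewrite /GRing.scale/=; field.
- by move=> y y0 _; rewrite subr_ge0 cos_ge.
Qed.

(** The derivative of the difference is at least y (4 - y^2) / 6 by [sin_ge]. Validity up to 2 is
    what dyadic rescaling in [large_part_dyadic] requires. *)
Lemma one_sub_cos_ge u : `|u| <= 2 -> u ^+ 2 / 6 <= 1 - cos u.
Proof.
wlog u0 : u / 0 <= u => [H|].
  have [/H//|/ltW u0] := leP 0 u; move=> hu.
  by rewrite -cosN -sqrrN; apply: H; rewrite ?normrN// oppr_ge0.
rewrite ger0_norm// => u2; rewrite -subr_ge0.
apply: (@ge0_of_derive (fun y => 1 - cos y - y ^+ 2 / 6) (fun y => sin y - y / 3) 2) => //.
- by rewrite cos0 expr0n mul0r subr0 subrr.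
- by move=> y; apply: is_derive_eq; rewrite /GRing.scale/=; field.
- move=> y y0 y2; have := sin_ge y0.
  have : 0 <= y * (4 - y ^+ 2) by rewrite mulr_ge0//; nra.
  rewrite exprS; lra.
Qed.

Lemma sin_sub_le u : `|u| <= 1 -> `|u - sin u| <= u ^+ 2.
Proof.
wlog u0 : u / 0 <= u => [H|].
  have [/H//|/ltW u0] := leP 0 u; move=> hu.
  have -> : u - sin u = - (- u - sin (- u)) by rewrite sinN; ring.
  by rewrite normrN -sqrrN; apply: H; rewrite ?normrN// oppr_ge0.
rewrite ger0_norm// => u1; rewrite ger0_norm ?subr_ge0 ?sin_le//.
have := sin_ge u0; have : 0 <= u ^+ 2 * (1 - u) by rewrite mulr_ge0 ?sqr_ge0// subr_ge0.
by rewrite exprS; have := sqr_ge0 u; lra.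
Qed.

Definition small_part u : R := if `|u| <= 1 then u else 0.
(* Square roots keep the moment of the large part finite even for [p = 1]. *)
Definition large_part u : R := if `|u| <= 1 then 0 else Num.sqrt `|u|.

Lemma small_part_sqr_le u : small_part u ^+ 2 <= 6 * (1 - cos u).
Proof.
rewrite /small_part; case: ifPn => u1.
  have u2 : `|u| <= 2 by lra.
  by have := one_sub_cos_ge u2; lra.
by rewrite expr0n/=; have := cos_le1 u; lra.
Qed.

(** Compares the truncation with a function whose mean vanishes for stable variables; the error
    consists of the two quantities with known moments. *)
Lemma small_part_sin u : `|small_part u - sin u| <= small_part u ^+ 2 + large_part u.
Proof.
rewrite /small_part /large_part; case: ifPn => u1; first by rewrite addr0 sin_sub_le.
rewrite sub0r normrN expr0n add0r; apply: le_trans (sin_max u) _.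
by rewrite -[leLHS]sqrtr1 ler_wsqrtr// ltW// ltNge.
Qed.

Lemma large_part_ge0 u : 0 <= large_part u.
Proof. by rewrite /large_part; case: ifP. Qed.

(* A pointwise bound by the quantities [1 - cos], whose means are known from the
   characteristic function. *)
Lemma large_part_dyadic u : exists j : nat,
  large_part u <= 12 * Num.sqrt 2 ^+ j * (1 - cos (u / 2 ^+ j)).
Proof.
rewrite /large_part; case: ifPn => [_|].
  by exists 0%N; rewrite mulr_ge0// ?subr_ge0 ?cos_le1// mulr_ge0// exprn_ge0.
rewrite -ltNge => u1.
have ex : exists j, `|u| <= 2 ^+ j.+1.
  exists (Num.truncn `|u|); apply: ltW; apply: lt_le_trans (truncnS_gt _) _.
  by rewrite -natrX ler_nat; apply: ltnW; apply: ltn_expl.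
pose j := ex_minn ex; exists j.
have [j1 j2] : `|u| <= 2 ^+ j.+1 /\ 2 ^+ j < `|u|.
  rewrite /j; case: ex_minnP => m m1 m2; split => //.
  case: m m1 m2 => [|m] m1 m2; first by rewrite expr0.
  by rewrite ltNge; apply/negP => /m2; rewrite ltnn.
have p2 : 0 < 2 ^+ j :> R by rewrite exprn_gt0.
(* The rescaled argument has modulus in ]1,2]. Since the square root of the modulus of [u] is at
   most 2 sqrt(2)^j, the factor 12 = 2 * 6 results. *)
have c1 : 6^-1 <= 1 - cos (u / 2 ^+ j).
  have d0 : `|u / 2 ^+ j| <= 2.
    by rewrite normrM normfV (gtr0_norm p2) ler_pdivrMr// -exprS.
  have d1 : 1 < `|u / 2 ^+ j|.
    by rewrite normrM normfV (gtr0_norm p2) ltr_pdivlMr// mul1r.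
  apply: le_trans (one_sub_cos_ge d0); rewrite -real_normK ?num_real//.
  by nra.
have s2 : Num.sqrt 2 <= 2 :> R.
  by rewrite -[leRHS](@ger0_norm R 2)// -sqrtr_sqr ler_wsqrtr// expr2; lra.
have sj : 0 <= Num.sqrt 2 ^+ j :> R by rewrite exprn_ge0.
apply: (@le_trans _ _ (2 * Num.sqrt 2 ^+ j)).
  apply: (@le_trans _ _ (Num.sqrt 2 ^+ j.+1)); last by rewrite exprS ler_wpM2r.
  have sX k : Num.sqrt 2 ^+ k = Num.sqrt (2 ^+ k) :> R.
    elim: k => [|k IH]; first by rewrite !expr0 sqrtr1.
    by rewrite !exprS sqrtrM// IH.
  by rewrite sX ler_wsqrtr.
have := ler_wpM2l sj c1; lra.
Qed.

End Trig.

(** * Moments of truncated stable variables *)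

Section StableMoments.
Context d (T : measurableType d) (R : realType) (P : probability T R) (p : R).
Hypotheses (p1 : 1 <= p).
Variable X : T -> R.
Hypothesis mX : measurable_fun setT X.
Hypothesis chX : forall xi : R,
     (\int[P]_w (cos (xi * X w))%:E)%E = (expR (- (`|xi| `^ p)))%:E /\
     (\int[P]_w (sin (xi * X w))%:E)%E = 0%E.

Lemma measurable_scaled (b : R) : measurable_fun setT (fun w => b * X w).
Proof. exact: measurable_funM. Qed.

Lemma bounded_integrable (f : T -> R) (c : R) : measurable_fun setT f ->
  (forall w, `|f w| <= c) -> P.-integrable setT (EFin \o f).
Proof.
move=> mf fc; apply: (@le_integrable _ _ _ P _ measurableT _ (EFin \o cst c)).
- exact/measurable_EFinP.
- by move=> w _; rewrite /= lee_fin (le_trans (fc w))// ler_norm.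
- exact: finite_measure_integrable_cst.
Qed.

Lemma measurable_cos_scaled b : measurable_fun setT (fun w => cos (b * X w)).
Proof.
apply: (measurableT_comp (f := cos)); last exact: measurable_scaled.
by apply: continuous_measurable_fun; exact: continuous_cos.
Qed.

Lemma measurable_sin_scaled b : measurable_fun setT (fun w => sin (b * X w)).
Proof.
apply: (measurableT_comp (f := sin)); last exact: measurable_scaled.
by apply: continuous_measurable_fun; exact: continuous_sin.
Qed.

Lemma integral_one_sub_cos b : 0 <= b ->
  (\int[P]_w (1 - cos (b * X w))%:E <= (b `^ p)%:E)%E.
Proof.
move=> b0.
have hc : has_integral P setT (fun w => cos (b * X w)) (expR (- (b `^ p))).
  split; last by rewrite (chX b).1 ger0_norm.
  by apply: (@bounded_integrable _ 1); [exact: measurable_cos_scaled|move=> w; exact: cos_max].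
have h1 : has_integral P setT (fun=> 1) 1.
  split; first exact: finite_measure_integrable_cst.
  by rewrite integral_cst//= probability_setT mule1.
have [_] := has_integralD measurableT h1 (has_integralZ measurableT (-1) hc).
under eq_integral do rewrite mulN1r.
move=> ->; rewrite lee_fin mulN1r.
by have := expR_ge1Dx (- (b `^ p)); lra.
Qed.

Lemma small_part_moment2 b : 0 <= b ->
  (\int[P]_w (small_part (b * X w) ^+ 2)%:E <= (6 * b `^ p)%:E)%E.
Proof.
move=> b0.
have := @integral_le_comb _ T R P setT 'I_1 (fun=> 6) (fun=> b `^ p)
  (fun _ w => 1 - cos (b * X w)) (fun w => small_part (b * X w) ^+ 2) measurableT.
rewrite big_ord1; apply => //.
- by move=> i; apply: measurable_funB => //; exact: measurable_cos_scaled.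
- by move=> i; exact: integral_one_sub_cos.
- by move=> w _; rewrite big_ord1 sqr_ge0 small_part_sqr_le.
Qed.

Definition large_const : R := 12 * (1 - Num.sqrt 2 / 2)^-1.

Lemma sqrt2_half : 0 <= Num.sqrt (2 : R) / 2 < 1.
Proof.
rewrite divr_ge0//= ltr_pdivrMr// mul1r.
by rewrite -[ltRHS](@ger0_norm R 2)// -sqrtr_sqr ltr_sqrt// expr2; lra.
Qed.

Lemma large_const_ge0 : 0 <= large_const.
Proof. by have /andP[h1 h2] := sqrt2_half; rewrite mulr_ge0// invr_ge0 subr_ge0 ltW. Qed.

(** Sum the dyadic bounds over all j: the mean of 1 - cos at scale j is at most (b / 2^j)^p <= b^p
    2^(-j) because p >= 1, and against the weight sqrt(2)^j this is a geometric series of ratio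
    sqrt(2)/2. *)
Lemma large_part_moment b : 0 <= b ->
  (\int[P]_w (large_part (b * X w))%:E <= (large_const * b `^ p)%:E)%E.
Proof.
move=> b0.
pose g (j : nat) w : R := 12 * Num.sqrt 2 ^+ j * (1 - cos (b * X w / 2 ^+ j)).
have g0 j w : 0 <= g j w.
  by rewrite mulr_ge0// ?subr_ge0 ?cos_le1// mulr_ge0// exprn_ge0.
have gE j w : g j w = 12 * Num.sqrt 2 ^+ j * (1 - cos ((b / 2 ^+ j) * X w)).
  by rewrite /g; congr (_ * (1 - cos _)); rewrite mulrAC.
have mg j : measurable_fun setT (g j).
  rewrite (_ : g j = fun w => 12 * Num.sqrt 2 ^+ j * (1 - cos ((b / 2 ^+ j) * X w))).
    by apply: measurable_funM => //; apply: measurable_funB => //; exact: measurable_cos_scaled.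
  by apply/funext => w; exact: gE.
have /andP[h1 h2] := sqrt2_half.
have ig j : (\int[P]_w (g j w)%:E <= (12 * b `^ p * (Num.sqrt 2 / 2) ^+ j)%:E)%E.
  have b2 : 0 <= b / 2 ^+ j by rewrite divr_ge0// exprn_ge0.
  under eq_integral do rewrite gE EFinM.
  rewrite ge0_integralZl//; last first.
  - apply/measurable_EFinP; apply: measurable_funB => //; exact: measurable_cos_scaled.
  apply: (@le_trans _ _ ((12 * Num.sqrt 2 ^+ j)%:E * ((b / 2 ^+ j) `^ p)%:E)%E).
    by rewrite lee_wpmul2l// ?integral_one_sub_cos// lee_fin mulr_ge0// exprn_ge0.
  rewrite -EFinM lee_fin powRM ?invr_ge0 ?exprn_ge0//.
  have : (2 ^+ j)^-1 `^ p <= (2 ^+ j)^-1 :> R.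
    apply: ge1r_powR => //; rewrite invr_gt0 exprn_gt0//= invf_le1 ?exprn_gt0//.
    by rewrite exprn_ege1// ler1n.
  move=> h; rewrite exprMn exprVn.
  have c0 : 0 <= 12 * Num.sqrt 2 ^+ j * b `^ p by rewrite !mulr_ge0 ?exprn_ge0 ?powR_ge0.
  by have := ler_wpM2l c0 h; lra.
apply: (@le_trans _ _ (\int[P]_w (\sum_(0 <= j <oo) (g j w)%:E))%E).
  apply: le_integral_ge0 => w _; first by rewrite lee_fin large_part_ge0.
  have [j hj] := large_part_dyadic (b * X w).
  apply: (@le_trans _ _ (g j w)%:E); first by rewrite lee_fin.
  have nn n : (0 <= n)%N -> true -> (0 <= (g n w)%:E)%E by rewrite lee_fin.
  apply: le_trans (nneseries_lim_ge j.+1 nn).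
  rewrite big_nat_recr//=.
  by rewrite leeDr// sume_ge0// => i _; rewrite lee_fin.
rewrite integral_nneseries//; last 2 first.
- by move=> j; apply/measurable_EFinP.
- by move=> j w _; rewrite lee_fin.
apply: lime_le.
  by apply: is_cvg_nneseries => j _ _; apply: integral_ge0 => w _; rewrite lee_fin.
apply: nearW => m.
apply: (@le_trans _ _ (\sum_(0 <= j < m) (12 * b `^ p * (Num.sqrt 2 / 2) ^+ j)%:E)%E).
  by apply: lee_sum.
rewrite sumEFin lee_fin -mulr_sumr big_mkord /large_const.
rewrite [leRHS]mulrAC ler_wpM2l ?mulr_ge0 ?powR_ge0//.
exact: geo_sum_le.
Qed.

Lemma measurable_small_part b : measurable_fun setT (fun w => small_part (b * X w)).
Proof.
apply: measurable_fun_ifT => //; last exact: measurable_scaled.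
apply: measurable_fun_ler => //; apply: measurableT_comp => //; exact: measurable_scaled.
Qed.

Lemma measurable_large_part b : measurable_fun setT (fun w => large_part (b * X w)).
Proof.
apply: measurable_fun_ifT => //.
  apply: measurable_fun_ler => //; apply: measurableT_comp => //; exact: measurable_scaled.
apply: (measurableT_comp (f := @Num.sqrt R)).
  by apply: continuous_measurable_fun; exact: sqrt_continuous.
by apply: measurableT_comp => //; exact: measurable_scaled.
Qed.

Lemma small_part_le1 u : `|small_part u| <= 1 :> R.
Proof. by rewrite /small_part; case: ifP => // _; rewrite normr0. Qed.

Lemma small_part_mean b : 0 <= b -> exists m : R,
  has_integral P setT (fun w => small_part (b * X w)) m /\
  `|m| <= (6 + large_const) * b `^ p.
Proof.
move=> b0.
have intS : P.-integrable setT (EFin \o (fun w => small_part (b * X w))).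
  apply: (@bounded_integrable _ 1); [exact: measurable_small_part|move=> w; exact: small_part_le1].
have hs : has_integral P setT (fun w => small_part (b * X w))
    (fine (\int[P]_w (small_part (b * X w))%:E)%E).
  by split => //; rewrite fineK//; exact: integrable_fin_num.
exists (fine (\int[P]_w (small_part (b * X w))%:E)%E); split => //.
move: hs; set m := fine _ => hs.
have hsin : has_integral P setT (fun w => sin (b * X w)) 0.
  split; last exact: (chX b).2.
  by apply: (@bounded_integrable _ 1); [exact: measurable_sin_scaled|move=> w; exact: sin_max].
have [iD eD] := has_integralD measurableT hs (has_integralZ measurableT (-1) hsin).
rewrite mulr0 addr0 in eD.
rewrite -lee_fin -[`|m|%:E]/(`|m%:E|)%E -eD.
apply: le_trans (le_abse_integral P measurableT _) _; first by case/integrableP: iD.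
have -> : (6 + large_const) * b `^ p = 1 * (6 * b `^ p) + 1 * (large_const * b `^ p) by ring.
apply: (integral_le_comb2 (f := fun w => `|small_part (b * X w) + -1 * sin (b * X w)|)
  _ _ _ _ _ _ _ (small_part_moment2 b0) (large_part_moment b0)) => //.
- by move=> w _; exact: sqr_ge0.
- by move=> w _; exact: large_part_ge0.
- by apply: measurable_funX; exact: measurable_small_part.
- exact: measurable_large_part.
- by move=> w _; rewrite normr_ge0 !mul1r mulN1r small_part_sin.
Qed.

End StableMoments.

Section FiniteValued.
Context d (T : measurableType d) (R : realType) (P : probability T R).

Lemma has_integral_indic (A : set T) : measurable A -> has_integral P setT \1_A (fine (P A)).
Proof.
move=> mA; split; first exact: integrable_indic.
by rewrite integral_indic// setIT fineK// fin_num_measure.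
Qed.

Lemma has_integral_finite_valued (V : finType) (v : T -> V) (F : V -> R) :
  (forall x, measurable (v @^-1` [set x])) ->
  has_integral P setT (fun w => F (v w)) (\sum_x F x * fine (P (v @^-1` [set x]))).
Proof.
move=> mv; have -> : (fun w => F (v w)) = (fun w => \sum_x F x * \1_(v @^-1` [set x]) w).
  apply/funext => w; rewrite (bigD1 (v w))//= indicE mem_set// mulr1 big1 ?addr0// => x.
  by move=> /eqP xv; rewrite indicE memNset ?mulr0// => /= vx; apply: xv.
apply: has_integral_sum => // x _.
by apply: has_integralZ => //; exact: has_integral_indic.
Qed.

Lemma has_integral_abs_le (f : T -> R) (m c : R) : has_integral P setT f m ->
  (forall w, `|f w| <= c) -> `|m| <= c.
Proof.
move=> [fi fm] fc; rewrite -lee_fin -[`|m|%:E]/(`|m%:E|)%E -fm.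
have mf : measurable_fun setT (fun w => (f w)%:E) by case/integrableP: fi.
apply: le_trans (le_abse_integral P measurableT mf) _.
apply: (@le_trans _ _ (\int[P]_w (cst c%:E w))%E); last first.
  by rewrite integral_cst//= probability_setT mule1.
by apply: le_integral_ge0 => w _; rewrite ?lee_fin//; exact: normr_ge0.
Qed.

End FiniteValued.

(** * Sums of stable variables *)

Section Quantization.
Variable R : realType.
Implicit Types (u b t : R) (m : nat).

(* [qval (qcode m u)] is [u] rounded towards 0 to a multiple of [1 / m]. *)
Definition qcode m u : bool * 'I_m.+1 := (u < 0, inord (Num.truncn (m%:R * `|u|))).
Definition qval m (v : bool * 'I_m.+1) : R := (-1) ^+ v.1 * (v.2%:R / m%:R).
Definition qclass m b t := qcode m (small_part (b * t)).

Lemma qval_le1 m (v : bool * 'I_m.+1) : `|qval v| <= 1.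
Proof.
rewrite /qval normrM normr_sign mul1r ger0_norm ?divr_ge0//.
have [m0|m0] := posnP m.
  by rewrite (_ : m%:R = 0) ?m0// invr0 mulr0 ler01.
by rewrite ler_pdivrMr ?ltr0n// mul1r ler_nat -ltnS.
Qed.

Lemma qcode_trunc m u : `|u| <= 1 -> (qcode m u).2 = Num.truncn (m%:R * `|u|) :> nat.
Proof.
move=> u1; rewrite /qcode/= inordK// ltnS -(ler_nat R).
apply: (@le_trans _ _ (m%:R * `|u|)); last by rewrite ler_piMr.
by have /andP[] := truncn_itv (mulr_ge0 (ler0n R m) (normr_ge0 u)).
Qed.

Lemma qval_le m u : `|u| <= 1 -> `|qval (qcode m u)| <= `|u|.
Proof.
move=> u1; rewrite /qval normrM normr_sign mul1r ger0_norm ?divr_ge0//.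
rewrite qcode_trunc//; have [m0|m0] := posnP m.
  by rewrite (_ : m%:R = 0) ?m0// invr0 mulr0.
rewrite ler_pdivrMr ?ltr0n// [leRHS]mulrC.
by have /andP[] := truncn_itv (mulr_ge0 (ler0n R m) (normr_ge0 u)).
Qed.

Lemma qval_err m u : (0 < m)%N -> `|u| <= 1 -> `|u - qval (qcode m u)| <= m%:R^-1.
Proof.
move=> m0 u1; have m0' : 0 < m%:R :> R by rewrite ltr0n.
have /andP[t1 t2] := truncn_itv (mulr_ge0 (ler0n R m) (normr_ge0 u)).
have -> : u - qval (qcode m u) = (-1) ^+ (u < 0)%R * (`|u| - (Num.truncn (m%:R * `|u|))%:R / m%:R).
  by rewrite /qval qcode_trunc// mulrBr -numEsign.
rewrite normrM normr_sign mul1r ger0_norm; last by rewrite subr_ge0 ler_pdivrMr// [leRHS]mulrC.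
rewrite lerBlDl -[X in _ + X]mul1r -mulrDl ler_pdivlMr// natr1 [leLHS]mulrC.
exact: ltW.
Qed.

Lemma measurable_qclass m b v : measurable (qclass m b @^-1` [set v]).
Proof.
pose S t : R := small_part (b * t).
have mS : measurable_fun setT S by exact: (@measurable_small_part _ _ _ id).
have mN : measurable_fun setT (fun t => m%:R * `|S t|).
  by apply: measurable_funM => //; exact: measurableT_comp.
have mneg : measurable [set t | S t < 0].
  have -> : [set t | S t < 0] = setT `&` S @^-1` `]-oo, 0[%classic.
    by rewrite setTI; apply/seteqP; split => t /=; rewrite in_itv.
  exact: mS.
pose k := v.2.
have mk : measurable [set t | k%:R <= m%:R * `|S t| < k.+1%:R].
  have -> : [set t | k%:R <= m%:R * `|S t| < k.+1%:R] =
      setT `&` (fun t => m%:R * `|S t|) @^-1` `[k%:R, k.+1%:R[%classic.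
    by rewrite setTI; apply/seteqP; split => t /=; rewrite in_itv.
  exact: mN.
have -> : qclass m b @^-1` [set v] =
    (if v.1 then [set t | S t < 0] else ~` [set t | S t < 0]) `&`
    [set t | k%:R <= m%:R * `|S t| < k.+1%:R].
  have tr t : (Num.truncn (m%:R * `|S t|) == k :> nat) = (k%:R <= m%:R * `|S t| < k.+1%:R).
    by rewrite truncn_eq// mulr_ge0.
  have S1 t : `|S t| <= 1 by exact: small_part_le1.
  apply/seteqP; split => t /=.
    move=> tv; split; last by rewrite -tr -(qcode_trunc m (S1 t)) -/(qclass m b t) tv.
    by rewrite -tv /qclass /=; case: ifPn => //; rewrite -/(S t) => h; apply/negP.
  move=> [h]; rewrite -tr -(qcode_trunc m (S1 t)) => /eqP h2.
  have e1 : (qclass m b t).1 = v.1.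
    by rewrite /= -/(S t); move: h; case: (v.1) => //= /negP/negbTE.
  have e2 : (qclass m b t).2 = v.2 by exact: val_inj.
  by rewrite [qclass m b t]surjective_pairing e1 e2 -surjective_pairing.
by apply: measurableI => //; case: (v.1) => //; exact: measurableC.
Qed.

End Quantization.

Section Auxiliary.
Variable R : realType.

Lemma large_part_ge1 (u : R) : 1 < `|u| -> 1 <= large_part u.
Proof.
move=> u1; rewrite /large_part (leNgt `|u| 1) u1/=.
by rewrite -[leLHS]sqrtr1 ler_wsqrtr// ltW.
Qed.

Lemma small_part_le (u : R) : `|small_part u| <= `|u|.
Proof. by rewrite /small_part; case: ifP => // _; rewrite normr0. Qed.

Lemma powR_expr (x p : R) k : 0 <= x -> (x ^+ k) `^ p = (x `^ p) ^+ k.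
Proof.
move=> x0; elim: k => [|k IH]; first by rewrite !expr0 powR1.
by rewrite !exprS powRM ?exprn_ge0// IH.
Qed.

Lemma sum_sqr_le n (L : 'I_n -> R) : (forall i, 0 <= L i) ->
  \sum_i L i ^+ 2 <= (\sum_i L i) ^+ 2.
Proof.
move=> L0; rewrite [leRHS]expr2 big_distrl; apply: ler_sum => i _ /=.
by rewrite expr2 ler_wpM2l// (bigD1 i)//= lerDl sumr_ge0.
Qed.

End Auxiliary.

Section StableSums.
Context (R : realType) (E : normedModType R) (rho C p : R).
Context d (T : measurableType d) (P : probability T R) (theta : nat -> T -> R).

(** The scalar [c] stays under the integral so that the homogeneous form comes out of pointwise
    domination, which accepts any nonnegative integrand. *)
Lemma stable_sum_bound : 0 < rho -> rho <= 1 -> 0 <= C -> rademacher_bounded E rho C ->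
  1 <= p -> rho `^ p = 4^-1 -> std_sym_stable_seq P p theta ->
  exists D : R, 0 <= D /\ forall n (c : R) (b : 'I_n -> R) (u : 'I_n -> E),
    0 <= c -> (forall i, 0 <= b i) -> \sum_i b i `^ p <= 1 -> (forall i, `|u i| <= 1) ->
    (\int[P]_w (c * Num.sqrt `|\sum_i (b i * theta i w) *: u i|)%:E <= (c * D)%:E)%E.
Proof.
move=> rho0 rho1 C0 bnd p1 rhop [indep chT].
pose lc := large_const R; have lc0 : 0 <= lc := large_const_ge0 R.
(* 4 lc comes from the tails, where rho^p = 1/4 turns the threshold rho^(k+1) into 4^(k+1); lc + 7
   is the bound 6 + lc on the means plus 1 for rounding. *)
pose K := 4 * lc + 7.
have K0 : 0 <= K by rewrite /K; lra.
pose D := 1 + (K + 4 * C * (K + 1)) + lc.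
have mth i : measurable_fun setT (theta i).
  by have [/(_ (Ordinal (ltnSn i)))] := indep i.+1.
exists D; split.
  by rewrite /D !addr_ge0// mulr_ge0// ?addr_ge0// mulr_ge0.
(* Fine enough that n rounding errors of size 1/m add up to at most 1. *)
move=> n s b u s0 b0 bp u1; pose m := n.+1.
pose V := (bool * 'I_m.+1)%type.
pose cls (i : 'I_n) (w : T) : V := qclass m (b i) (theta i w).
have mcls i x : measurable (cls i @^-1` [set x]).
  have := mth i measurableT _ (measurable_qclass (b i) x).
  by rewrite setTI.
pose q (i : 'I_n) (x : V) : R := fine (P (cls i @^-1` [set x])).
have q0 i x : 0 <= q i x by rewrite fine_ge0.
have q1 i : \sum_x q i x = 1.
  have [_] := has_integral_finite_valued P (fun=> 1) (mcls i).
  rewrite integral_cst//= probability_setT mule1 => -[->].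
  by apply: eq_bigr => x _; rewrite mul1r.
pose S (i : 'I_n) w := small_part (b i * theta i w).
pose L (i : 'I_n) w := large_part (b i * theta i w).
have S1 i w : `|S i w| <= 1 by exact: small_part_le1.
have mL i : measurable_fun setT (L i) by exact: measurable_large_part.
have IL i c : 0 <= c -> (\int[P]_w (large_part (c * theta i w))%:E <= (lc * c `^ p)%:E)%E.
  by move=> c0; apply: (large_part_moment p1 (mth i) (chT i)).
have m0 : (0 < m)%N by [].
have meanK : \sum_i `|\sum_x q i x * qval R x| <= K.
  apply: (@le_trans _ _ (\sum_i ((6 + lc) * b i `^ p + m%:R^-1))).
    apply: ler_sum => i _.
    have [mu [hmu mule]] := small_part_mean p1 (mth i) (chT i) (b0 i).
    have hq := has_integral_finite_valued P (@qval R m) (mcls i).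
    have := has_integralD measurableT hq (has_integralZ measurableT (-1) hmu).
    set M := \sum_x _ => hd.
    have dle : `|M + -1 * mu| <= m%:R^-1.
      apply: (has_integral_abs_le hd) => w.
      by rewrite mulN1r distrC; exact: (qval_err m0 (S1 i w)).
    have -> : \sum_x q i x * qval R x = M by apply: eq_bigr => x _; rewrite mulrC.
    have : `|M| <= `|M + -1 * mu| + `|mu|.
      by rewrite -[X in `|X| <= _](subrK mu) mulN1r; exact: ler_normD.
    by rewrite -/lc in mule; lra.
  rewrite big_split/= -mulr_sumr sumr_const card_ord.
  have h1 : (6 + lc) * \sum_i b i `^ p <= 6 + lc by rewrite ler_piMr//; lra.
  have h2 : m%:R^-1 *+ n <= 1 :> R.
    by rewrite -[leLHS]mulr_natl ler_pdivrMr ?ltr0n// mul1r ler_nat.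
  by rewrite /K; lra.
(* Rounding towards 0 cannot create large values, so the event forces b theta past rho^(k+1) in
   modulus; after rescaling, [large_part] is then at least 1 and its mean bounds the probability. *)
have tailK i k : \sum_(x | rho ^+ k.+1 < `|qval R x|) q i x <= K * b i `^ p * 4 ^+ k.
  have rk0 : 0 < rho ^+ k.+1 by rewrite exprn_gt0.
  have c0 : 0 <= b i / rho ^+ k.+1 by rewrite divr_ge0// ltW.
  have [_ hq] := has_integral_finite_valued P
    (fun x => (rho ^+ k.+1 < `|qval R x|)%R%:R) (mcls i).
  rewrite -lee_fin; have -> : \sum_(x | rho ^+ k.+1 < `|qval R x|) q i x =
     \sum_x (rho ^+ k.+1 < `|qval R x|)%R%:R * fine (P (cls i @^-1` [set x])).
    rewrite big_mkcond; apply: eq_bigr => x _.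
    by case: ifP => _; rewrite ?mul1r ?mul0r.
  rewrite -hq; apply: (@le_trans _ _ (\int[P]_w (large_part (b i / rho ^+ k.+1 * theta i w))%:E)%E).
    apply: le_integral_ge0 => w _; first by rewrite lee_fin ler0n.
    rewrite lee_fin; have [h|_] := boolP (rho ^+ k.+1 < _); last exact: large_part_ge0.
    apply: large_part_ge1; rewrite mulrAC normrM normfV (gtr0_norm rk0).
    rewrite ltr_pdivlMr// mul1r; apply: lt_le_trans h _.
    by apply: le_trans (qval_le m (S1 i w)) _; exact: small_part_le.
  apply: le_trans (IL i _ c0) _; rewrite lee_fin.
  have -> : (b i / rho ^+ k.+1) `^ p = b i `^ p * 4 ^+ k.+1.
    rewrite powRM// ?invr_ge0 ?(ltW rk0)//; congr (_ * _).
    apply: (mulIf (x := (rho ^+ k.+1) `^ p)); first by rewrite gt_eqF// powR_gt0.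
    rewrite -powRM ?invr_ge0 ?(ltW rk0)// mulVf ?gt_eqF// powR1 powR_expr ?(ltW rho0)//.
    by rewrite rhop -exprMn divff// expr1n.
  have := mulr_ge0 (powR_ge0 (b i) p) (exprn_ge0 k (ler0n R 4)).
  by rewrite exprS /K; move: (4 ^+ k) (b i `^ p) => x y xy; lra.
have jointE (f : {ffun 'I_n -> V}) : (fun w => [ffun i => cls i w]) @^-1` [set f] =
    \bigcap_(i in [set: 'I_n]) (cls i @^-1` [set f i]).
  apply/seteqP; split => w /=; first by move=> wf i _; rewrite /= -wf ffunE.
  by move=> H; apply/ffunP => i; rewrite ffunE; exact: H.
have mjoint (f : {ffun 'I_n -> V}) :
    measurable ((fun w => [ffun i => cls i w]) @^-1` [set f]).
  rewrite jointE; apply: fin_bigcap_measurable => //; exact: finite_finset.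
have Pjoint (f : {ffun 'I_n -> V}) :
    fine (P ((fun w => [ffun i => cls i w]) @^-1` [set f])) = weight q f.
  have [_ /(_ (fun i => qclass m (b i) @^-1` [set f i])) ind] := indep n.
  rewrite jointE (_ : \bigcap_(i in _) _ =
    [set w | forall i : 'I_n, (qclass m (b i) @^-1` [set f i]) (theta i w)]); last first.
    by apply/seteqP; split=> [w H i|w H i _]; exact: H.
  rewrite ind; last by move=> i; exact: measurable_qclass.
  rewrite (eq_bigr (fun i => (q i (f i))%:E)); first by rewrite prodEFin.
  by move=> i _; rewrite fineK// fin_num_measure//; exact: mcls.
have [iA eA] := has_integral_finite_valued P
  (fun f : {ffun 'I_n -> V} => `|\sum_i qval R (f i) *: u i|) mjoint.
have eA' := expect_bound rho0 rho1 C0 bnd q0 q1 (@qval_le1 R m) u1 K0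
   (fun i => powR_ge0 (b i) p) bp meanK tailK.
pose A w := `|\sum_i qval R (cls i w) *: u i|.
have AE w : `|\sum_i qval R ([ffun i => cls i w] i) *: u i| = A w.
  by congr `|_|; apply: eq_bigr => i _; rewrite ffunE.
have {}eA : (\int[P]_w (A w)%:E <= (K + 4 * C * (K + 1))%:E)%E.
  rewrite -(eq_integral _ _ (fun w _ => congr1 EFin (AE w))) eA lee_fin.
  apply: le_trans eA'; rewrite le_eqVlt; apply/orP; left; apply/eqP.
  by apply: eq_bigr => f _; rewrite Pjoint mulrC.
have mA : measurable_fun setT A.
  have -> : A = (fun w => `|\sum_i qval R ([ffun i => cls i w] i) *: u i|).
    by apply/funext => w; rewrite AE.
  by apply/measurable_EFinP; case/integrableP: iA.
have A0 w : 0 <= A w by exact: normr_ge0.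
have L0 i w : 0 <= L i w by exact: large_part_ge0.
have IsumL : (\int[P]_w (\sum_i L i w)%:E <= lc%:E)%E.
  apply: (@le_trans _ _ (\sum_i 1 * (lc * b i `^ p))%:E).
    apply: (integral_le_comb (c := fun=> 1) (g := L)) => //.
    - by move=> i; exact: IL.
    - move=> w _; rewrite sumr_ge0//= le_eqVlt; apply/orP; left; apply/eqP.
      by apply: eq_bigr => i _; rewrite mul1r.
  rewrite lee_fin; under eq_bigr do rewrite mul1r.
  by rewrite -mulr_sumr ler_piMr.
have msL : measurable_fun setT (fun w => \sum_i L i w) by exact: measurable_sum.
have I1A : (\int[P]_w (1 + A w)%:E <= (1 * 1 + 1 * (K + 4 * C * (K + 1)))%:E)%E.
  apply: (integral_le_comb2 (g1 := fun=> 1) _ _ _ _ _ _ mA _ eA) => //.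
  - by rewrite integral_cst//= probability_setT mule1.
  - by move=> w _; rewrite !mul1r lexx andbT addr_ge0.
have -> : s * D = s * (1 * 1 + 1 * (K + 4 * C * (K + 1))) + s * lc by rewrite /D; ring.
apply: (integral_le_comb2 _ _ _ _ _ _ msL I1A IsumL) => //.
- by move=> w _; rewrite addr_ge0.
- by move=> w _; rewrite sumr_ge0.
- exact: measurable_funD.
move=> w _; rewrite mulr_ge0 ?sqrtr_ge0//= -mulrDr ler_wpM2l//.
have sL0 : 0 <= \sum_i L i w by rewrite sumr_ge0.
have y0 : 0 <= 1 + A w + \sum_i L i w by rewrite !addr_ge0.
(* With L for the sum of the large parts, the norm will be at most A + 1 + L^2, which is below (1 +
   A + L)^2. *)
rewrite -[leRHS](ger0_norm y0) -sqrtr_sqr ler_wsqrtr//.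
(* Where the variable is at most 1 in modulus only rounding errs; elsewhere its class has value 0
   and the modulus itself is the square of the large part. *)
have term i : `|b i * theta i w - qval R (cls i w)| <= m%:R^-1 + L i w ^+ 2.
  have [t1|t1] := boolP (`|b i * theta i w| <= 1).
    apply: (@le_trans _ _ m%:R^-1); last by rewrite lerDl sqr_ge0.
    have := qval_err m0 (S1 i w); rewrite /S /small_part t1.
    by rewrite /cls /qclass /small_part t1.
  have z : qval R (cls i w) = 0 :> R.
    apply/normr0_eq0/eqP; rewrite eq_le normr_ge0 andbT.
    by apply: le_trans (qval_le m (S1 i w)) _; rewrite /S /small_part (negbTE t1) normr0.
  by rewrite z subr0 /L /large_part (negbTE t1) sqr_sqrtr// lerDr invr_ge0.
have h1 : `|\sum_i (b i * theta i w) *: u i| <= A w + (1 + (\sum_i L i w) ^+ 2).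
  have -> : \sum_i (b i * theta i w) *: u i = \sum_i qval R (cls i w) *: u i +
      \sum_i (b i * theta i w - qval R (cls i w)) *: u i.
    by rewrite -big_split/=; apply: eq_bigr => i _; rewrite -scalerDl addrC subrK.
  apply: le_trans (ler_normD _ _) _; rewrite lerD2l.
  apply: le_trans (ler_norm_sum _ _ _) _.
  apply: (@le_trans _ _ (\sum_i (m%:R^-1 + L i w ^+ 2))).
    by apply: ler_sum => i _; rewrite normrZ; apply: le_trans (term i); rewrite ler_piMr.
  rewrite big_split/= sumr_const card_ord; apply: lerD.
    by rewrite -[leLHS]mulr_natl ler_pdivrMr ?ltr0n// mul1r ler_nat.
  exact: sum_sqr_le.
apply: le_trans h1 _.
have : 0 <= A w * \sum_i L i w by rewrite mulr_ge0.
by have := sqr_ge0 (A w); have := A0 w; lra.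
Qed.

End StableSums.

Section StableType.
Context (R : realType) (E : normedModType R) (p : R).
Context d (T : measurableType d) (P : probability T R).

(** Homogeneity: write x_i = l b_i u_i with l the l^p norm of the family. The moment of order 1/2
    scales by sqrt(l), and squaring produces D^2 l. *)
Lemma sqrt_moment_stable_type (theta : nat -> T -> R) (D : R) : 1 <= p -> 0 <= D ->
  (forall n (c : R) (b : 'I_n -> R) (u : 'I_n -> E),
    0 <= c -> (forall i, 0 <= b i) -> \sum_i b i `^ p <= 1 -> (forall i, `|u i| <= 1) ->
    (\int[P]_w (c * Num.sqrt `|\sum_i (b i * theta i w) *: u i|)%:E <= (c * D)%:E)%E) ->
  forall n (x : 'I_n -> E),
  (poweR (\int[P]_w ((`|\sum_(i < n) theta i w *: x i|) `^ 2^-1)%:E) (2^-1)^-1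
    <= (D ^+ 2 * (\sum_(i < n) `|x i| `^ p) `^ p^-1)%:E)%E.
Proof.
move=> p1 D0 bnd n x.
have p0 : 0 < p by lra.
set s := \sum_(i < n) _; have s0 : 0 <= s by rewrite sumr_ge0.
have [sz|sz] := eqVneq s 0.
  have xz i : x i = 0.
    apply/normr0_eq0/eqP; have := psumr_eq0P (fun i _ => powR_ge0 `|x i| p) sz.
    by move=> /(_ i isT)/eqP; rewrite powR_eq0 => /andP[].
  rewrite (_ : (\int[P]_w _)%E = 0%E).
    by rewrite poweR0r ?invr_eq0 ?invr_eq0// lee_fin mulr_ge0 ?sqr_ge0 ?powR_ge0.
  apply: integral0_eq => w _; rewrite big1 ?normr0 ?powR0 ?invr_neq0// => i _.
  by rewrite xz scaler0.
have l0 : 0 < s `^ p^-1 by rewrite powR_gt0// lt_neqAle eq_sym sz.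
set l := s `^ p^-1 in l0 *.
have lp : l `^ p = s by rewrite -powRrM mulVf ?gt_eqF// powRr1.
pose b i := `|x i| / l.
(* For x i = 0 the convention that 0 is its own inverse gives u i = 0, which still fits the unit
   ball. *)
pose u i := `|x i|^-1 *: x i.
have b0 i : 0 <= b i by rewrite divr_ge0// ltW.
have bp : \sum_i b i `^ p <= 1.
  rewrite -(ler_pM2r (x := s)) ?lt_neqAle 1?eq_sym ?sz// mul1r mulr_suml.
  apply: ler_sum => i _; rewrite -lp -powRM ?(ltW l0)// /b divfK// gt_eqF//.
have u1 i : `|u i| <= 1.
  rewrite normrZ normfV normr_id; have [->|xi] := eqVneq (x i) 0.
    by rewrite normr0 mulr0.
  by rewrite mulVf// normr_eq0.
have xE i : x i = (l * b i) *: u i.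
  have [xi|xi] := eqVneq (x i) 0; first by rewrite /u xi !scaler0.
  by rewrite /u /b scalerA mulrCA mulfV ?gt_eqF// mulr1 divff ?normr_eq0// scale1r.
have sE w : `|\sum_(i < n) theta i w *: x i| `^ 2^-1 =
    Num.sqrt l * Num.sqrt `|\sum_i (b i * theta i w) *: u i|.
  rewrite powR12_sqrt// -sqrtrM ?(ltW l0)//; congr Num.sqrt.
  rewrite -[l in RHS](gtr0_norm l0) -normrZ scaler_sumr; congr `|_|.
  by apply: eq_bigr => i _; rewrite {1}xE !scalerA [theta i w * _]mulrC -[l * b i * _]mulrA.
have bd : (\int[P]_w ((`|\sum_(i < n) theta i w *: x i|) `^ 2^-1)%:E <= (Num.sqrt l * D)%:E)%E.
  by under eq_integral do rewrite sE; exact: bnd.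
rewrite invrK; apply: (@le_trans _ _ (poweR (Num.sqrt l * D)%:E 2)).
  by apply: gt0_ler_poweR => //; rewrite ?in_itv/= ?leey ?andbT ?lee_fin ?mulr_ge0 ?integral_ge0.
rewrite poweR_EFin powR_mulrn ?mulr_ge0// exprMn sqr_sqrtr ?(ltW l0)// mulrC lee_fin.
exact: lexx.
Qed.

End StableType.

Theorem theorem5p3 (R : realType) (E : completeNormedModType R) (alpha p : R)
  (d : measure_display) (Omega : measurableType d) (P : probability Omega R)
  (W : R -> Omega -> R) :
  0 < alpha <= 2^-1 -> 1 <= p < 2 -> alpha = p^-1 - 2^-1 ->
  brownian P W ->
  (forall phi : R -> E, holder alpha phi -> stoch_integrable P W phi) ->
  stable_type E p.
Proof.
move=> /andP[alpha0 alpha1] /andP[p1 p2] alphaE bW intW d' T Q theta stab.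
have p0 : 0 < p by lra.
have al1 : alpha <= 1 by lra.
pose a : R := 4 `^ (- alpha).
have a4 : a * 4 `^ alpha = 1 by rewrite /a powRN mulVf// gt_eqF// powR_gt0.
have h4 : 4 `^ 2^-1 = 2 :> R.
  by rewrite powR12_sqrt// -[2 in RHS](ger0_norm (ler0n R 2)) -sqrtr_sqr expr2 -natrM.
(* This is where alpha <= 1/2 enters; [scale_sum_le] depends on it. *)
have a2 : 2^-1 <= a.
  rewrite /a powRN lef_pV2 ?posrE ?powR_gt0// -[leRHS]h4.
  by apply: ler_powR => //; rewrite ler1n.
have a1 : a < 1.
  have e1 : 1 `^ alpha = 1 by rewrite powR1.
  rewrite /a powRN invf_lt1 ?powR_gt0// -[ltLHS]e1.
  by apply: gt0_ltr_powR => //; rewrite ?nnegrE// ltr1n.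
have [C [C0 bnd]] := rademacher_bound bW intW alpha0 al1 a2 a1 a4.
have rho0 : 0 < a / 2 by lra.
have rho1 : a / 2 <= 1 by lra.
have rhop : (a / 2) `^ p = 4^-1.
  (* The relation between [alpha] and [p], with 2 = 4^(1/2): -alpha - 1/2 = -1/p. *)
  have -> : a / 2 = 4 `^ (- p^-1).
    rewrite -[2]h4 -powRN -powRD ?pnatr_eq0 ?implybT//; congr (_ `^ _).
    by rewrite alphaE; lra.
  by rewrite -powRrM mulNr mulVf ?gt_eqF// powR_inv1.
have [D [D0 sD]] := stable_sum_bound rho0 rho1 C0 bnd p1 rhop stab.
exists 2^-1; split; first by apply/andP; split; lra.
by exists (D ^+ 2); exact: sqrt_moment_stable_type.
Qed.
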